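(* Let $\Omega$ be $\mathbb R^2$, $\mathbb R^2_+:=\mathbb R\times(0,\infty)$, or $\Omega_\infty:=\mathbb R\times(-1,1)$, and let $\mathbf v=(v_1,v_2)\in C^1(\bar\Omega)$ be a solution (in the sense of distributions) of $$\operatorname{div}(v_1\nabla v_2-v_2\nabla v_1)=0\quad\text{in }\Omega$$ satisfying $v_2=0$ on $\partial\Omega$ (if $\partial\Omega$ is nonempty) and $$\int_\Omega\frac{|v_1\nabla v_2-v_2\nabla v_1|^2}{|\mathbf v|^2}\,dx<\infty .$$ Assume that there is a constant $C>0$ such that for all $R>100$: $\sup_{|x|\le R}|\mathbf v(x)|\le C\sqrt{\log R}$ if $\Omega=\mathbb R^2$; $\sup_{\{x\in\mathbb R^2_+:|x|\le R\}}|\mathbf v|\le C\sqrt{\log R}$ if $\Omega=\mathbb R^2_+$; $\sup_{[-R,R]\times[-1,1]}|\mathbf v|\le C\sqrt R$ if $\Omega=\Omega_\infty$. Then the following identities hold: (i) If $\Omega=\mathbb R^2$, then $$\mathfrak k(y)=\frac1{2\pi}\int_\Omega|\mathbf v|^2\left|\nabla\left(\frac{\mathbf v}{|\mathbf v|}\right)\right|^2dx\quad\text{for a.e. }y\in S^1.$$ (ii) If $\Omega=\Omega_\infty$ or $\Omega=\mathbb R^2_+$, then $$\mathfrak k(y)=\frac1\pi\int_{\{x\in\Omega:\ \pm v_2\ge0\}}|\mathbf v|^2\left|\nabla\left(\frac{\mathbf v}{|\mathbf v|}\right)\right|^2dx\quad\text{for a.e. }y\in S^1_\pm .$$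
   Context: For $y\in S^1$, set $$\Sigma_y=\left\{x\in\Omega:|\mathbf v(x)|>0,\ \tfrac{\mathbf v(x)}{|\mathbf v(x)|}=y\right\},\qquad \mathfrak k(y)=\int_{\Sigma_y}|\mathbf v|^2\left|\nabla\left(\frac{\mathbf v}{|\mathbf v|}\right)\right|d\mathcal H^1,$$ where $\mathcal H^1$ is one-dimensional Hausdorff measure. All integrands are understood as $0$ where $\mathbf v=0$; where $\mathbf v\neq0$ one has $|\mathbf v|^2|\nabla(\mathbf v/|\mathbf v|)|^2=|v_1\nabla v_2-v_2\nabla v_1|^2/|\mathbf v|^2$ (Frobenius norm). $S^1_+$ and $S^1_-$ are the upper and lower closed semicircles; ''a.e.'' on $S^1$ is with respect to arc length. *)

(* Defs.v *)
From HB Require Import structures.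
From mathcomp Require Import all_boot all_order all_algebra.
From mathcomp Require Import all_classical all_reals all_analysis.

Set Implicit Arguments.
Unset Strict Implicit.
Unset Printing Implicit Defensive.

Import Order.TTheory GRing.Theory Num.Theory.
Import numFieldNormedType.Exports.

Local Open Scope classical_set_scope.
Local Open Scope ring_scope.

(* R * R with the Borel sigma-algebra carried by lebesgue_measure; it is
   convertible to R * R. *)
Notation borel_plane R := (measurableTypeR R * measurableTypeR R)%type.

Section plane.
Context {R : realType}.
Implicit Types (x y u w : R * R) (f phi : R * R -> R) (v : R * R -> R * R)
  (A Omega : set (R * R)).

(* The library norm on R * R is the max norm, which induces the right topology
   but not the Euclidean lengths used below. *)
Definition dot u w : R := u.1 * w.1 + u.2 * w.2.
Definition enorm u : R := Num.sqrt (dot u u).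

Definition grad f x : R * R :=
  ('D_((1 : R), (0 : R)) f x, 'D_((0 : R), (1 : R)) f x).

Definition halfplane : set (R * R) := [set x | 0 < x.2].
Definition strip : set (R * R) := [set x | -1 < x.2 < 1].

Definition disk (r : R) : set (R * R) := [set x | enorm x <= r].

(* C^1 up to the boundary of an open set: f and its partial derivatives extend
   continuously to the closure.  No boundedness is required. *)
Definition C1_closure Omega f : Prop :=
  {within closure Omega, continuous f} /\
  forall e : R * R, e = (1, 0) \/ e = (0, 1) ->
    (forall x, Omega x -> derivable f x e) /\
    exists2 g : R * R -> R, {within closure Omega, continuous g} &
      forall x, Omega x -> 'D_e f x = g x.

Fixpoint Ck (k : nat) f : Prop :=
  continuous f /\
  if k is k'.+1 then
    forall e : R * R, e = (1, 0) \/ e = (0, 1) ->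
      (forall x, derivable f x e) /\ Ck k' ('D_e f)
  else True.

Definition test_function Omega phi : Prop :=
  [/\ forall k, Ck k phi,
      compact (closure [set x | phi x != 0]) &
      closure [set x | phi x != 0] `<=` Omega].

Definition lebesgue2 : {measure set (borel_plane R) -> \bar R} :=
  (@lebesgue_measure R \x @lebesgue_measure R)%E.

Definition div_free Omega (F : R * R -> R * R) : Prop :=
  forall phi, test_function Omega phi ->
    (\int[lebesgue2]_(x in Omega) (dot (F x) (grad phi x))%:E = 0)%E.

(* The field v1 * grad v2 - v2 * grad v1. *)
Definition flux v x : R * R :=
  (v x).1 *: grad (fun z => (v z).2) x - (v x).2 *: grad (fun z => (v z).1) x.

Definition direction v x : R * R := (enorm (v x))^-1 *: v x.

(* Frobenius norm of the Jacobian matrix. *)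
Definition jacobian_norm v x : R :=
  Num.sqrt (dot (grad (fun z => (v z).1) x) (grad (fun z => (v z).1) x)
          + dot (grad (fun z => (v z).2) x) (grad (fun z => (v z).2) x)).

(* The supremum of the empty set is -oo in \bar R, hence the maximum with 0. *)
Definition diameter A : \bar R :=
  maxe 0%E (ereal_sup [set (enorm (p.1 - p.2))%:E | p in A `*` A]).

(* One-dimensional Hausdorff outer measure, with the normalisation under which
   the measure of a segment is its length.  Integrals against it only evaluate
   it on Borel sets. *)
Definition hausdorff1_delta (delta : R) A : \bar R :=
  ereal_inf [set (\sum_(0 <= i <oo) diameter (U i))%E |
    U in [set U : nat -> set (R * R) |
      A `<=` \bigcup_i U i /\ forall i, (diameter (U i) <= delta%:E)%E]].

Definition hausdorff1 (A : set (borel_plane R)) : \bar R :=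
  ereal_sup [set hausdorff1_delta delta A | delta in [set d : R | 0 < d]].

Definition circle : set (R * R) := [set y | enorm y = 1].
Definition upper_semicircle : set (R * R) := circle `&` [set y | 0 <= y.2].
Definition lower_semicircle : set (R * R) := circle `&` [set y | y.2 <= 0].

(* Image of Lebesgue measure on [0, 2 pi[ under the arc length
   parametrisation of the unit circle. *)
Definition arc_length (A : set (borel_plane R)) : \bar R :=
  lebesgue_measure [set t : R | 0 <= t < 2 * pi /\ A (cos t, sin t)].

Definition Sigma Omega v y : set (R * R) :=
  [set x | [/\ Omega x, 0 < enorm (v x) & direction v x = y]].

Definition frakk Omega v y : \bar R :=
  (\int[hausdorff1]_(x in Sigma Omega v y)
     (enorm (v x) ^+ 2 * jacobian_norm (direction v) x)%:E)%E.

(* Where v x = 0 the factor |v|^2 makes the integrand 0. *)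
Definition energy v A : \bar R :=
  (\int[lebesgue2]_(x in A)
     (enorm (v x) ^+ 2 * jacobian_norm (direction v) x ^+ 2)%:E)%E.

(* The quotient is 0 where v x = 0, because 0^-1 = 0. *)
Definition flux_energy v A : \bar R :=
  (\int[lebesgue2]_(x in A) (enorm (flux v x) ^+ 2 / enorm (v x) ^+ 2)%:E)%E.

Definition sup_norm v A : \bar R := ereal_sup [set (enorm (v x))%:E | x in A].

End plane.

(* Main.v *)
Require Import Defs.
From HB Require Import structures.
From mathcomp Require Import all_boot all_order all_algebra.
From mathcomp Require Import all_classical all_reals all_analysis.
From mathcomp Require Import measurable_realfun ring lra.
Set Implicit Arguments.
Unset Strict Implicit.
Unset Printing Implicit Defensive.
Import Order.TTheory GRing.Theory Num.Theory.
Import numFieldNormedType.Exports.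
Local Open Scope classical_set_scope.
Local Open Scope ring_scope.

(** Where [v2 != 0], put [s = v1 / v2] and [F = v1 grad v2 - v2 grad v1], so that
    [F = - v2^2 grad s] and [|v|^2 |grad (v / |v|)| = |F|].  The sets [Sigma_y] are the
    level sets of [s], and [frakk y] is [l t], the integral of [|F|] over [s = t],
    with [t = y1 / y2].  On [v2 > 0], test [div F = 0] with [eta H(s)], truncated near
    [v2 = 0]; this is legitimate as [v2] vanishes on the boundary.  For logarithmic
    cutoffs [eta] the growth bound makes the integral of [|F| |grad eta|] small, whence
    the integral of [H'(s) |F|^2 / v2^2] vanishes as soon as [H] has compact support.  By
    the coarea formula this integral is that of [H' l] over the line, so [l] is a constant
    [c] almost everywhere, and the energy on [v2 > 0], which is the integral of
    [|F|^2 / |v|^2 = |F| |grad s| / (1 + s^2)], is [c * pi].  The pair [(v1, - v2)] handles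
    [v2 < 0].  In the plane the pair [(v2, v1)] handles [v1 > 0], a set of directions
    meeting both half circles, hence the constants of the two half circles agree. *)

(** * One-dimensional Hausdorff measure *)

(** Two obstacles shape the proof. First, the equation holds against smooth functions only, while
    [eta H(s)] is merely C^1; it is approximated together with its gradient by spline sums. Second,
    [H(s)] does not tend to 0 with [v2], so a factor depending on [v2] has to truncate it. The error
    this causes disappears in the limit because [|v1| <= S v2] on the support of [H(s)], which makes
    [F] of order [v2]. Hence [H] itself, and not only [H'], must have compact support, and so [l] is
    compared on two intervals at a time: [H'] approximates a combination of two indicators with
    integral zero.

    The growth bound says in all three domains that the supremum of [|v|^2] times the area, over the
    part of the domain in a box of size [4^k], is O(k 16^k). The energies of the dyadic annuli are
    summable, so for infinitely many k the k-th one is at most e / k. By Cauchy-Schwarz a cutoff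
    with gradient in such an annulus costs O(sqrt e): the factor k is compensated exactly because
    the harmonic series diverges.

    The factor pi is the integral of 1 / (1 + t^2) over the line. *)

Lemma exists_nat_gt (R : realType) (x : R) : exists k : nat, x < k%:R.
Proof.
exists (Num.bound `|x|); apply: le_lt_trans (ler_norm x) _.
exact: archi_boundP.
Qed.

Section hausdorff_measure.
Context {R : realType}.
Implicit Types (A B X Y : set (R * R)) (d : R).
Local Open Scope ereal_scope.

Lemma diameter_ge0 A : 0 <= diameter A.
Proof. by rewrite /diameter le_max lexx. Qed.

Lemma le_diameter A B : A `<=` B -> diameter A <= diameter B.
Proof.
move=> AB; rewrite /diameter; set a := ereal_sup _; set b := ereal_sup _.
have ab : a <= b.
  apply: ge_ereal_sup => _ [p [pA1 pA2] <-]; apply: ereal_sup_ubound.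
  by exists p => //; split; exact: AB.
by rewrite ge_max !le_max lexx ab orbT.
Qed.

Lemma diameter_le A (r : R) : (0 <= r)%R ->
  (forall x y, A x -> A y -> (enorm (x - y) <= r)%R) -> diameter A <= r%:E.
Proof.
move=> r0 Ar; rewrite /diameter ge_max lee_fin r0 /=.
apply: ge_ereal_sup => _ [[x y] [/= Ax Ay] <-]; rewrite lee_fin; exact: Ar.
Qed.

Lemma enorm_le_diameter A x y : A x -> A y -> (enorm (x - y))%:E <= diameter A.
Proof.
move=> Ax Ay; rewrite /diameter le_max; apply/orP; right.
by apply: ereal_sup_ubound; exists (x, y).
Qed.

Lemma diameter0 : diameter (set0 : set (R * R)) = 0.
Proof.
by apply/eqP; rewrite eq_le diameter_ge0 andbT; exact: diameter_le.
Qed.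

Lemma hausdorff1_delta_ge0 d A : 0 <= hausdorff1_delta d A.
Proof.
apply: le_ereal_inf_tmp => _ [U _ <-]; apply: nneseries_ge0 => *.
exact: diameter_ge0.
Qed.

Lemma le_hausdorff1_delta d A B : A `<=` B ->
  hausdorff1_delta d A <= hausdorff1_delta d B.
Proof.
move=> AB; apply: ereal_inf_le_tmp => _ [U [BU Ud] <-]; exists U => //.
by split => //; exact: subset_trans BU.
Qed.

Lemma hausdorff1_delta_anti (d d' : R) A : (d <= d')%R ->
  hausdorff1_delta d' A <= hausdorff1_delta d A.
Proof.
move=> dd; apply: ereal_inf_le_tmp => _ [U [BU Ud] <-]; exists U => //.
by split => // i; apply: le_trans (Ud i) _; rewrite lee_fin.
Qed.

End hausdorff_measure.

(* The plane with every set measurable: makes [mu_ext] an infimum over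
   arbitrary countable covers. *)
Definition discrete_plane (R : realType) : Type := (R * R)%type.
HB.instance Definition _ (R : realType) := Pointed.on (discrete_plane R).
HB.instance Definition _ (R : realType) := @isMeasurable.Build default_measure_display
  (discrete_plane R) (@discrete_measurable (discrete_plane R))
  discrete_measurable0 (@discrete_measurableC _) (@discrete_measurableU _).

Section hausdorff_outer.
Context {R : realType}.
Local Open Scope ereal_scope.

(** The value [+oo] encodes the constraint on diameters, so that [mu_ext] of the gauge, an infimum
    over all countable covers, is [hausdorff1_delta]. *)
Let gauge (d : R) (U : set (discrete_plane R)) : \bar R :=
  if diameter U <= d%:E then diameter U else +oo.

Let gauge_ge0 d U : 0 <= gauge d U.
Proof. by rewrite /gauge; case: ifPn => // _; exact: diameter_ge0. Qed.

Let hausdorff1_deltaE (d : R) (A : set (R * R)) : (0 <= d)%R ->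
  hausdorff1_delta d A = mu_ext (gauge d) A.
Proof.
move=> d0; apply/eqP; rewrite eq_le; apply/andP; split.
- apply: le_ereal_inf_tmp => _ [U [_ AU] <-].
  have [Ud|] := pselect (forall i, diameter (U i) <= d%:E).
    apply: ereal_inf_lbound; exists U => //.
    by apply: eq_eseriesr => i _; rewrite /gauge Ud.
  move=> /existsNP[i /negP Ui].
  rewrite (@eseries_pinfty _ _ xpredT i) ?leey//.
  - by move=> n _; rewrite -ltNye; apply: lt_le_trans (gauge_ge0 d (U n)).
  - by rewrite /gauge (negbTE Ui).
- apply: le_ereal_inf_tmp => _ [U [AU Ud] <-].
  apply: ereal_inf_lbound; exists U; first by split.
  by apply: eq_eseriesr => i _; rewrite /gauge Ud.
Qed.

Lemma hausdorff1_delta0 (d : R) : (0 <= d)%R -> hausdorff1_delta d set0 = 0.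
Proof.
move=> d0; rewrite hausdorff1_deltaE// mu_ext0// /gauge diameter0 lee_fin d0//.
Qed.

Lemma hausdorff1_delta_sigma_subadditive (d : R) : (0 <= d)%R ->
  sigma_subadditive (hausdorff1_delta d).
Proof.
move=> d0 F; rewrite hausdorff1_deltaE//.
apply: le_trans (mu_ext_sigma_subadditive (gauge_ge0 d) F) _.
by apply: lee_nneseries => [*|i _]; rewrite ?mu_ext_ge0// hausdorff1_deltaE.
Qed.

Lemma hausdorff1_delta_le (d : R) A : (0 < d)%R ->
  hausdorff1_delta d A <= hausdorff1 A.
Proof. by move=> d0; apply: ereal_sup_ubound; exists d. Qed.

Lemma hausdorff1_ge0 (A : set (R * R)) : 0 <= hausdorff1 A.
Proof.
exact: le_trans (hausdorff1_delta_ge0 1 A) (hausdorff1_delta_le A ltr01).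
Qed.

Lemma hausdorff1_0 : hausdorff1 (set0 : set (R * R)) = 0.
Proof.
apply/eqP; rewrite eq_le hausdorff1_ge0 andbT.
apply: ge_ereal_sup => _ [d /= d0 <-]; rewrite hausdorff1_delta0//; exact: ltW.
Qed.

Lemma le_hausdorff1 (A B : set (R * R)) : A `<=` B -> hausdorff1 A <= hausdorff1 B.
Proof.
move=> AB; apply: ge_ereal_sup => _ [d /= d0 <-].
exact: le_trans (le_hausdorff1_delta d AB) (hausdorff1_delta_le B d0).
Qed.

Lemma hausdorff1_sigma_subadditive : sigma_subadditive (@hausdorff1 R).
Proof.
move=> F; apply: ge_ereal_sup => _ [d /= d0 <-].
apply: le_trans (hausdorff1_delta_sigma_subadditive (ltW d0) F) _.
apply: lee_nneseries => [*|i _]; rewrite ?hausdorff1_delta_ge0//.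
exact: hausdorff1_delta_le.
Qed.

HB.instance Definition _ := isOuterMeasure.Build R (R * R)%type
  (@hausdorff1 R : set (R * R) -> \bar R) hausdorff1_0 hausdorff1_ge0 le_hausdorff1
  hausdorff1_sigma_subadditive.

End hausdorff_outer.

Section hausdorff_caratheodory.
Context {R : realType}.
Local Open Scope ereal_scope.
Variable p : R * R -> R.
Hypothesis p_lip : forall x y, (`|p x - p y| <= enorm (x - y))%R.
Notation H := (@hausdorff1 R).

Lemma hausdorff1_separated (a b : R) (X Y Z : set (R * R)) : (a < b)%R ->
  (forall x, X x -> p x <= a)%R -> (forall y, Y y -> b <= p y)%R ->
  X `<=` Z -> Y `<=` Z -> H X + H Y <= H Z.
Proof.
move=> ab Xa Yb XZ YZ.
(* A set of diameter less than [b - a] meets at most one of [X] and [Y]. *)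
have key d : (0 < d)%R -> (d < b - a)%R ->
    hausdorff1_delta d X + hausdorff1_delta d Y <= hausdorff1_delta d Z.
  move=> d0 dab; apply: le_ereal_inf_tmp => _ [U [ZU Ud] <-].
  pose V i := if pselect (exists x, U i x /\ X x) then U i else set0.
  pose W i := if pselect (exists x, U i x /\ X x) then set0 else U i.
  have -> : \sum_(0 <= i <oo) diameter (U i) =
      \sum_(0 <= i <oo) diameter (V i) + \sum_(0 <= i <oo) diameter (W i).
    rewrite -nneseriesD//; try by move=> *; exact: diameter_ge0.
    apply: eq_eseriesr => i _; rewrite /V /W; case: pselect => ?;
      by rewrite diameter0 ?adde0 ?add0e.
  apply: leeD; apply: ereal_inf_lbound.
  - exists V => //; split.
      move=> x Xx; have [i _ Ui] := ZU _ (XZ _ Xx); exists i => //.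
      by rewrite /V; case: pselect => // -[]; exists x.
    by move=> i; rewrite /V; case: pselect => ? /=; [exact: Ud|rewrite diameter0 lee_fin ltW].
  - exists W => //; split.
      move=> y Yy; have [i _ Ui] := ZU _ (YZ _ Yy); exists i => //.
      rewrite /W; case: pselect => // -[x [Ux Xx]].
      have := enorm_le_diameter Ui Ux => /le_trans /(_ (Ud i)).
      rewrite lee_fin => /(le_trans (p_lip _ _)) yx.
      have := Xa _ Xx; have := Yb _ Yy; move: yx; rewrite ler_norml.
      by move=> /andP[]; lra.
    by move=> i; rewrite /W; case: pselect => ? /=; [rewrite diameter0 lee_fin ltW|exact: Ud].
(* [hausdorff1_delta] is nonincreasing in the scale, so one scale below [d], [e] and [b - a] gives
   the bound for independent [d] and [e]. The two suprema can then be taken one after the other. *)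
have key2 d e : (0 < d)%R -> (0 < e)%R ->
    hausdorff1_delta d X + hausdorff1_delta e Y <= H Z.
  move=> d0 e0; set m := Num.min (Num.min d e) ((b - a) / 2)%R.
  have m0 : (0 < m)%R by rewrite !lt_min d0 e0 /= divr_gt0// subr_gt0.
  have mab : (m < b - a)%R.
    by rewrite gt_min; apply/orP; right; lra.
  apply: le_trans (hausdorff1_delta_le Z m0); apply: le_trans (key _ m0 mab).
  by apply: leeD; apply: hausdorff1_delta_anti; rewrite !ge_min lexx ?orbT.
case: (H Z) key2 => [z| |] key2; last 2 first.
  by rewrite leey.
  have := key2 1%R 1%R ltr01 ltr01; rewrite leeNy_eq => /eqP h.
  by have := adde_ge0 (hausdorff1_delta_ge0 1 X) (hausdorff1_delta_ge0 1 Y);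
    rewrite h.
have fY e : (0 < e)%R -> hausdorff1_delta e Y \is a fin_num.
  move=> e0; rewrite ge0_fin_numE ?hausdorff1_delta_ge0//.
  apply: le_lt_trans (ltry z); apply: le_trans (key2 _ _ ltr01 e0).
  by rewrite leeDr// hausdorff1_delta_ge0.
have HX e : (0 < e)%R -> H X <= z%:E - hausdorff1_delta e Y.
  move=> e0; apply: ge_ereal_sup => _ [d /= d0 <-].
  by rewrite leeBrDr ?fY//; exact: key2.
have fX : H X \is a fin_num.
  rewrite ge0_fin_numE ?hausdorff1_ge0//.
  by apply: le_lt_trans (HX _ ltr01) _; rewrite -(fineK (fY _ ltr01)) ltry.
rewrite addeC -leeBrDr//; apply: ge_ereal_sup => _ [d /= d0 <-].
by rewrite leeBrDr// addeC -leeBrDr ?fY// HX.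
Qed.

(** Carathéodory's argument for metric outer measures. The part of [X] above the level [r] is cut
    into slices [Rg k] at the heights [r + 1 / (k + 1)]. Slices with indices of equal parity are
    separated, so the measures of all slices sum to at most [2 H(X)], and the slices close to the
    level have small total measure. *)
Lemma caratheodory_le (r : R) : H.-caratheodory [set x | (p x <= r)%R].
Proof.
apply: le_caratheodory_measurable => X /=.
have [->|Xfin] := eqVneq (H X) +oo; first by rewrite leey.
pose a (k : nat) : R := (r + k.+1%:R^-1)%R.
have aS k : (a k.+1 < a k)%R.
  by rewrite /a ltrD2l ltf_pV2 ?posrE ?ltr0n// ltr_nat.
have ar k : (r < a k)%R by rewrite /a ltrDl invr_gt0 ltr0n.
pose Rg k := X `&` [set x | (a k.+1 <= p x < a k)%R].
have sumRg (q m : nat) : \sum_(k < m) H (Rg (k.*2 + q).+1) <=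
    H (X `&` [set x | (a (m.*2 + q)%N <= p x)%R]).
  elim: m => [|m IH]; first by rewrite big_ord0 hausdorff1_ge0.
  rewrite big_ord_recr /= doubleS !addSn addeC.
  apply: le_trans (leeD2l _ IH) _.
  rewrite addeC [leLHS]addeC; apply: (@hausdorff1_separated (a (m.*2 + q).+1) (a (m.*2 + q)%N)) => //.
  - by move=> x [_ /=/andP[_ /ltW]].
  - by move=> x [_ /=].
  - by move=> x [Xx /andP[]].
  - move=> x [Xx /= h]; split => //=; apply: le_trans h.
    exact: le_trans (ltW (aS _)) (ltW (aS _)).
have sumRgX (q m : nat) : \sum_(k < m) H (Rg (k.*2 + q).+1) <= H X.
  by apply: le_trans (sumRg q m) _; apply: le_hausdorff1 => x [].
have sum2 m : \sum_(k < m.*2) H (Rg k.+1) <= H X + H X.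
  have -> : \sum_(k < m.*2) H (Rg k.+1) = \sum_(k < m) H (Rg (k.*2 + 0).+1) +
      \sum_(k < m) H (Rg (k.*2 + 1).+1).
    elim: m => [|m IH]; first by rewrite double0 !big_ord0 adde0.
    rewrite doubleS !big_ord_recr /= IH addn0 addn1.
    by rewrite -!addeA; congr (_ + _); rewrite addeCA.
  exact: leeD.
have HXf : H X \is a fin_num by rewrite ge0_fin_numE ?hausdorff1_ge0// ltey.
have sumlt : \sum_(0 <= k <oo) H (Rg k.+1) < +oo.
  apply: (@le_lt_trans _ _ (H X + H X)); last first.
    by rewrite -(fineK HXf) -EFinD ltry.
  apply: lime_le.
    by apply: is_cvg_nneseries => *; exact: hausdorff1_ge0.
  near=> n; apply: le_trans (sum2 n); rewrite big_mkord.
  rewrite -(big_mkord xpredT (fun k => H (Rg k.+1))) -(big_mkord xpredT (fun k => H (Rg k.+1))).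
  apply: lee_sum_nneg_natr => // [*|]; first exact: hausdorff1_ge0.
  by rewrite -addnn leq_addr.
have tail := nneseries_tail_cvg sumlt (fun k _ => hausdorff1_ge0 _).
apply/lee_addgt0Pr => e e0.
have /tail : nbhs (0 : \bar R) [set u | u < e%:E].
  apply: open_nbhs_nbhs; split; first exact: open_ereal_lt_ereal.
  by rewrite /= lte_fin.
move=> [N _ /(_ N (leqnn N)) tN].
(* Above the level [r], [X] consists of the part of height at least [a N.+1], which is separated
   from the sublevel set, and of the slices in the tail, whose total measure is below [e]. *)
have Ysub : X `&` ~` [set x | (p x <= r)%R] `<=`
   (X `&` [set x | (a N.+1 <= p x)%R]) `|` \bigcup_(k in ~` `I_N) Rg k.+1.
  move=> x [Xx /= /negP]; rewrite -ltNge => rx.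
  have [h|h] := leP (a N.+1) (p x); [by left|right].
  have [k kx] : exists k, (a k.+1 <= p x)%R.
    have [k kx] := exists_nat_gt (p x - r)^-1.
    exists k; rewrite /a -lerBrDl -[leRHS]invrK lef_pV2 ?posrE ?ltr0n ?invr_gt0 ?subr_gt0//.
    by rewrite (le_trans (ltW kx))// ler_nat -addn2 leq_addr.
  have [m mx mmin] := ex_minnP (ex_intro (fun k => (a k.+1 <= p x)%R) k kx).
  have Nm : (N < m)%N.
    rewrite ltnNge; apply/negP => mN.
    suff : (a N.+1 <= a m.+1)%R by move=> /le_trans/(_ mx); rewrite leNgt h.
    by rewrite /a lerD2l lef_pV2 ?posrE ?ltr0n// ler_nat !ltnS.
  exists m.-1 => /=; first by apply/negP; rewrite -leqNgt -ltnS (ltn_predK Nm).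
  rewrite /Rg (ltn_predK Nm); split => //=; rewrite mx /= ltNge.
  apply/negP => mx'; have : (m <= m.-1)%N.
    by apply: mmin; rewrite (ltn_predK Nm).
  by case: (m) Nm => // n _; rewrite /= ltnn.
apply: (@le_trans _ _ (H (X `&` [set x | (p x <= r)%R]) +
   (H (X `&` [set x | (a N.+1 <= p x)%R]) + e%:E))).
  apply: leeD2l; apply: le_trans (le_hausdorff1 Ysub) _.
  apply: le_trans (outer_measureU2 _ _ _) _; apply: leeD2l.
  apply: le_trans (outer_measure_sigma_subadditive_tail _ _ _) _.
  exact: ltW.
rewrite addeA; apply: leeD2r; apply: (@hausdorff1_separated r (a N.+1)) => //; by move=> x [].
Unshelve. all: by end_near. Qed.

Lemma caratheodory_preimage (B : set (measurableTypeR R)) : measurable B ->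
  H.-caratheodory (p @^-1` B).
Proof.
rewrite RGenInftyO.measurableE.
apply: (@smallest_sub _ _ _ (fun B => H.-caratheodory (p @^-1` B))).
  split => /=.
  - by rewrite preimage_set0; exact: caratheodory_measurable_set0.
  - by move=> A mA; rewrite setTD preimage_setC; exact: caratheodory_measurable_setC.
  - by move=> F mF; rewrite preimage_bigcup; exact: caratheodory_measurable_bigcup.
move=> _ [x ->] /=.
have -> : p @^-1` `]-oo, x[ = \bigcup_k [set y | (p y <= x - k.+1%:R^-1)%R].
  apply/seteqP; split => y /=; rewrite in_itv /=.
    move=> yx.
    have [k kx] := exists_nat_gt (x - p y)^-1.
    exists k => //=; rewrite lerBrDl -lerBrDr -[leRHS]invrK lef_pV2 ?posrE ?ltr0n ?invr_gt0 ?subr_gt0//.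
    by rewrite (le_trans (ltW kx))// ler_nat.
  move=> [k _ /= /le_lt_trans]; apply; by rewrite gtrBl invr_gt0 ltr0n.
by apply: caratheodory_measurable_bigcup => k; exact: caratheodory_le.
Qed.

End hausdorff_caratheodory.

Section hausdorff_borel.
Context {R : realType}.
Implicit Types x y : R * R.

Lemma enorm_ge0 x : 0 <= enorm x.
Proof. exact: sqrtr_ge0. Qed.

Lemma sqr_enorm x : enorm x ^+ 2 = x.1 ^+ 2 + x.2 ^+ 2.
Proof. by rewrite /enorm sqr_sqrtr /dot -?expr2// addr_ge0 ?sqr_ge0. Qed.

Lemma norm_fst_enorm x : `|x.1| <= enorm x.
Proof.
rewrite -ler_sqr ?nnegrE ?enorm_ge0// sqr_enorm real_normK ?num_real//.
by rewrite lerDl sqr_ge0.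
Qed.

Lemma norm_snd_enorm x : `|x.2| <= enorm x.
Proof.
rewrite -ler_sqr ?nnegrE ?enorm_ge0// sqr_enorm real_normK ?num_real//.
by rewrite lerDr sqr_ge0.
Qed.

(** The product sigma-algebra is generated by preimages under the two coordinates, and these are
    1-Lipschitz for the Euclidean distance. *)
Lemma borel_caratheodory (A : set (borel_plane R)) : measurable A ->
  (@hausdorff1 R).-caratheodory A.
Proof.
apply: smallest_sub.
  split => /=; first exact: caratheodory_measurable_set0.
  - by move=> B mB; rewrite setTD; exact: caratheodory_measurable_setC.
  - by move=> F mF; exact: caratheodory_measurable_bigcup.
move=> _ [] [B mB <-]; rewrite setTI; apply: caratheodory_preimage => //.
- by move=> x y; rewrite (le_trans _ (norm_fst_enorm _)).
- by move=> x y; rewrite (le_trans _ (norm_snd_enorm _)).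
Qed.

Lemma hausdorff1_semi_sigma_additive :
  semi_sigma_additive (@hausdorff1 R : set (borel_plane R) -> \bar R).
Proof.
move=> F mF tF mUF; apply: caratheodory_measure_sigma_additive => //.
- by move=> i; exact: borel_caratheodory.
- exact: borel_caratheodory.
Qed.

HB.instance Definition _ := isMeasure.Build _ (borel_plane R) R
  (@hausdorff1 R) hausdorff1_0 hausdorff1_ge0 hausdorff1_semi_sigma_additive.


End hausdorff_borel.

(** * Disintegration and densities *)

(** Localisation: an identity between measures is checked inside the pieces of a countable cover.
    The pieces have to be made disjoint first, which is why [P] is asked of all measurable subsets
    of each piece. *)
Lemma countable_cover_ind d (T : measurableType d) (P : set T -> Prop)
    (N : nat -> set T) :
  (forall i, measurable (N i)) ->
  (forall i A, measurable A -> A `<=` N i -> P A) ->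
  (forall F : nat -> set T, (forall i, measurable (F i)) -> trivIset setT F ->
     (forall i, P (F i)) -> P (\bigcup_i F i)) ->
  forall A, measurable A -> A `<=` \bigcup_i N i -> P A.
Proof.
move=> mN PN PU A mA AN.
have -> : A = \bigcup_i (A `&` seqDU N i).
  by rewrite -setI_bigcupr -seqDU_bigcup_eq; apply/esym/setIidPl.
have mD i : measurable (seqDU N i).
  by apply: measurableD => //; apply: bigsetU_measurable.
apply: PU => [i||i]; first exact: measurableI.
- by apply: trivIset_setIl; exact: trivIset_seqDU.
- apply: (PN i); first exact: measurableI.
  by move=> x [_]; exact: subset_seqDU.
Qed.

Section density.
Context d (T : measurableType d) (R : realType).
Variables (mu : {measure set T -> \bar R}) (f : T -> \bar R).
Hypotheses (mf : measurable_fun setT f) (f0 : forall x, (0 <= f x)%E).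

(** The two proofs are arguments so that the measure structure declared below can be inferred from
    the term itself. *)
Definition density of measurable_fun setT f & (forall x, (0 <= f x)%E) :=
  fun A : set T => (\int[mu]_(x in A) f x)%E.

Let density0 : density mf f0 set0 = 0%E.
Proof. exact: integral_set0. Qed.

Let density_ge0 A : (0 <= density mf f0 A)%E.
Proof. exact: integral_ge0. Qed.

Let density_sigma_additive : semi_sigma_additive (density mf f0).
Proof.
move=> F mF tF mUF; rewrite /density ge0_integral_bigcup//; last first.
  exact: measurable_funTS.
apply: is_cvg_nneseries => n _ _; exact: integral_ge0.
Qed.

HB.instance Definition _ := isMeasure.Build _ _ _ (density mf f0)
  density0 density_ge0 density_sigma_additive.
End density.

Section disintegration.
Context d d' (T : measurableType d) (Y : measurableType d') (R : realType).
Variables (mu : {measure set T -> \bar R}) (la : {measure set Y -> \bar R}).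
Variable k : Y -> {measure set T -> \bar R}.
Hypothesis mk : forall A, measurable A -> measurable_fun setT (fun y => k y A).
Hypothesis muE : forall A, measurable A -> mu A = (\int[la]_y k y A)%E.
Local Open Scope ereal_scope.
Import HBNNSimple.

Lemma disintegration_measurable (f : T -> \bar R) : measurable_fun setT f ->
  (forall x, 0 <= f x) -> measurable_fun setT (fun y => \int[k y]_x f x).
Proof.
move=> mf f0; pose h := nnsfun_approx measurableT mf.
apply: (@measurable_fun_preimage_integral _ _ _ _ _ f h).
- by move=> m n mn; exact/nd_nnsfun_approx.
- by move=> z _; exact: cvg_nnsfun_approx.
- by move=> n r; exact: mk.
Qed.

Let disintegration_nnsfun (h : {nnsfun T >-> R}) :
  \int[mu]_x (h x)%:E = \int[la]_y \int[k y]_x (h x)%:E.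
Proof.
rewrite integralT_nnsfun sintegralE.
under [RHS]eq_integral do rewrite integralT_nnsfun sintegralE.
rewrite ge0_integral_fsum//.
- apply: eq_fsbigr => r /[!inE] -[t _ <-].
  by rewrite ge0_integralZl//; [rewrite muE|exact: mk|rewrite lee_fin fun_ge0].
- by move=> r; apply: measurable_funeM; exact: mk.
- move=> r y _; exact: nnsfun_mulemu_ge0.
Qed.

(** Simple functions first, then monotone limits. With [k y] the Hausdorff measure on a level set,
    this passes from the coarea formula for sets to the one for functions. *)
Lemma disintegration (f : T -> \bar R) : measurable_fun setT f ->
  (forall x, 0 <= f x) -> \int[mu]_x f x = \int[la]_y \int[k y]_x f x.
Proof.
move=> mf f0; pose h := nnsfun_approx measurableT mf.
have hf x : f x = limn (fun n => (h n x)%:E).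
  by apply/esym/cvg_lim => //; apply: cvg_nnsfun_approx.
have hnd x : {homo (fun n => (h n x)%:E) : m n / (m <= n)%N >-> m <= n}.
  by move=> m n mn; rewrite lee_fin; exact/lefP/nd_nnsfun_approx.
have mh n : measurable_fun setT (fun x => (h n x)%:E).
  by apply/measurable_EFinP.
have h0 n x : 0 <= (h n x)%:E by rewrite lee_fin.
under eq_integral do rewrite hf.
rewrite (monotone_convergence mu measurableT mh (fun n x _ => h0 n x) (fun x _ => hnd x)).
under [RHS]eq_integral => y _.
  under eq_integral do rewrite hf.
  rewrite (monotone_convergence (k y) measurableT mh (fun n x _ => h0 n x) (fun x _ => hnd x)).
  over.
rewrite (monotone_convergence la measurableT); last 3 first.
- by move=> n; apply: disintegration_measurable.
- by move=> n y _; exact: integral_ge0.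
- move=> y _ m n mn; apply: ge0_le_integral => //.
  by move=> x _; exact: hnd.
by congr (limn _); apply/funext => n; exact: disintegration_nnsfun.
Qed.

End disintegration.

Section ge0_integral_density.
Context d (T : measurableType d) (R : realType).
Variables (mu : {measure set T -> \bar R}) (r : T -> R).
Hypotheses (mr : measurable_fun setT (fun x => (r x)%:E))
  (r0 : forall x, (0 <= (r x)%:E)%E).
Local Open Scope ereal_scope.

(** A density is a disintegration along the kernel that sends [y] to [r y] times the Dirac mass at
    [y]. *)
Lemma ge0_integral_density (g : T -> \bar R) : measurable_fun setT g ->
  (forall x, 0 <= g x) ->
  \int[density mu mr r0]_x g x = \int[mu]_x ((r x)%:E * g x).
Proof.
move=> mg g0.
have r0' x : (0 <= r x)%R by rewrite -lee_fin.
pose k y : {measure set T -> \bar R} := mscale (NngNum (r0' y)) (dirac y).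
have kE y A : k y A = (r y)%:E * (\1_A y)%:E.
  by rewrite /k /= /mscale /= /dirac.
rewrite (@disintegration _ _ _ _ _ (density mu mr r0) mu k)//.
- apply: eq_integral => y _; rewrite ge0_integral_mscale//=.
  by rewrite integral_dirac// diracT mul1e.
- move=> A mA; under eq_fun do rewrite kE; apply: emeasurable_funM => //.
  exact/measurable_EFinP/measurable_indic.
- move=> A mA; rewrite /density/= [LHS]integral_mkcond.
  apply: eq_integral => y _; rewrite kE /patch indicE.
  by case: ifPn => _; rewrite ?mule1 ?mule0.
Qed.

End ge0_integral_density.

Lemma ge0_integral_mrestr d (T : measurableType d) (R : realType)
    (mu : {measure set T -> \bar R}) (D : set T) (mD : measurable D)
    (f : T -> \bar R) : measurable_fun setT f -> (forall x, 0 <= f x)%E ->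
  (\int[mrestr mu mD]_x f x = \int[mu]_(x in D) f x)%E.
Proof.
move=> mf f0; rewrite -(setUv D) ge0_integral_setU//; last 3 first.
- exact: measurableC.
- by rewrite setUv.
- exact/disj_setPCl.
rewrite [X in (_ + X)%E](_ : _ = 0%E) ?adde0; last first.
  apply: null_set_integral; [exact: measurableC|exact: measurable_funTS|].
  by change (mu (~` D `&` D) = 0%E); rewrite setICl measure0.
apply: eq_measure_integral => A mA AD.
by change (mu (A `&` D) = mu A); congr (mu _); exact/setIidPl.
Qed.

(** * Measures with a continuous density on an interval *)

Section area.
Context (R : realType).
Notation leb := (@lebesgue_measure R).
Variables (a b : R) (rho : R -> R)
  (nu : {measure set (measurableTypeR R) -> \bar R}).
Hypothesis rho_cont : forall x, a < x < b -> {for x, continuous rho}.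
Hypothesis rho_ge0 : forall x, a < x < b -> 0 <= rho x.
Hypothesis nu_fin : forall s t, a < s -> t < b -> (nu `]s, t]%classic < +oo)%E.
Hypothesis nu_rho : forall x e, a < x < b -> 0 < e -> exists2 del, 0 < del &
  forall s t, x - del < s -> s < t -> t < x + del ->
    (((rho x - e) * (t - s))%:E <= nu `]s, t]%classic <= ((rho x + e) * (t - s))%:E)%E.

Let nufin s t : a < s -> t < b -> nu `]s, t]%classic \is a fin_num.
Proof.
move=> sa tb; by rewrite ge0_fin_numE//; exact: nu_fin.
Qed.

Let nuD s t u : a < s -> u < b -> s <= t -> t <= u ->
  fine (nu `]s, u]%classic) = fine (nu `]s, t]%classic) + fine (nu `]t, u]%classic).
Proof.
move=> sa ub st tu; rewrite -fineD ?nufin ?(lt_le_trans sa)// ?(le_lt_trans _ ub)//.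
rewrite -measureU//; last first.
  apply/seteqP; split => // x [] /=; rewrite !in_itv/= => /andP[_ xt] /andP[].
  by rewrite ltNge xt.
by rewrite -itv_bndbnd_setU// bnd_simp.
Qed.

Let area_itv s t : a < s -> s <= t -> t < b ->
  nu `]s, t]%classic = (\int[leb]_(x in `]s, t]) (rho x)%:E)%E.
Proof.
move=> sa; rewrite le_eqVlt => /predU1P[<- _|st tb].
  by rewrite set_itvoc0// measure0 integral_set0.
(* The base point [c] of the distribution function lies strictly to the left of [s], so that [N] is
   differentiable at the end point [s] as well. *)
have [c /andP[ac cs]] : exists c, a < c < s by exists ((a + s) / 2); lra.
pose N x := fine (nu `]c, x]%classic).
have dN x : c < x -> x < b -> is_derive x 1 N (rho x).
  move=> cx xb; have xab : a < x < b by rewrite (lt_trans ac cx) xb.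
  apply/is_derive1_caratheodory.
  exists (fun z => if z == x then rho x else (N z - N x) / (z - x)); split.
  - move=> z; case: eqVneq => [->|zx]; first by rewrite !subrr mulr0.
    by rewrite divfK// subr_eq0.
  - apply/cvgrPdist_le => e e0; rewrite eqxx.
    have [del del0 H] := nu_rho xab e0.
    near=> z; case: eqVneq => [_|zx]; first by rewrite subrr normr0 ltW.
    have : `|x - z| < Num.min del (Num.min (x - c) (b - x)).
      by near: z; exists (Num.min del (Num.min (x - c) (b - x))) => //=;
        rewrite !lt_min !subr_gt0 del0 cx.
    rewrite !lt_min => /andP[zdel /andP[]].
    rewrite !ltr_distlC => /andP[zc _] /andP[_ zb].
    have {}zc : c < z by lra.
    have {}zb : z < b by lra.
    have key u v : c < u -> u < v -> v < b -> x - del < u -> v < x + del ->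
        `|rho x - (N v - N u) / (v - u)| <= e.
      move=> cu uv vb xu vx; have := H u v xu uv vx.
      have -> : N v - N u = fine (nu `]u, v]%classic).
        by rewrite /N (@nuD c u v)// ?(ltW cu) ?(ltW uv)// addrC addKr.
      rewrite -(fineK (@nufin u v _ _)) ?(lt_trans ac)//= !lee_fin.
      have vu : 0 < v - u by rewrite subr_gt0.
      move=> /andP[]; rewrite -ler_pdivlMr// => h1; rewrite -ler_pdivrMr// => h2.
      by rewrite ler_distlC h1 h2.
    have /andP[z1 z2] : x - del < z < x + del by rewrite -ltr_distlC.
    case: (ltgtP z x) zx => // zx _.
    + rewrite -[(_ / _)]divrNN !opprB; apply: key => //; lra.
    + apply: key => //; lra.
  - by rewrite eqxx.
have stI x : x \in `[s, t] -> c < x /\ x < b.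
  by rewrite in_itv/= => /andP[sx xt]; split; [exact: lt_le_trans sx|exact: le_lt_trans tb].
have cN x : x \in `[s, t] -> {for x, continuous N}.
  move=> /stI[cx xb]; apply: differentiable_continuous; apply/derivable1_diffP.
  by have [] := dN _ cx xb.
have := @continuous_FTC2 R rho N s t st.
rewrite integral_itv_obnd_cbnd; last first.
  apply/measurable_EFinP; apply: subspace_continuous_measurable_fun => //.
  apply: continuous_in_subspaceT => x /[!inE] /= xst.
  have /stI[cx xb] : x \in `[s, t] by apply: subset_itv_oc_cc.
  by apply: rho_cont; rewrite (lt_trans ac cx) xb.
move=> ->.
- rewrite -EFinB /N (@nuD c s t)//; last 2 first.
  + exact: ltW.
  + exact: ltW.
  by rewrite addrC addKr fineK// nufin.
- apply: continuous_in_subspaceT => x /[!inE] /= /stI[cx xb].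
  by apply: rho_cont; rewrite (lt_trans ac cx) xb.
- split.
  + move=> x /subset_itv_oo_cc /stI[cx xb]; by have [] := dN _ cx xb.
  + by apply: cvg_at_right_filter; apply: cN; rewrite in_itv/= lexx ltW.
  + by apply: cvg_at_left_filter; apply: cN; rewrite in_itv/= lexx ltW.
- move=> x /subset_itv_oo_cc /stI[cx xb]; rewrite derive1E.
  by have [_ ->] := dN _ cx xb.
Unshelve. all: by end_near. Qed.

Let rho0 x := if a < x < b then rho x else 0.

Let mrho : measurable_fun setT (fun x : measurableTypeR R => (rho0 x)%:E).
Proof.
apply/measurable_EFinP.
have -> : rho0 = rho \_ `]a, b[.
  by apply/funext => x; rewrite /rho0 /patch mem_setE in_itv.
apply: (@measurable_restrictT _ _ (measurableTypeR R) (measurableTypeR R) `]a, b[%classic rho _).1 => //.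
apply: subspace_continuous_measurable_fun => //.
apply: continuous_in_subspaceT => x /[!inE] /=; rewrite in_itv/= => xab.
exact: rho_cont.
Qed.

Let rho0_ge0 x : (0 <= (rho0 x)%:E)%E.
Proof. by rewrite lee_fin /rho0; case: ifPn => // /rho_ge0. Qed.

Let kap := density leb mrho rho0_ge0.

(* [rho] is the derivative of the distribution function of [nu]. *)
Lemma area (E : set (measurableTypeR R)) : measurable E -> E `<=` `]a, b[ ->
  nu E = (\int[leb]_(x in E) (rho x)%:E)%E.
Proof.
move=> mE Eab.
suff : nu E = kap E.
  move=> ->; rewrite /kap /density; apply: eq_integral => x /[!inE] /Eab /=.
  by rewrite in_itv/= /rho0 => ->.
(* Uniqueness of measures needs finite mass on the pieces, and [nu] is known to be finite only away
   from the end points [a] and [b]. *)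
pose I k : set (measurableTypeR R) := `]a + k.+1%:R^-1, b - k.+1%:R^-1]%classic.
apply: (@countable_cover_ind _ _ (fun E => nu E = kap E) I) => //.
- by move=> k; exact: measurable_itv.
- move=> k A mA Ak.
  pose c := a + k.+1%:R^-1; pose d := b - k.+1%:R^-1.
  have mI : measurable (`]c, d]%classic : set (measurableTypeR R)) by [].
  have EA : A `&` `]c, d]%classic = A by exact/setIidPl.
  suff : mrestr nu mI A = mrestr kap mI A by rewrite /mrestr EA.
  have ac : a < c by rewrite /c ltrDl invr_gt0.
  have db : d < b by rewrite /d gtrBl invr_gt0.
  apply: (@measure_unique _ R (measurableTypeR R) (@ocitv R)
    (fun k => `](- k%:R), k%:R]%classic) erefl (@ocitvI R) (fun k => is_ocitv _ _) _
    (mrestr nu mI) (mrestr kap mI)) => //.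
  + apply/seteqP; split => // x _; have [n nx] := exists_nat_gt `|x|.
    exists n => //=; rewrite in_itv/=; move: nx; rewrite ltr_norml => /andP[-> /ltW ->//].
  + move=> _ [[u v] _ <-] /=.
    rewrite /mrestr.
    have -> : `]u, v]%classic `&` `]c, d] = `]Num.max u c, Num.min v d]%classic.
      apply/seteqP; split => x /=; rewrite !in_itv/= gt_max le_min.
        by move=> [/andP[-> ->] /andP[-> ->]].
      by move=> /andP[/andP[-> ->] /andP[-> ->]].
    have [h|h] := leP (Num.max u c) (Num.min v d); last first.
      rewrite (_ : [set` _] = set0) ?measure0//.
      by apply: set_itv_ge; rewrite bnd_simp -leNgt ltW.
    have h1 : a < Num.max u c by rewrite lt_max ac orbT.
    have h2 : Num.min v d < b by rewrite gt_min db orbT.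
    rewrite area_itv// /kap /density; apply: eq_integral => x /[!inE] /=.
    rewrite in_itv/= /rho0 => /andP[x1 x2].
    by rewrite (lt_trans h1 x1) (le_lt_trans x2 h2).
  + move=> n; apply: le_lt_trans (nu_fin ac db).
    by apply: le_measure; rewrite ?inE//; apply: measurableI.
- move=> F mF tF FP; rewrite /kap measure_bigcup// [RHS]measure_bigcup//.
  by apply: eq_eseriesr => i _; exact: FP.
- move=> x /Eab /=; rewrite in_itv/= => /andP[ax xb].
  have m0 : 0 < Num.min (x - a) (b - x) by rewrite lt_min !subr_gt0 ax xb.
  have [k kx] := exists_nat_gt (Num.min (x - a) (b - x))^-1.
  exists k => //; rewrite /I /= in_itv/=.
  have : k.+1%:R^-1 < Num.min (x - a) (b - x).
    rewrite -[ltRHS]invrK ltf_pV2 ?posrE ?invr_gt0//.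
    by apply: lt_trans kx _; rewrite ltr_nat.
  rewrite lt_min => /andP[h1 h2].
  by rewrite -ltrBrDl h1 /= lerBrDl -lerBrDr ltW.
Qed.

End area.

(** * Hausdorff measure of arcs with controlled chords *)

Section chords.
Context {R : realType}.
Variables (G : R -> R * R) (s t : R).
Hypothesis st : s < t.
Local Open Scope ereal_scope.

(** The images of [n.+1] equal subintervals of length [h] have diameter at most [M h]. They form an
    admissible cover once [M h <= del], and their diameters add up to [M (t - s)]. *)
Lemma hausdorff1_image_le (M : R) : (0 <= M)%R ->
  (forall u w, u \in `]s, t]%R -> w \in `]s, t]%R ->
     (enorm (G u - G w) <= M * `|u - w|)%R) ->
  hausdorff1 (G @` `]s, t]) <= (M * (t - s))%:E.
Proof.
move=> M0 GM; apply: ge_ereal_sup => _ [del /= del0 <-].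
have [n nM] := exists_nat_gt (M * (t - s) / del)%R.
pose h := ((t - s) / n.+1%:R)%R.
have h0 : (0 < h)%R by rewrite divr_gt0 ?subr_gt0.
have hn : (n.+1%:R * h = t - s)%R by rewrite /h mulrC divfK.
have Mh : (M * h <= del)%R.
  rewrite /h mulrA ler_pdivrMr// [leRHS]mulrC -ler_pdivrMr//.
  by rewrite (le_trans (ltW nM))// ler_nat.
pose J i : set R := `](s + i%:R * h)%R, (s + i.+1%:R * h)%R]%classic.
pose U i := if (i < n.+1)%N then G @` (J i `&` `]s, t]) else set0.
have dU i : diameter (U i) <= (M * h)%:E.
  rewrite /U; case: ifPn => _; last by rewrite diameter0 lee_fin mulr_ge0 // ltW.
  apply: diameter_le; first by rewrite mulr_ge0 // ltW.
  move=> _ _ [u [/= Ju ust] <-] [w [/= Jw wst] <-].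
  apply: le_trans (GM _ _ ust wst) _; apply: ler_wpM2l => //.
  move: Ju Jw; rewrite /J /= !in_itv /= -natr1 mulrDl mul1r => /andP[u1 u2] /andP[w1 w2].
  by rewrite ler_norml; apply/andP; split; lra.
apply: (@le_trans _ _ (\sum_(0 <= i <oo) diameter (U i))).
  apply: ereal_inf_lbound; exists U => //; split; last first.
    by move=> i; apply: le_trans (dU i) _; rewrite lee_fin.
  move=> _ [u /= ust <-]; have := ust; rewrite in_itv/= => /andP[su ut].
  have un : (u <= s + n.+1%:R * h)%R by rewrite hn; lra.
  have [i ui imin] := ex_minnP (ex_intro (fun i => (u <= s + i.+1%:R * h)%R) n un).
  have ni : (i < n.+1)%N by rewrite ltnS imin.
  exists i => //; rewrite /U ni; exists u => //; split => //.
  rewrite /J /= in_itv/= ui andbT; case: i ui imin ni => [|i] ui imin ni.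
    by rewrite mul0r addr0.
  by rewrite ltNge; apply/negP => /imin; rewrite ltnn.
rewrite (nneseries_split 0 n.+1); last by move=> *; exact: diameter_ge0.
rewrite add0n [X in _ + X]eseries0 ?adde0; last first.
  by move=> i ni _; rewrite /U ltnNge ni /= diameter0.
apply: le_trans (lee_sum _ (fun i _ => dU i)) _.
by rewrite sumEFin lee_fin sumr_const_nat subn0 -[leLHS]mulr_natl mulrCA hn.
Qed.

(** A cover of the arc is pulled back to the parameter interval: the preimage of [U i] lies in the
    interval [J i], which starts at its infimum and has length [D i / m]. Subadditivity of Lebesgue
    measure concludes. *)
Lemma hausdorff1_image_ge (m : R) :
  (forall u w, u \in `]s, t]%R -> w \in `]s, t]%R ->
     (m * `|u - w| <= enorm (G u - G w))%R) ->
  (m * (t - s))%:E <= hausdorff1 (G @` `]s, t]).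
Proof.
have [m0|m0] := ltP 0%R m; last first.
  move=> _; apply: le_trans (hausdorff1_ge0 _).
  by rewrite lee_fin mulr_le0_ge0// subr_ge0 ltW.
move=> Gm; apply: le_trans (hausdorff1_delta_le _ ltr01).
apply: le_ereal_inf_tmp => _ [U [GU U1] <-].
pose V i := [set u | u \in `]s, t]%R /\ U i (G u)].
pose D i := fine (diameter (U i)).
have DE i : diameter (U i) = (D i)%:E.
  rewrite fineK// ge0_fin_numE ?diameter_ge0//.
  by rewrite (le_lt_trans (U1 i))// ltry.
have D0 i : (0 <= D i)%R by rewrite -lee_fin -DE diameter_ge0.
pose J i : set (measurableTypeR R) := if pselect (V i !=set0) then
  `[inf (V i), (inf (V i) + D i / m)%R]%classic else set0.
have mJ i : measurable (J i) by rewrite /J; case: pselect => ?; [exact: measurable_itv|exact: measurable0].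
have VJ i : V i `<=` J i.
  move=> u Vu; rewrite /J; case: pselect => [V0|]; last by case; exists u.
  have lV : has_lbound (V i).
    by exists s => w [] /=; rewrite in_itv/= => /andP[/ltW].
  rewrite /= in_itv/= ge_inf//= -lerBlDr; apply: lb_le_inf => // w [wst Uw].
  have := enorm_le_diameter Vu.2 Uw; rewrite DE lee_fin.
  move/(le_trans (Gm _ _ Vu.1 wst)); rewrite mulrC -ler_pdivlMr//.
  by move/(le_trans (ler_norm _)); lra.
have lJ i : m%:E * lebesgue_measure (J i) <= diameter (U i).
  rewrite /J; case: pselect => V0; last by rewrite measure0 mule0 diameter_ge0.
  rewrite lebesgue_measure_itv/= lte_fin; case: ifPn => _; last first.
    by rewrite mule0 diameter_ge0.
  by rewrite -EFinB -EFinM addrAC subrr add0r mulrC divfK ?gt_eqF// DE.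
have : lebesgue_measure (`]s, t]%classic : set (measurableTypeR R)) <=
    \sum_(0 <= i <oo) lebesgue_measure (J i).
  apply: measure_sigma_subadditive => // u /= ust.
  have [i _ Ui] := GU (G u) (ex_intro2 _ _ u ust erefl).
  by exists i => //; apply: VJ.
rewrite lebesgue_measure_itv/= lte_fin st => h.
rewrite EFinM; apply: (@le_trans _ _ (m%:E * \sum_(0 <= i <oo) lebesgue_measure (J i))).
  by apply: lee_wpmul2l => //; rewrite lee_fin ltW.
rewrite -nneseriesZl//.
by apply: lee_nneseries => // i _; rewrite mule_ge0// lee_fin ltW.
Qed.

End chords.

(** * Flow boxes *)

Lemma bigcup_unpickle (I : countType) (T : Type) (F : I -> set T) :
  \bigcup_i F i = \bigcup_n (if unpickle n is Some i then F i else set0).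
Proof.
apply/seteqP; split => x [i _].
  by move=> Fx; exists (pickle i) => //; rewrite pickleK.
by case: unpickle => [j Fx|//]; exists j.
Qed.

Lemma countable_bigcup_measurable d (T : measurableType d) (I : countType)
    (F : I -> set T) : (forall i, measurable (F i)) -> measurable (\bigcup_i F i).
Proof.
move=> mF; rewrite bigcup_unpickle; apply: bigcupT_measurable => n.
by case: unpickle => [i|]; [exact: mF|exact: measurable0].
Qed.

Lemma half_lt_near (R : realFieldType) (x y : R) : `|x - y| < x / 2 -> x / 2 < y.
Proof. by rewrite ltr_distlC => /andP[? _]; lra. Qed.

Lemma dist_between_lt (R : realDomainType) (x p q r m : R) :
  `|x - p| < m -> `|x - q| < m -> Num.min p q <= r <= Num.max p q -> `|x - r| < m.
Proof.
rewrite !ltr_distlC => /andP[p1 p2] /andP[q1 q2] /andP[r1 r2]; apply/andP; split.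
  by apply: lt_le_trans r1; rewrite lt_min p1.
by apply: le_lt_trans r2 _; rewrite gt_max p2.
Qed.

Lemma between_itvoo (R : realDomainType) (lo hi p q r : R) :
  lo < p < hi -> lo < q < hi -> Num.min p q <= r <= Num.max p q -> lo < r < hi.
Proof.
move=> /andP[p1 p2] /andP[q1 q2] /andP[r1 r2]; apply/andP; split.
  by apply: lt_le_trans r1; rewrite lt_min p1.
by apply: le_lt_trans r2 _; rewrite gt_max p2.
Qed.

Section plane_topology.
Context {R : realType}.
Implicit Types (x y : R * R) (A U : set (R * R)).

Lemma nbhs_boxP x A : nbhs x A <-> exists2 e, 0 < e &
  forall y, `|x.1 - y.1| < e -> `|x.2 - y.2| < e -> A y.
Proof.
split.
  by move=> /nbhs_ballP[e e0 h]; exists e => // y h1 h2; apply: h; split.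
move=> [e e0 h]; apply/nbhs_ballP; exists e => // y [h1 h2]; exact: h.
Qed.

Lemma open_rectangle (a b c d : R) : open [set x : R * R | a < x.1 < b /\ c < x.2 < d].
Proof.
rewrite openE => x [/andP[x1 x2] /andP[x3 x4]]; apply/nbhs_boxP.
exists (Num.min (Num.min (x.1 - a) (b - x.1)) (Num.min (x.2 - c) (d - x.2))).
  by rewrite !lt_min !subr_gt0 x1 x2 x3.
move=> y; rewrite !lt_min !ltr_norml.
by move=> /andP[/andP[/andP[? ?] /andP[? ?]] _] /andP[_ /andP[/andP[? ?] /andP[? ?]]];
  split; apply/andP; split; lra.
Qed.

Lemma open_borel_plane U : open U -> measurable (U : set (borel_plane R)).
Proof.
move=> oU.
pose B (q : rat * rat * rat * rat) : set (borel_plane R) :=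
  `]ratr q.1.1.1, ratr q.1.1.2[%classic `*` `]ratr q.1.2, ratr q.2[%classic.
have mB q : measurable (B q) by apply: measurableX; exact: measurable_itv.
pose N q := if pselect (B q `<=` U) then B q else set0.
have -> : U = \bigcup_q N q.
  apply/seteqP; split => x; last first.
    move=> [q _]; rewrite /N.
    by case: pselect => // BU; exact: BU.
  move=> Ux; have /nbhs_boxP[e e0 h] : nbhs x U by exact: open_nbhs_nbhs.
  have lt1 (z : R) : z - e < z by rewrite ltrBlDr ltrDl.
  have lt2 (z : R) : z < z + e by rewrite ltrDl.
  have [q1 h1] := rat_in_itvoo (lt1 x.1); have [q2 h2] := rat_in_itvoo (lt2 x.1).
  have [q3 h3] := rat_in_itvoo (lt1 x.2); have [q4 h4] := rat_in_itvoo (lt2 x.2).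
  move: h1 h2 h3 h4; rewrite !in_itv /= => /andP[? ?] /andP[? ?] /andP[? ?] /andP[? ?].
  exists (q1, q2, q3, q4); first exact: I.
  rewrite /N; case: pselect => [BU|[]]; first by split => /=; rewrite in_itv/=; apply/andP.
  move=> y [/=]; rewrite !in_itv/= => /andP[? ?] /andP[? ?].
  by apply: h; rewrite ltr_norml; apply/andP; split; lra.
apply: countable_bigcup_measurable => q; rewrite /N.
by case: pselect => ?; [exact: mB|exact: measurable0].
Qed.

Lemma continuous_on_measurable U (f : R * R -> R) : open U ->
  (forall x, U x -> {for x, continuous f}) ->
  measurable_fun (U : set (borel_plane R)) f.
Proof.
move=> oU cf; apply: (measurability _ (RGenOpens.measurableE R)).
move=> _ [_ [a [b ->] <-]]; apply: open_borel_plane.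
rewrite openE => x [Ux fx]; apply: filterI; first exact: open_nbhs_nbhs.
apply: cf => //; apply: open_nbhs_nbhs; split => //; exact: interval_open.
Qed.

Lemma is_derive_section1 (f : R * R -> R) (t z d : R) :
  is_derive (t, z) (1, 0) f d -> is_derive t 1 (fun t => f (t, z)) d.
Proof.
have E : (fun h : R => h^-1 *: (((fun t => f (t, z)) \o shift t) (h *: 1) - f (t, z))) =
    (fun h => h^-1 *: ((f \o shift (t, z)) (h *: ((1, 0) : R * R)) - f (t, z))).
  apply/funext => h /=; congr (_ *: (f _ - _)).
  by apply: injective_projections => //=; rewrite scaler0 add0r.
case=> [df dE]; split; first by rewrite /derivable E.
by rewrite /derive E.
Qed.

Lemma is_derive_section2 (f : R * R -> R) (t z d : R) :
  is_derive (t, z) (0, 1) f d -> is_derive z 1 (fun z => f (t, z)) d.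
Proof.
have E : (fun h : R => h^-1 *: (((fun z => f (t, z)) \o shift z) (h *: 1) - f (t, z))) =
    (fun h => h^-1 *: ((f \o shift (t, z)) (h *: ((0, 1) : R * R)) - f (t, z))).
  apply/funext => h /=; congr (_ *: (f _ - _)).
  by apply: injective_projections => //=; rewrite scaler0 add0r.
case=> [df dE]; split; first by rewrite /derivable E.
by rewrite /derive E.
Qed.

Lemma MVT_between (f df : R -> R) (x y : R) :
  (forall z, Num.min x y <= z <= Num.max x y -> is_derive z 1 f (df z)) ->
  exists2 z, Num.min x y <= z <= Num.max x y & f y - f x = df z * (y - x).
Proof.
wlog xy : x y / x <= y => [wl|].
  move=> h; have /orP[xy|yx] := le_total x y.
    exact: wl.
  have [|z zxy E] := wl y x yx; first by rewrite minC maxC.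
  exists z; first by rewrite minC maxC.
  by rewrite -opprB E -mulrN opprB.
rewrite (min_idPl xy) (max_idPr xy) => h.
have [||z zxy E] := @MVT_segment R f df x y xy.
- by move=> z /subset_itv_oo_cc; rewrite in_itv/=; exact: h.
- apply: derivable_within_continuous => z; rewrite in_itv/= => /h.
  by case.
- by exists z => //; move: zxy; rewrite in_itv.
Qed.

End plane_topology.

Section flow_box.
Context {R : realType}.
Variables (a b c d y1 y2 K : R) (s s1 s2 : R * R -> R).
Hypotheses (cd : c < d) (y12 : y1 < y2).
(** Closed in the second variable, so that the intermediate value theorem applies between the sides
    [z = c], where [s <= y1], and [z = d], where [s >= y2]. *)
Let box t z := (a < t < b) && (c <= z <= d).
Hypothesis ds1 : forall t z, box t z -> is_derive (t, z) (1, 0) s (s1 (t, z)).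
Hypothesis ds2 : forall t z, box t z -> is_derive (t, z) (0, 1) s (s2 (t, z)).
Hypothesis cs : forall t z, box t z -> {for (t, z), continuous s}.
Hypothesis cs1 : forall t z, box t z -> {for (t, z), continuous s1}.
Hypothesis cs2 : forall t z, box t z -> {for (t, z), continuous s2}.
Hypothesis s2gt0 : forall t z, box t z -> 0 < s2 (t, z).
Hypothesis sc : forall t, a < t < b -> s (t, c) <= y1.
Hypothesis sd : forall t, a < t < b -> y2 <= s (t, d).
(** The two derivatives are taken at unrelated points because the chord of a level curve involves
    [s1] at one point and [s2] at another, as in [flow_box_chord]. *)
Hypothesis sK : forall t z t' z', box t z -> box t' z' ->
  `|s1 (t, z)| <= K * s2 (t', z').
Notation H := (@hausdorff1 R).
Notation leb := (@lebesgue_measure R).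

Lemma flow_box_mono t z z' : a < t < b -> c <= z -> z < z' -> z' <= d ->
  s (t, z) < s (t, z').
Proof.
move=> tab cz zz zd.
have [|w] := @MVT_between R (fun z => s (t, z)) (fun z => s2 (t, z)) z z'.
  rewrite (min_idPl (ltW zz)) (max_idPr (ltW zz)) => w /andP[zw wz].
  apply/is_derive_section2/ds2; rewrite /box tab (le_trans cz zw) /=.
  exact: le_trans wz zd.
rewrite (min_idPl (ltW zz)) (max_idPr (ltW zz)) => /andP[zw wz] E.
rewrite -subr_gt0 E mulr_gt0 ?subr_gt0//; apply: s2gt0.
rewrite /box tab (le_trans cz zw) /=; exact: le_trans wz zd.
Qed.

(* The level sets of [s] in the box are the graphs of the functions [g ^~ y]. *)
Let g t y := get [set z | c < z < d /\ s (t, z) = y].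

Lemma flow_box_gP t y : a < t < b -> y1 < y < y2 ->
  c < g t y < d /\ s (t, g t y) = y.
Proof.
move=> tab /andP[y1y yy2].
suff : [set z | c < z < d /\ s (t, z) = y] (g t y) by [].
apply: getPex.
have sc1 := le_lt_trans (sc tab) y1y; have sd1 := lt_le_trans yy2 (sd tab).
have [||z] := @IVT R (fun z => s (t, z)) c d y (ltW cd).
- apply: derivable_within_continuous => z; rewrite in_itv/= => zcd.
  have : box t z by rewrite /box tab.
  by move=> /ds2 /is_derive_section2 [].
- by rewrite (min_idPl (ltW (lt_trans sc1 sd1))) (max_idPr (ltW (lt_trans sc1 sd1))) !ltW.
rewrite in_itv/= => /andP[cz zd] E; exists z; split => //; rewrite !lt_neqAle cz zd !andbT.
apply/andP; split; apply/negP => /eqP Ez.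
  by move: sc1; rewrite Ez E ltxx.
by move: sd1; rewrite -Ez E ltxx.
Qed.

(** With its counterpart below, this takes the place of the implicit function theorem: comparing [z]
    with [g t y] amounts to an open condition on [s]. Continuity of [g] in [t] and its joint
    measurability follow. *)
Lemma flow_box_g_gt t y z : a < t < b -> y1 < y < y2 -> c < z < d ->
  (z < g t y) = (s (t, z) < y).
Proof.
move=> tab yy /andP[cz zd]; have [/andP[cg gd] E] := flow_box_gP tab yy.
apply/idP/idP => [zg|].
  by rewrite -E; apply: flow_box_mono => //; exact: ltW.
rewrite ltNge [in X in _ -> X]ltNge => /negP h; apply/negP => gz; apply: h.
move: gz; rewrite le_eqVlt => /predU1P[<-|gz]; first by rewrite E.
by rewrite -E ltW// flow_box_mono // ltW.
Qed.

Lemma flow_box_g_lt t y z : a < t < b -> y1 < y < y2 -> c < z < d ->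
  (g t y < z) = (y < s (t, z)).
Proof.
move=> tab yy /andP[cz zd]; have [/andP[cg gd] E] := flow_box_gP tab yy.
apply/idP/idP => [zg|].
  by rewrite -{1}E; apply: flow_box_mono => //; exact: ltW.
rewrite ltNge [in X in _ -> X]ltNge => /negP h; apply/negP => gz; apply: h.
move: gz; rewrite le_eqVlt => /predU1P[->|gz]; first by rewrite E.
by rewrite -{1}E ltW// flow_box_mono // ltW.
Qed.

Lemma flow_box_g_cont y t : a < t < b -> y1 < y < y2 ->
  {for t, continuous (g ^~ y)}.
Proof.
move=> tab yy; have [/andP[cg gd] E] := flow_box_gP tab yy.
have near_t : \forall u \near t, a < u < b.
  have : t \in `]a, b[ by rewrite in_itv.
  by move=> /near_in_itvoo; apply: filterS => u; rewrite in_itv.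
have cst z : c < z < d -> {for t, continuous (fun u => s (u, z))}.
  move=> /andP[cz zd].
  have : box t z by rewrite /box tab !ltW.
  move=> /ds1 /is_derive_section1 [dx _].
  by apply: differentiable_continuous; apply/derivable1_diffP.
apply/cvgrPdist_lt => e e0.
pose z1 := Num.max (g t y - e) ((c + g t y) / 2).
pose z2 := Num.min (g t y + e) ((g t y + d) / 2).
have z1c : c < z1 < d.
  by rewrite /z1 lt_max gt_max; apply/andP; split; [apply/orP; right|apply/andP; split]; lra.
have z2c : c < z2 < d.
  by rewrite /z2 lt_min gt_min; apply/andP; split; [apply/andP; split|apply/orP; right]; lra.
have z1g : z1 < g t y by rewrite /z1 gt_max; apply/andP; split; lra.
have z2g : g t y < z2 by rewrite /z2 lt_min; apply/andP; split; lra.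
have n1 : \forall u \near t, s (u, z1) < y.
  have := cst _ z1c; move/(_ [set x | x < y]); apply.
  by apply: open_nbhs_nbhs; split; [exact: open_lt|rewrite /= -flow_box_g_gt].
have n2 : \forall u \near t, y < s (u, z2).
  have := cst _ z2c; move/(_ [set x | y < x]); apply.
  by apply: open_nbhs_nbhs; split; [exact: open_gt|rewrite /= -flow_box_g_lt].
near=> u.
have uab : a < u < b by near: u.
have h1 : z1 < g u y by rewrite flow_box_g_gt//; near: u.
have h2 : g u y < z2 by rewrite flow_box_g_lt//; near: u.
move: h1 h2; rewrite /z1 /z2 gt_max lt_min => /andP[h1 _] /andP[h2 _].
rewrite ltr_distlC; apply/andP; split; lra.
Unshelve. all: by end_near. Qed.

(** The length element of the level curves, as the graph of [g ^~ y] has slope [- s1 / s2]. *)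
Let rho x := Num.sqrt (1 + (s1 x / s2 x) ^+ 2).

(** The pointwise content of the coarea formula: on a vertical line [s2 dz] becomes [dy], and
    [rho dt] is arc length on a level curve. *)
Lemma rho_s2 t z : box t z -> rho (t, z) * s2 (t, z) = enorm (s1 (t, z), s2 (t, z)).
Proof.
move=> bx; have s20 := s2gt0 bx.
rewrite /rho /enorm /dot /= -[X in _ * X]gtr0_norm// -sqrtr_sqr -sqrtrM//.
  by congr Num.sqrt; field; rewrite gt_eqF.
by rewrite addr_ge0 ?sqr_ge0.
Qed.

(** Between the two points of the level curve pass through the corner [(t, g u y)]. The changes of
    [s] along the two legs cancel, and the mean value theorem on each leg gives the slope of the
    chord. *)
Lemma flow_box_chord y t u : a < t < b -> a < u < b -> y1 < y < y2 ->
  exists xi eta, [/\ Num.min t u <= xi <= Num.max t u,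
   Num.min (g t y) (g u y) <= eta <= Num.max (g t y) (g u y) &
   enorm ((u, g u y) - (t, g t y)) =
     Num.sqrt (1 + (s1 (xi, g u y) / s2 (t, eta)) ^+ 2) * `|u - t|].
Proof.
move=> tab uab yy.
have [/andP[cg gd] E] := flow_box_gP tab yy.
have [/andP[cg' gd'] E'] := flow_box_gP uab yy.
have btw x : Num.min t u <= x <= Num.max t u -> a < x < b by exact: between_itvoo.
have btw2 x : Num.min (g t y) (g u y) <= x <= Num.max (g t y) (g u y) -> c <= x <= d.
  have cgt : c < g t y < d by rewrite cg.
  have cgu : c < g u y < d by rewrite cg'.
  by move=> /(between_itvoo cgt cgu) /andP[/ltW -> /ltW ->].
have [xi xih Exi] := @MVT_between R (fun t => s (t, g u y)) (fun t => s1 (t, g u y)) t u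
  (fun z h => is_derive_section1 (ds1 (introT andP (conj (btw _ h) (introT andP (conj (ltW cg') (ltW gd'))))))).
have [eta etah Eeta] := @MVT_between R (fun z => s (t, z)) (fun z => s2 (t, z)) (g t y) (g u y)
  (fun z h => is_derive_section2 (ds2 (introT andP (conj tab (btw2 _ h))))).
exists xi, eta; split => //.
have s20 : 0 < s2 (t, eta) by apply: s2gt0; rewrite /box tab btw2.
have EE : g u y - g t y = - (s1 (xi, g u y) / s2 (t, eta)) * (u - t).
  apply: (mulfI (lt0r_neq0 s20)); rewrite -Eeta E.
  have -> : s (t, g u y) = y - s1 (xi, g u y) * (u - t).
    by rewrite -Exi E'; ring.
  by field; rewrite gt_eqF.
rewrite -sqrtr_sqr -sqrtrM ?addr_ge0 ?sqr_ge0//.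
by rewrite /enorm /dot /= EE; congr Num.sqrt; ring.
Qed.

Lemma flow_box_chord_near y t e : a < t < b -> y1 < y < y2 -> 0 < e ->
  exists2 del, 0 < del & forall u w, `|t - u| < del -> `|t - w| < del ->
   [/\ a < u < b, a < w < b, (rho (t, g t y) - e) * `|u - w| <= enorm ((u, g u y) - (w, g w y)) &
   enorm ((u, g u y) - (w, g w y)) <= (rho (t, g t y) + e) * `|u - w|].
Proof.
move=> tab yy e0.
have [/andP[cg gd] E] := flow_box_gP tab yy.
have bx : box t (g t y) by rewrite /box tab !ltW.
have s20 := s2gt0 bx.
(* The chord formula has [s1] and [s2] at different points, hence a function of the pair of values,
   continuous at the pair taken at [(t, g t y)]. *)
pose h (p : R * R) := Num.sqrt (1 + (p.1 / p.2) ^+ 2).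
have ch : {for (s1 (t, g t y), s2 (t, g t y)), continuous h}.
  apply: (@continuous_comp _ _ _ (fun p : R * R => 1 + (p.1 / p.2) ^+ 2) Num.sqrt); last exact: sqrt_continuous.
  apply: cvgD; first exact: cvg_cst.
  apply: (@continuous_comp _ _ _ (fun p : R * R => p.1 / p.2) (fun x => x ^+ 2)); last exact: exprn_continuous.
  apply: cvgM; first exact: cvg_fst.
  by apply: cvgV; [exact: lt0r_neq0|exact: cvg_snd].
have /nbhs_boxP[e1 e10 he1] : nbhs (s1 (t, g t y), s2 (t, g t y))
    [set p | `|rho (t, g t y) - h p| < e].
  by move/cvgrPdist_lt : ch => /(_ _ e0).
have /nbhs_boxP[e2 e20 he2] : nbhs (t, g t y) [set x | `|s1 (t, g t y) - s1 x| < e1].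
  by have := cs1 bx => /cvgrPdist_lt /(_ _ e10).
have /nbhs_boxP[e3 e30 he3] : nbhs (t, g t y) [set x | `|s2 (t, g t y) - s2 x| < e1].
  by have := cs2 bx => /cvgrPdist_lt /(_ _ e10).
have e4 : 0 < Num.min e2 e3 by rewrite lt_min e20.
have /nbhs_ballP[e5 /= e50 he5] : nbhs t [set u | `|g t y - g u y| < Num.min e2 e3].
  by have := flow_box_g_cont tab yy => /cvgrPdist_lt /(_ _ e4).
have /nbhs_ballP[e6 /= e60 he6] : nbhs t [set u | a < u < b].
  have : t \in `]a, b[ by rewrite in_itv.
  by move=> /near_in_itvoo; apply: filterS => u; rewrite in_itv.
exists (Num.min (Num.min e2 e3) (Num.min e5 e6)).
  by rewrite !lt_min e20 e30 e50 e60.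
move=> u w; rewrite !lt_min => /andP[/andP[u2 u3] /andP[u5 u6]] /andP[/andP[w2 w3] /andP[w5 w6]].
have uab := he6 _ u6; have wab := he6 _ w6.
have /= := he5 _ u5; have /= := he5 _ w5; rewrite !lt_min => /andP[gw2 gw3] /andP[gu2 gu3].
have [xi [eta [xih etah EE]]] := flow_box_chord wab uab yy.
have hE : `|rho (t, g t y) - h (s1 (xi, g u y), s2 (w, eta))| < e.
  apply: he1 => /=; first by apply: he2 => //=; exact: dist_between_lt xih.
  by apply: he3 => //=; exact: dist_between_lt etah.
split => //; rewrite EE -/(h (s1 (xi, g u y), s2 (w, eta))); apply: ler_wpM2r => //.
  by move: hE; rewrite ltr_distlC => /andP[/ltW].
by move: hE; rewrite ltr_distlC => /andP[_ /ltW].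
Qed.


Let box0 : set (borel_plane R) := [set x | a < x.1 < b /\ c < x.2 < d].

Let box0_box x : box0 x -> box x.1 x.2.
Proof. by move=> [xab /andP[/ltW cx /ltW xd]]; rewrite /box xab cx. Qed.

Let open_box0 : open (box0 : set (R * R)).
Proof. exact: open_rectangle. Qed.

Let mbox0 : measurable box0. Proof. exact: open_borel_plane. Qed.

Let ms : measurable_fun box0 s.
Proof.
apply: (@continuous_on_measurable R box0 s open_box0) => -[t z] /box0_box; exact: cs.
Qed.

Let ms2 : measurable_fun box0 s2.
Proof.
apply: (@continuous_on_measurable R box0 s2 open_box0) => -[t z] /box0_box; exact: cs2.
Qed.

Let mrho : measurable_fun box0 rho.
Proof.
apply: (@continuous_on_measurable R box0 rho open_box0) => -[t z] /box0_box bx.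
apply: (@continuous_comp _ _ _ (fun x => 1 + (s1 x / s2 x) ^+ 2) Num.sqrt); last exact: sqrt_continuous.
apply: cvgD; first exact: cvg_cst.
apply: (@continuous_comp _ _ _ (fun x => s1 x / s2 x) (fun x => x ^+ 2)); last exact: exprn_continuous.
apply: cvgM; first exact: cs1.
by apply: cvgV; [exact: lt0r_neq0 (s2gt0 bx)|exact: cs2].
Qed.

Let rho_ge0 x : 0 <= rho x. Proof. exact: sqrtr_ge0. Qed.

Let L y : set (borel_plane R) := box0 `&` s @^-1` [set y].

Let mL y : measurable (L y).
Proof. by apply: ms => //; exact: measurable_set1. Qed.

Let g_uniq t z y : a < t < b -> y1 < y < y2 -> c < z < d -> s (t, z) = y -> z = g t y.
Proof.
move=> tab yy zcd E; apply/eqP; rewrite eq_le leNgt flow_box_g_lt// E ltxx /=.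
by rewrite leNgt flow_box_g_gt// E ltxx.
Qed.

Let L_graph y u v : y1 < y < y2 -> a < u -> v < b ->
  fst @^-1` `]u, v]%classic `&` L y = (fun t => (t, g t y)) @` `]u, v]%classic.
Proof.
move=> yy au vb; apply/seteqP; split => [[t z]|_ [t /= tuv <-]] /=.
  by move=> [tuv [[/= tab zcd] E]]; exists t => //; rewrite (g_uniq tab yy zcd E).
have tab : a < t < b.
  move: tuv; rewrite in_itv/= => /andP[ut tv].
  by rewrite (lt_trans au ut) (le_lt_trans tv vb).
by have [gcd E] := flow_box_gP tab yy.
Qed.

Let g_pair_cont t y (f : R * R -> R) : a < t < b -> y1 < y < y2 ->
  {for (t, g t y), continuous f} -> {for t, continuous (fun t => f (t, g t y))}.
Proof.
move=> tab yy cf; apply: (@continuous_comp _ _ _ (fun t => (t, g t y)) f) => //.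
exact: (cvg_pair cvg_id (flow_box_g_cont tab yy)).
Qed.

(** The Hausdorff measure of the level curve, projected to the [t] axis, is a measure on []a, b[].
    The chord estimates show that its density is [rho], and [area] applies. *)
Lemma flow_box_hausdorff y (A : set (borel_plane R)) : y1 < y < y2 ->
  measurable A -> A `<=` box0 ->
  H (A `&` s @^-1` [set y]) =
  (\int[leb]_(t in `]a, b[%classic `&` [set t | A (t, g t y)]) (rho (t, g t y))%:E)%E.
Proof.
move=> yy mA Abox.
pose nu := measure_function_pushforward__canonical__measure_function_Measure
  (mrestr H (mL y)) (@measurable_fst _ _ (measurableTypeR R) (measurableTypeR R)).
have nuE E : nu E = H (fst @^-1` E `&` L y) by [].
pose E := `]a, b[%classic `&` [set t | A (t, g t y)].
have gb t : a < t < b -> box t (g t y).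
  by move=> tab; have [/andP[? ?] _] := flow_box_gP tab yy; rewrite /box tab !ltW.
have mE : measurable (E : set (measurableTypeR R)).
  pose G := (g ^~ y) \_ `]a, b[.
  have mG : measurable_fun setT (G : measurableTypeR R -> measurableTypeR R).
    apply: (@measurable_restrictT _ _ (measurableTypeR R) (measurableTypeR R) `]a, b[%classic (g ^~ y) _).1 => //.
    apply: open_continuous_measurable_fun; first exact: interval_open.
    by move=> t; rewrite inE/= in_itv/= => tab; exact: flow_box_g_cont.
  have -> : E = `]a, b[%classic `&` (fun t => (t, G t)) @^-1` A.
    apply/seteqP; split => t [tab /= At]; split => //; move: At;
      by rewrite /= /G /patch mem_set.
  apply: measurableI; first exact: measurable_itv.
  rewrite -[X in measurable X]setTI.
  have : measurable_fun setT (fun t : measurableTypeR R => (t, G t) : borel_plane R).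
    by apply: measurable_fun_pair.
  exact.
have -> : A `&` s @^-1` [set y] = fst @^-1` E `&` L y.
  apply/seteqP; split => [[t z] [Atz /= E']|[t z] /= [[tab Atg] [tz E']]].
    have [/= tab zcd] := Abox _ Atz.
    split; last by split => //; split.
    split; first by rewrite /= in_itv.
    by rewrite /= -(g_uniq tab yy zcd E').
  have zg : z = g t y := g_uniq tz.1 yy tz.2 E'.
  by split => //; rewrite zg.
rewrite -nuE; apply: (@area R a b) => //.
- move=> t tab; apply: (g_pair_cont (f := rho)) => //.
  apply: (@continuous_comp _ _ _ (fun x => 1 + (s1 x / s2 x) ^+ 2) Num.sqrt); last exact: sqrt_continuous.
  apply: cvgD; first exact: cvg_cst.
  apply: (@continuous_comp _ _ _ (fun x => s1 x / s2 x) (fun x => x ^+ 2)); last exact: exprn_continuous.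
  apply: cvgM; first exact: cs1 (gb _ tab).
  by apply: cvgV; [exact: lt0r_neq0 (s2gt0 (gb _ tab))|exact: cs2 (gb _ tab)].
- move=> u v au vb; rewrite nuE L_graph//.
  have [uv|vu] := ltP u v; last first.
    by rewrite set_itv_ge ?bnd_simp -?leNgt// image_set0 hausdorff1_0.
  (* By [sK] the slope of every chord is at most [K], so the projected measure is finite on compact
     subintervals. *)
  apply: le_lt_trans (hausdorff1_image_le uv (sqrtr_ge0 (1 + K ^+ 2)) _) (ltry _).
  move=> t w; rewrite !in_itv/= => /andP[t1 t2] /andP[w1 w2].
  have tab : a < t < b by rewrite (lt_trans au t1) (le_lt_trans t2 vb).
  have wab : a < w < b by rewrite (lt_trans au w1) (le_lt_trans w2 vb).
  have [xi [eta [xih etah ->]]] := flow_box_chord wab tab yy.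
  apply: ler_wpM2r => //; apply: ler_wsqrtr; rewrite lerD2l.
  have K0 : 0 <= K.
    have := sK (gb _ tab) (gb _ tab); move/(le_trans (normr_ge0 _)).
    by rewrite pmulr_lge0// s2gt0// gb.
  rewrite -[leLHS]real_normK ?num_real// ler_sqr ?nnegrE// normrM normfV.
  have [c1 _] := flow_box_gP wab yy.
  have [c2 _] := flow_box_gP tab yy.
  have bx1 : box w eta.
    by rewrite /box wab; have /andP[? ?] := between_itvoo c1 c2 etah; rewrite !ltW.
  have bx2 : box xi (g t y).
    by rewrite /box (between_itvoo wab tab xih); case/andP: c2 => ? ?; rewrite !ltW.
  rewrite (gtr0_norm (s2gt0 bx1)) ler_pdivrMr ?s2gt0//; exact: sK.
- move=> t e tab e0; have [del del0 h] := flow_box_chord_near tab yy e0.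
  have dd u : t - del / 2 < u -> u < t + del / 2 -> `|t - u| < del.
    by move=> ? ?; rewrite ltr_distlC; apply/andP; split; lra.
  exists (del / 2); first by rewrite divr_gt0.
  move=> u v tu uv vt.
  have [||/andP[au _] /andP[_ vb] _ _] := h u v; [exact: dd (lt_trans uv vt)|exact: dd (lt_trans tu uv) vt|].
  rewrite nuE L_graph//; apply/andP; split.
  + apply: hausdorff1_image_ge => // p q; rewrite !in_itv/= => /andP[p1 p2] /andP[q1 q2].
    by have [||] := h p q; [exact: dd (lt_trans tu p1) (le_lt_trans p2 vt)|exact: dd (lt_trans tu q1) (le_lt_trans q2 vt)|].
  + apply: hausdorff1_image_le => //.
      by rewrite addr_ge0// ltW.
    move=> p q; rewrite !in_itv/= => /andP[p1 p2] /andP[q1 q2].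
    by have [||] := h p q; [exact: dd (lt_trans tu p1) (le_lt_trans p2 vt)|exact: dd (lt_trans tu q1) (le_lt_trans q2 vt)|].
- by move=> t [].
Qed.

Let D : set (borel_plane R) := [set x | a < x.1 < b /\ y1 < x.2 < y2].

Let open_D : open (D : set (R * R)).
Proof. exact: open_rectangle. Qed.

(** Joint measurability is what Tonelli's theorem requires in [flow_box_coarea]. The sets [z < g]
    are even open in [D]. *)
Lemma flow_box_g_measurable :
  measurable_fun D (fun x : borel_plane R => g x.1 x.2 : measurableTypeR R).
Proof.
apply: (measurability _ (RGenOInfty.measurableE R)) => _ [_ [z ->] <-].
apply: open_borel_plane.
have [cz|zc] := ltP c z; last first.
  rewrite (_ : _ `&` _ = D) //; apply/setIidPl => x [xab xy] /=.
  by have [/andP[h _] _] := flow_box_gP xab xy; rewrite in_itv/= andbT (le_lt_trans zc).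
have [zd|dz] := ltP z d; last first.
  rewrite (_ : _ `&` _ = set0); first exact: open0.
  rewrite -subset0 => x [[xab xy]] /=; rewrite in_itv/= andbT.
  by have [/andP[_ h] _] := flow_box_gP xab xy; rewrite ltNge (ltW (lt_le_trans h dz)).
have zcd : c < z < d by rewrite cz zd.
rewrite (_ : _ `&` _ = D `&` [set x | 0 < x.2 - s (x.1, z)]); last first.
  apply/seteqP; split => x [[xab xy]] /=.
    by rewrite in_itv/= andbT flow_box_g_gt// -subr_gt0.
  by rewrite subr_gt0 -flow_box_g_gt// => h; split => //=; rewrite in_itv/= h.
rewrite openE => x [Dx /= h]; apply: filterI; first exact: open_nbhs_nbhs.
have cf : {for x, continuous (fun x : R * R => x.2 - s (x.1, z))}.
  apply: cvgB; first exact: cvg_snd.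
  apply: (@continuous_comp _ _ _ (@fst R R) (fun u => s (u, z))); first exact: cvg_fst.
  have : box x.1 z by rewrite /box Dx.1 !ltW.
  move=> /ds1 /is_derive_section1 [dx _].
  by apply: differentiable_continuous; apply/derivable1_diffP.
move: (cf [set x | 0 < x]); apply; apply: open_nbhs_nbhs; split => //; exact: open_gt.
Qed.

(** The change of variables [z = g t y] on a vertical line. The image of Lebesgue measure on []y1,
    y2[] under [g t] gives an interval []u, v]] the mass [s (t, v) - s (t, u)], hence has density
    [s2] by [area]. *)
Lemma flow_box_substitution t (F : R -> \bar R) : a < t < b ->
  measurable_fun setT (F : measurableTypeR R -> \bar R) -> (forall z, 0 <= F z)%E ->
  (forall z, ~ (c < z < d) -> F z = 0%E) ->
  (forall z, c < z < d -> ~ (y1 < s (t, z) < y2) -> F z = 0%E) ->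
  (\int[leb]_z (F z * (if c < z < d then s2 (t, z) else 0)%:E) =
   \int[leb]_(y in `]y1, y2[) F (g t y))%E.
Proof.
move=> tab mF F0 Fcd Fy.
have bx z : c <= z <= d -> box t z by rewrite /box tab.
have ivt y : y1 <= y <= y2 -> exists2 z, c <= z <= d & s (t, z) = y.
  move=> /andP[h1 h2].
  have sc' := le_trans (sc tab) h1; have sd' := le_trans h2 (sd tab).
  have [||z] := @IVT R (fun z => s (t, z)) c d y (ltW cd).
  - apply: derivable_within_continuous => z; rewrite in_itv/= => /bx.
    by move=> /ds2 /is_derive_section2 [].
  - by rewrite (min_idPl (le_trans sc' sd')) (max_idPr (le_trans sc' sd')) sc'.
  by rewrite in_itv/=; exists z.
(* The heights at which [s] takes the values [y1] and [y2] delimit the part of the vertical line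
   where the levels lie in []y1, y2[]. *)
have [z1 z1cd Ez1] : exists2 z, c <= z <= d & s (t, z) = y1 by apply: ivt; rewrite lexx ltW.
have [z2 z2cd Ez2] : exists2 z, c <= z <= d & s (t, z) = y2 by apply: ivt; rewrite lexx ltW.
have mono u v : c <= u <= d -> c <= v <= d -> (s (t, u) < s (t, v)) = (u < v).
  move=> /andP[? ?] /andP[? ?]; apply/idP/idP => [|uv]; last exact: flow_box_mono.
  apply: contraTT; rewrite -!leNgt le_eqVlt => /predU1P[->//|vu].
  by rewrite ltW// flow_box_mono.
have z12 z : z1 < z < z2 -> c < z < d.
  case/andP: z1cd => ? ?; case/andP: z2cd => ? ? /andP[? ?]; apply/andP; split; lra.
have z12s z : c < z < d -> (y1 < s (t, z) < y2) = (z1 < z < z2).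
  by move=> /andP[cz zd]; rewrite -Ez1 -Ez2 !mono// !ltW.
have gz y : y1 < y < y2 -> z1 < g t y < z2.
  by move=> yy; have [gcd E] := flow_box_gP tab yy; rewrite -z12s// E.
pose q (y : measurableTypeR R) : measurableTypeR R := if y1 < y < y2 then g t y else 0.
have mI : measurable (`]y1, y2[%classic : set (measurableTypeR R)) by exact: measurable_itv.
have mq : measurable_fun setT q.
  have -> : q = (g t) \_ `]y1, y2[.
    by apply/funext => y; rewrite /q /patch mem_setE in_itv.
  apply: (@measurable_restrictT _ _ (measurableTypeR R) (measurableTypeR R) `]y1, y2[%classic (g t) _).1 => //.
  have : measurable_fun (`]y1, y2[%classic : set (measurableTypeR R))
      ((fun x : borel_plane R => g x.1 x.2 : measurableTypeR R) \o
       (fun y : measurableTypeR R => (t, y) : borel_plane R)); last by [].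
  apply: (measurable_comp (F := D)).
  - exact: open_borel_plane.
  - by move=> _ [y /= yI <-]; split => //=; move: yI; rewrite in_itv.
  - exact: flow_box_g_measurable.
  - by apply: measurable_funTS; apply: measurable_fun_pair.
pose nu := measure_function_pushforward__canonical__measure_function_Measure (mrestr leb mI) mq.
have nuE E : nu E = leb (q @^-1` E `&` `]y1, y2[%classic) by [].
have nu_itv u v : z1 < u -> u < v -> v < z2 -> nu `]u, v]%classic = (s (t, v) - s (t, u))%:E.
  move=> zu uv vz.
  have uz : z1 < u < z2 by rewrite zu (lt_trans uv).
  have vz' : z1 < v < z2 by rewrite vz (lt_trans zu).
  have ucd := z12 _ uz; have vcd := z12 _ vz'.
  rewrite nuE (_ : _ `&` _ = `]s (t, u), s (t, v)]%classic).
    rewrite lebesgue_measure_itv/= lte_fin mono ?uv//.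
    - by case/andP: ucd => ? ?; rewrite !ltW.
    - by case/andP: vcd => ? ?; rewrite !ltW.
  move: uz vz'; rewrite -!z12s// => /andP[su1 su2] /andP[sv1 sv2].
  apply/seteqP; split => y /=; rewrite !in_itv/=.
    move=> [+ yy]; rewrite /q yy flow_box_g_gt// leNgt flow_box_g_gt// -leNgt//.
  move=> /andP[h1 h2]; have yy : y1 < y < y2 by rewrite (lt_trans su1 h1) (le_lt_trans h2).
  by split => //; rewrite /q yy flow_box_g_gt// leNgt flow_box_g_gt// -leNgt h1.
have cs2t z : z1 < z < z2 -> {for z, continuous (fun z => s2 (t, z))}.
  move=> /z12 /andP[? ?]; apply: (@continuous_comp _ _ _ (fun z => (t, z)) s2).
    exact: (cvg_pair (cvg_cst _) cvg_id).
  by apply: cs2; rewrite bx// !ltW.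
have nuA (E : set (measurableTypeR R)) : measurable E -> E `<=` `]z1, z2[%classic ->
    nu E = (\int[leb]_(z in E) (s2 (t, z))%:E)%E.
  move=> mE Ez; apply: (@area R z1 z2) => //.
  - by move=> z /z12 /andP[? ?]; rewrite ltW// s2gt0// bx// !ltW.
  - move=> u v _ _; rewrite nuE; apply: (@le_lt_trans _ _ (leb (`]y1, y2[%classic : set (measurableTypeR R)))).
      apply: le_measure; rewrite ?inE//; apply: measurableI => //.
      by rewrite -[X in measurable X]setTI; exact: (mq measurableT _ (measurable_itv _)).
    by rewrite lebesgue_measure_itv/= lte_fin y12 ltry.
  - move=> x e xz e0; have /cvgrPdist_lt /(_ _ e0) /nbhs_ballP[del /= del0 h] := cs2t _ xz.
    case/andP: (xz) => zx xz'.
    exists (Num.min del (Num.min (x - z1) (z2 - x))); first by rewrite !lt_min !subr_gt0 del0 zx.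
    move=> u v xu uv vx.
    have {xu} : x - u < Num.min del (Num.min (x - z1) (z2 - x)) by rewrite ltrBlDl -ltrBlDr.
    have {vx} : v - x < Num.min del (Num.min (x - z1) (z2 - x)) by rewrite ltrBlDl.
    rewrite !lt_min => /andP[v1 /andP[v2 v3]] /andP[u1 /andP[u2 u3]].
    rewrite nu_itv; [|lra|done|lra].
    have [|w] := @MVT_between R (fun z => s (t, z)) (fun z => s2 (t, z)) u v.
      rewrite (min_idPl (ltW uv)) (max_idPr (ltW uv)) => w /andP[w1 w2].
      apply/is_derive_section2/ds2/bx.
      by have /andP[? ?] : c < w < d by [apply: z12; apply/andP; split; lra]; rewrite !ltW.
    rewrite (min_idPl (ltW uv)) (max_idPr (ltW uv)) => /andP[w1 w2] ->.
    have : `|s2 (t, x) - s2 (t, w)| < e.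
      by apply: h; rewrite /ball/= ltr_distlC; apply/andP; split; lra.
    rewrite ltr_distlC !lee_fin => /andP[h1 h2].
    by rewrite !ler_wpM2r ?subr_ge0// ltW//; lra.
pose r z := if z1 < z < z2 then s2 (t, z) else 0.
have mr : measurable_fun setT (fun z : measurableTypeR R => (r z)%:E).
  apply/measurable_EFinP.
  have -> : r = (fun z => s2 (t, z)) \_ `]z1, z2[.
    by apply/funext => z; rewrite /r /patch mem_setE in_itv.
  apply: (@measurable_restrictT _ _ (measurableTypeR R) (measurableTypeR R) `]z1, z2[%classic (fun z => s2 (t, z)) _).1 => //.
  apply: open_continuous_measurable_fun; first exact: interval_open.
  by move=> z; rewrite inE/= in_itv/= => /cs2t.
have r0 z : (0 <= (r z)%:E)%E.
  rewrite lee_fin /r; case: ifPn => // /z12 /andP[? ?].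
  by rewrite ltW// s2gt0// bx// !ltW.
transitivity (\int[density leb mr r0]_z F z)%E.
  rewrite ge0_integral_density//; apply: eq_integral => z _; rewrite /r muleC.
  case: ifPn => zcd; last by rewrite Fcd ?mule0//; exact/negP.
  case: ifPn => // zz; rewrite Fy ?mule0//; rewrite z12s//; exact/negP.
transitivity (\int[nu]_z F z)%E.
  apply: eq_measure_integral => A mA _.
  transitivity (nu (A `&` `]z1, z2[%classic)).
    rewrite nuA; last 2 first.
    - by apply: measurableI => //; exact: measurable_itv.
    - by move=> z [].
    rewrite /density integral_mkcondr; apply: eq_integral => z _.
    by rewrite /r /patch mem_setE in_itv; case: ifP.
  rewrite !nuE; congr (leb _); apply/seteqP; split => y /=.
    by move=> [[? ?] ?].
  rewrite in_itv/= => -[Aq yy]; split => //; split => //.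
  by rewrite in_itv/= /q yy gz.
rewrite (ge0_integral_pushforward mq)//.
rewrite preimage_setT ge0_integral_mrestr//.
- by apply: eq_integral => y; rewrite inE/= in_itv/= /q => ->.
- exact: measurableT_comp.
- by move=> y; exact: F0.
Qed.


Let coarea_fun (A : set (borel_plane R)) x : \bar R := ((fun x => (rho x)%:E) \_ A) x.

(** Tonelli's theorem for [Phi (t, y) = F (t, g t y)]: its integral in [t] is the Hausdorff measure
    of a level set, and its integral in [y] is, by substitution, that of [|grad s|] over a vertical
    line. *)
Lemma flow_box_coarea (A : set (borel_plane R)) : measurable A ->
  A `<=` box0 -> (forall x, A x -> y1 < s x < y2) ->
  measurable_fun setT (fun y : measurableTypeR R => H (A `&` s @^-1` [set y])) /\
  (\int[@lebesgue2 R]_(x in A) (enorm (s1 x, s2 x))%:E =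
   \int[leb]_y H (A `&` s @^-1` [set y]))%E.
Proof.
move=> mA Abox Ay; set F := coarea_fun A.
have mF : measurable_fun setT F.
  apply: (measurable_restrictT _ _).1 => //.
  by apply/measurable_EFinP; exact: measurable_funS mrho.
have F0 x : (0 <= F x)%E.
  by rewrite /F /coarea_fun /patch; case: ifP => // _; rewrite lee_fin.
have AF x : ~ A x -> F x = 0%E.
  by move=> nA; rewrite /F /coarea_fun /patch memNset.
pose Phi := (fun x : borel_plane R => F (x.1, g x.1 x.2)) \_ D.
have mPhi : measurable_fun setT Phi.
  apply: (measurable_restrictT _ _).1; first exact: open_borel_plane.
  have : measurable_fun D (F \o (fun x : borel_plane R => (x.1, ((fun x => g x.1 x.2) \_ D) x) : borel_plane R)).
    apply: measurable_funTS; apply: measurableT_comp => //.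
    apply: measurable_fun_pair; first exact: measurable_fst.
    apply: (measurable_restrictT _ _).1; first exact: open_borel_plane.
    exact: flow_box_g_measurable.
  by apply: eq_measurable_fun => x xD; rewrite /= /patch xD.
have Phi0 x : (0 <= Phi x)%E by rewrite /Phi /patch; case: ifP.
have PhiH y : (\int[leb]_t Phi (t, y))%E = H (A `&` s @^-1` [set y]).
  have [yy|yy] := boolP (y1 < y < y2); last first.
    rewrite (_ : A `&` _ = set0) ?hausdorff1_0; last first.
      by rewrite -subset0 => x [/Ay + /= E]; rewrite E (negbTE yy).
    apply: integral0_eq => t _; rewrite /Phi /patch memNset// => -[_ /=].
    by rewrite (negbTE yy).
  rewrite flow_box_hausdorff// [RHS]integral_mkcond; apply: eq_integral => t _.
  rewrite /Phi /F /coarea_fun /patch; case: ifPn => [/[1!inE] -[/= tab _]|/negP Dty].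
    case: ifPn => [Atg|/negP nAtg].
      by rewrite mem_set//; split => /=; [rewrite in_itv|move: Atg; rewrite inE].
    by rewrite memNset// => -[_ /= h]; apply: nAtg; rewrite inE.
  by rewrite memNset// => -[/= tab _]; apply: Dty; rewrite inE; split => //=.
split.
  have := @measurable_fun_fubini_tonelli_G _ _ (measurableTypeR R) (measurableTypeR R) R leb Phi mPhi Phi0.
  by apply: eq_measurable_fun => y _; exact: PhiH.
under [RHS]eq_integral do rewrite -PhiH.
rewrite -(fubini_tonelli Phi)//.
pose f x := ((fun x => (enorm (s1 x, s2 x))%:E) \_ A) x.
have fE t z : a < t < b -> f (t, z) = (F (t, z) * (if (c < z < d)%R then s2 (t, z) else 0%R)%:E)%E.
  move=> tab; rewrite /f /F /coarea_fun /patch; case: ifPn => [|_]; last by rewrite mul0e.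
  by rewrite inE => /Abox [_ /= zcd]; rewrite zcd -EFinM rho_s2// /box tab; case/andP: zcd => ? ?; rewrite !ltW.
have mf : measurable_fun setT f.
  apply: (measurable_restrictT _ _).1 => //; apply/measurable_EFinP.
  have : measurable_fun A (fun x => rho x * s2 x).
    by apply: measurable_funM; [exact: measurable_funS mrho|exact: measurable_funS ms2].
  apply: eq_measurable_fun => -[t z]; rewrite inE => /Abox /box0_box bx.
  exact: rho_s2.
have f0 x : (0 <= f x)%E.
  by rewrite /f /patch; case: ifP => // _; rewrite lee_fin enorm_ge0.
rewrite integral_mkcond /lebesgue2.
rewrite (@fubini_tonelli1 _ _ _ _ _ leb leb f mf f0).
apply: eq_integral => t _; rewrite /fubini_F.
have [tab|tab] := boolP (a < t < b); last first.
  rewrite integral0_eq.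
    by rewrite integral0_eq// => y _; rewrite /Phi /patch memNset// => -[/=]; rewrite (negbTE tab).
  move=> z _; rewrite /f /patch memNset// => /Abox [/=]; by rewrite (negbTE tab).
under eq_integral do rewrite fE//.
rewrite (flow_box_substitution (F := fun z => F (t, z)))//.
- rewrite integral_mkcond; apply: eq_integral => y _; rewrite /Phi /patch.
  case: ifPn => [|/negP yy]; last by rewrite memNset// => -[_ /= h]; apply: yy; rewrite inE/= in_itv.
  by rewrite inE/= in_itv/= => yy; rewrite mem_set.
- by apply: measurableT_comp => //; apply: measurable_fun_pair.
- by move=> z zcd; apply: AF => /Abox [_ /=].
- by move=> z _ sy; apply: AF => /Ay.
Qed.

End flow_box.

(** * The coarea formula *)

Section C1_on.
Context {R : realType}.

(** The partial derivatives are arguments, so that explicit formulas for them can be carried through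
    sums, products and compositions. *)
Definition C1_on (O : set (R * R)) (s s1 s2 : R * R -> R) := forall x, O x ->
  [/\ is_derive x (1, 0) s (s1 x), is_derive x (0, 1) s (s2 x),
      {for x, continuous s}, {for x, continuous s1} & {for x, continuous s2}].

Lemma C1_onS (O O' : set (R * R)) s s1 s2 : O' `<=` O ->
  C1_on O s s1 s2 -> C1_on O' s s1 s2.
Proof. by move=> OO h x /OO /h. Qed.

Lemma C1_onN (O : set (R * R)) s s1 s2 : C1_on O s s1 s2 ->
  C1_on O (fun x => - s x) (fun x => - s1 x) (fun x => - s2 x).
Proof.
move=> h x /h[d1 d2 c c1 c2]; split; [exact: is_deriveN|exact: is_deriveN| | |]; exact: cvgN.
Qed.

End C1_on.

Section coarea.
Context {R : realType}.
Notation H := (@hausdorff1 R).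
Notation leb := (@lebesgue_measure R).
Implicit Types (O : set (R * R)) (s : R * R -> R) (A : set (borel_plane R)).

(** Measurability in [y] is part of the property because countable additivity of the right-hand side
    rests on it. *)
Definition coarea_on s (s1 s2 : R * R -> R) A :=
  measurable_fun setT (fun y : measurableTypeR R => H (A `&` s @^-1` [set y])) /\
  (\int[@lebesgue2 R]_(x in A) (enorm (s1 x, s2 x))%:E =
   \int[leb]_y H (A `&` s @^-1` [set y]))%E.

Lemma coarea_on_bigcup O s s1 s2 (F : nat -> set (borel_plane R)) :
  open O -> C1_on O s s1 s2 ->
  (forall i, measurable (F i)) -> trivIset setT F -> (forall i, F i `<=` O) ->
  (forall i, coarea_on s s1 s2 (F i)) -> coarea_on s s1 s2 (\bigcup_i F i).
Proof.
move=> oO sC mF tF FO FP.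
have ms : measurable_fun (O : set (borel_plane R)) s.
  by apply: continuous_on_measurable => // x /sC[].
have me : measurable_fun (O : set (borel_plane R)) (fun x => (enorm (s1 x, s2 x))%:E).
  apply/measurable_EFinP; apply: continuous_on_measurable => // x /sC[_ _ _ c1 c2].
  apply: (@continuous_comp _ _ _ (fun x => dot (s1 x, s2 x) (s1 x, s2 x)) Num.sqrt).
    by apply: cvgD => /=; apply: cvgM.
  exact: sqrt_continuous.
have mFs i y : measurable (F i `&` s @^-1` [set y]).
  rewrite (_ : _ `&` _ = F i `&` (O `&` s @^-1` [set y])).
    apply: measurableI => //; apply: ms; first exact: open_borel_plane.
    exact: measurable_set1.
  by rewrite setIA (setIidl (FO i)).
have HE y : H (\bigcup_i F i `&` s @^-1` [set y]) =
    (\sum_(0 <= i <oo) H (F i `&` s @^-1` [set y]))%E.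
  rewrite setI_bigcupl measure_bigcup//.
    by apply: eq_eseriesl => i; exact: mem_set.
  by apply: trivIset_setIr.
have HFm i : measurable_fun setT (fun y : measurableTypeR R => H (F i `&` s @^-1` [set y])).
  by have [] := FP i.
split.
  rewrite (_ : (fun y : measurableTypeR R => _) = fun y =>
    (\sum_(0 <= i <oo | i \in xpredT) H (F i `&` s @^-1` [set y]))%E).
    by apply: ge0_emeasurable_sum => // i y _ _; exact: hausdorff1_ge0.
  by apply/funext => y; rewrite HE.
rewrite ge0_integral_bigcup//; first last.
- by move=> x _; rewrite lee_fin enorm_ge0.
- by apply: measurable_funS me; [exact: open_borel_plane|move=> x [i _ /FO]].
under [RHS]eq_integral do rewrite HE.
rewrite integral_nneseries//.
by apply: eq_eseriesr => i _; have [_ ->] := FP i.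
Qed.

(** Every point of [O] lies in a flow box whose corners, levels [y1], [y2] and constant [K] are
    rational, so countably many boxes cover [O]. *)
Lemma coarea_pos O s s1 s2 A : open O -> C1_on O s s1 s2 ->
  (forall x, O x -> 0 < s2 x) -> measurable A -> A `<=` O ->
  coarea_on s s1 s2 A.
Proof.
move=> oO sC s2gt0 mA AO.
pose Q : countType := (rat * rat * rat * rat * rat * rat * rat)%type.
pose box (q : Q) : set (R * R) := let: (a, b, c, d, _, _, _) := q in
  [set x | ratr a < x.1 < ratr b /\ ratr c < x.2 < ratr d].
pose cbox (q : Q) : set (R * R) := let: (a, b, c, d, _, _, _) := q in
  [set x | ratr a < x.1 < ratr b /\ ratr c <= x.2 <= ratr d].
pose ok (q : Q) := let: (a, b, c, d, y1, y2, K) := q in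
  [/\ (ratr c : R) < ratr d, (ratr y1 : R) < ratr y2, cbox q `<=` O,
     (forall t, ratr a < t < ratr b -> s (t, ratr c) <= ratr y1 /\ ratr y2 <= s (t, ratr d)) &
     forall x x', cbox q x -> cbox q x' -> `|s1 x| <= ratr K * s2 x'].
pose N (q : Q) : set (borel_plane R) := let: (a, b, c, d, y1, y2, K) := q in
  if pselect (ok q) then box q `&` [set x | ratr y1 < s x < ratr y2] else set0.
have open_box q : open (box q).
  by case: q => -[[[[[a b] c] d] y1] y2] K; exact: open_rectangle.
have mN q : measurable (N q).
  have ob := open_box q; move: ob.
  case: q => -[[[[[a b] c] d] y1] y2] K ob; rewrite /N; case: pselect => [okq|?]; last exact: measurable0.
  have [_ _ cO _ _] := okq.
  rewrite (_ : [set x | _] = s @^-1` `]ratr y1, ratr y2[%classic); last first.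
    by apply/seteqP; split => x /=; rewrite in_itv.
  have ms : measurable_fun (box (a, b, c, d, y1, y2, K) : set (borel_plane R)) s.
    apply: continuous_on_measurable => // x /= [xab /andP[/ltW cx /ltW xd]].
    have Ox : O x by apply: cO; split => //; rewrite cx.
    by have [] := sC _ Ox.
  by apply: ms; [exact: open_borel_plane|exact: measurable_itv].
have NO q : N q `<=` O.
  case: q => -[[[[[a b] c] d] y1] y2] K x; rewrite /N; case: pselect => // -[_ _ cO _ _] [/= [xab /andP[/ltW cx /ltW xd]] _].
  by apply: cO; split => //; rewrite cx.
pose P A := A `<=` O /\ coarea_on s s1 s2 A.
suff [] : P A by [].
apply: (@countable_cover_ind _ _ P (fun n => if unpickle n is Some q then N q else set0)) => //.
- by move=> n; case: unpickle => [q|]; [exact: mN|exact: measurable0].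
- move=> n B mB; case: unpickle => [q BN|B0]; last first.
    have -> : B = set0 by rewrite -subset0.
    split; first exact: sub0set.
    split; first by under eq_fun do rewrite set0I hausdorff1_0; exact: measurable_cst.
    rewrite integral_set0 integral0_eq// => y _; by rewrite set0I hausdorff1_0.
  split; first exact: subset_trans BN (NO q).
  move: BN; case: q => -[[[[[a b] c] d] y1] y2] K; rewrite /N.
  case: pselect => [okq|?]; last first.
    move=> B0; have -> : B = set0 by rewrite -subset0.
    split; first by under eq_fun do rewrite set0I hausdorff1_0; exact: measurable_cst.
    rewrite integral_set0 integral0_eq// => y _; by rewrite set0I hausdorff1_0.
  move=> BN; have {}BN : B `<=` box (a, b, c, d, y1, y2, K) `&` [set x | ratr y1 < s x < ratr y2] := BN.
  case: okq => cd y12 cO sy sK.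
  have inO t z : (ratr a < t < ratr b) && (ratr c <= z <= ratr d) -> O (t, z).
    by move=> /andP[? ?]; apply: cO; split.
  apply: (@flow_box_coarea R (ratr a) (ratr b) (ratr c) (ratr d) (ratr y1) (ratr y2) (ratr K) s s1 s2) => //.
  + by move=> t z /inO /sC[].
  + by move=> t z /inO /sC[].
  + by move=> t z /inO /sC[].
  + by move=> t z /inO /sC[].
  + by move=> t z /inO /sC[].
  + by move=> t z /inO /s2gt0.
  + by move=> t /sy[].
  + by move=> t /sy[].
  + by move=> t z t' z' /andP[? ?] /andP[? ?]; apply: sK.
  + by move=> x /BN[].
  + by move=> x /BN[].
- move=> F mF tF FP; split; first by move=> x [i _]; have [FO _] := FP i; exact: FO.
  by apply: (coarea_on_bigcup oO sC) => // i; have [] := FP i.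
rewrite -bigcup_unpickle => x /AO; move: (x : R * R) => {x} x Ox.
have [dx1 dx2 cx cx1 cx2] := sC _ Ox.
have s2x := s2gt0 _ Ox.
have s2x2 : 0 < s2 x / 2 by rewrite divr_gt0.
have /nbhs_boxP[e0 e00 he0] : nbhs x (O `&` ([set z | `|s1 x - s1 z| < 1] `&` [set z | `|s2 x - s2 z| < s2 x / 2])).
  apply: filterI; first exact: open_nbhs_nbhs.
  apply: filterI; first by move/cvgrPdist_lt : cx1; apply.
  by move/cvgrPdist_lt : cx2; apply.
(* The order of choices: heights [c] and [d] around [x.2]; then levels [y1] and [y2] strictly
   between the value of [s] at [x] and its values at the two ends; then [a] and [b] so close to
   [x.1] that the horizontal sides stay beyond these levels. *)
have [|c] := @rat_in_itvoo R (x.2 - e0) (x.2); first by rewrite ltrBlDr ltrDl.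
rewrite in_itv/= => /andP[ec cx'].
have [|d] := @rat_in_itvoo R (x.2) (x.2 + e0); first by rewrite ltrDl.
rewrite in_itv/= => /andP[xd de].
have sec z : ratr c <= z <= ratr d -> O (x.1, z) /\ 0 < s2 (x.1, z).
  move=> /andP[cz zd]; have [||? _] := he0 (x.1, z); first by rewrite subrr normr0.
    by rewrite ltr_distlC/= (lt_le_trans ec cz) (le_lt_trans zd de).
  by split => //; apply: s2gt0.
have mono z z' : ratr c <= z -> z < z' -> z' <= ratr d -> s (x.1, z) < s (x.1, z').
  move=> cz zz zd.
  have [|w] := @MVT_between R (fun z => s (x.1, z)) (fun z => s2 (x.1, z)) z z'.
    rewrite (min_idPl (ltW zz)) (max_idPr (ltW zz)) => w /andP[zw wz].
    have [|Ow _] := sec w; first by rewrite (le_trans cz zw) (le_trans wz zd).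
    by apply: is_derive_section2; have [] := sC _ Ow.
  rewrite (min_idPl (ltW zz)) (max_idPr (ltW zz)) => /andP[zw wz] E.
  rewrite -subr_gt0 E mulr_gt0 ?subr_gt0//.
  by have [|] := sec w; first by rewrite (le_trans cz zw) (le_trans wz zd).
have xE : (x.1, x.2) = x by case: (x).
have sxc : s (x.1, ratr c) < s x by rewrite -[in ltRHS]xE mono// ltW.
have sxd : s x < s (x.1, ratr d) by rewrite -[in ltLHS]xE mono// ltW.
have [y1] := rat_in_itvoo sxc; rewrite in_itv/= => /andP[cy1 y1x].
have [y2] := rat_in_itvoo sxd; rewrite in_itv/= => /andP[xy2 y2d].
have csec z : ratr c <= z <= ratr d -> {for x.1, continuous (fun t => s (t, z))}.
  move=> /sec[Oz _]; have [dz _ _ _ _] := sC _ Oz.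
  have [dz' _] := is_derive_section1 dz.
  by apply: differentiable_continuous; apply/derivable1_diffP.
pose c' : R := ratr c; pose d' : R := ratr d.
have cld : c' <= d' := ltW (lt_trans cx' xd).
have ccd : c' <= c' <= d' by rewrite lexx cld.
have dcd : c' <= d' <= d' by rewrite lexx cld.
have /nbhs_ballP[e1 /= e10 he1] : nbhs x.1 [set t | s (t, ratr c) < ratr y1].
  by move: (csec _ ccd [set z | z < ratr y1]); apply; apply: open_nbhs_nbhs; split => //; exact: open_lt.
have /nbhs_ballP[e2 /= e20 he2] : nbhs x.1 [set t | ratr y2 < s (t, ratr d)].
  by move: (csec _ dcd [set z | ratr y2 < z]); apply; apply: open_nbhs_nbhs; split => //; exact: open_gt.
pose e := Num.min e0 (Num.min e1 e2).
have e_gt0 : 0 < e by rewrite !lt_min e00 e10.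
have [|a] := @rat_in_itvoo R (x.1 - e) (x.1); first by rewrite ltrBlDr ltrDl.
rewrite in_itv/= => /andP[ea ax].
have [|b] := @rat_in_itvoo R (x.1) (x.1 + e); first by rewrite ltrDl.
rewrite in_itv/= => /andP[xb be].
have te t : ratr a < t < ratr b -> `|x.1 - t| < e.
  by move=> /andP[at_ tb]; rewrite ltr_distlC (lt_trans ea at_) (lt_trans tb be).
(* In the box [|s1|] is at most [|s1 x| + 1] and [s2] exceeds [s2 x / 2], so any [K] above the
   quotient of these bounds will do. *)
have [|K] := @rat_in_itvoo R ((`|s1 x| + 1) / (s2 x / 2)) ((`|s1 x| + 1) / (s2 x / 2) + 1); first by rewrite ltrDl.
rewrite in_itv/= => /andP[K1 _].
exists (a, b, c, d, y1, y2, K); first exact: I.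
rewrite /N; case: pselect => [?|[]].
  by split; [split => /=; apply/andP|apply/andP].
have inb z : cbox (a, b, c, d, y1, y2, K) z -> [/\ O z, `|s1 x - s1 z| < 1 & `|s2 x - s2 z| < s2 x / 2].
  move=> [/te + /andP[cz zd]]; rewrite !lt_min => /andP[h1 _].
  have [] := he0 _ h1; first by rewrite ltr_distlC (lt_le_trans ec cz) (le_lt_trans zd de).
  by move=> ? [].
split => //.
- exact: lt_trans xd.
- exact: lt_trans xy2.
- by move=> z /inb[].
- move=> t /te; rewrite !lt_min => /andP[_ /andP[h1 h2]].
  by split; apply: ltW; [exact: he1|exact: he2].
- move=> z z' /inb[_ h1 _] /inb[_ _ h2].
  have {}h2 : s2 x / 2 < s2 z' := half_lt_near h2.
  have h3 : `|s1 z| <= `|s1 x| + 1.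
    rewrite -[s1 z](subrK (s1 x)) addrC (le_trans (ler_normD _ _))// lerD2l.
    by rewrite distrC ltW.
  apply: (le_trans h3); rewrite -ler_pdivrMr ?(lt_trans s2x2)//.
  apply: le_trans (ltW K1); apply: ler_wpM2l; first by rewrite addr_ge0.
  by rewrite lef_pV2; [exact: ltW|rewrite posrE (lt_trans s2x2 h2)|rewrite posrE].
Qed.

Lemma coarea_onN s s1 s2 A : coarea_on (fun x => - s x) (fun x => - s1 x) (fun x => - s2 x) A ->
  coarea_on s s1 s2 A.
Proof.
have E y : A `&` s @^-1` [set y] = A `&` (fun x => - s x) @^-1` [set - y].
  by apply/seteqP; split => x [Ax /= h]; split => //; [rewrite h|apply: oppr_inj].
have mopp : measurable_fun setT (-%R : measurableTypeR R -> measurableTypeR R).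
  exact: oppr_measurable.
move=> [mf If]; split.
  under eq_fun do rewrite E.
  exact: (measurableT_comp mf mopp).
have -> : (\int[@lebesgue2 R]_(x in A) (enorm (s1 x, s2 x))%:E =
    \int[@lebesgue2 R]_(x in A) (enorm (- s1 x, - s2 x))%:E)%E.
  by apply: eq_integral => x _; rewrite /enorm /dot /= !mulrNN.
rewrite If; under [RHS]eq_integral do rewrite E.
have := @ge0_integral_pushforward _ _ _ _ R _ mopp leb setT
  (fun y => H (A `&` (fun x => - s x) @^-1` [set y])) measurableT mf (fun _ _ => hausdorff1_ge0 _).
rewrite preimage_setT /comp => <-; apply: eq_measure_integral => B mB _.
exact/esym/lebesgue_measureN.
Qed.

(** Reflection in the diagonal preserves both measures and exchanges the roles of [s1] and [s2]. *)
Definition swap (x : R * R) : R * R := (x.2, x.1).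

Lemma swapK : involutive swap. Proof. by case. Qed.

Lemma enorm_swap x : enorm (swap x) = enorm x.
Proof. by rewrite /enorm /dot /= addrC. Qed.

Let hausdorff1_swap_le (B : set (R * R)) : (H (swap @^-1` B) <= H B)%E.
Proof.
apply: ge_ereal_sup => _ [del /= del0 <-].
apply: le_trans (hausdorff1_delta_le B del0).
apply: le_ereal_inf_tmp => _ [U [BU Ud] <-].
have dU i : diameter (swap @^-1` (U i)) = diameter (U i).
  have swap_le (V : set (R * R)) : (diameter (swap @^-1` V) <= diameter V)%E.
    rewrite /diameter ge_max; apply/andP; split; first exact: diameter_ge0.
    apply: ge_ereal_sup => _ [[x y] [/= Vx Vy] <-].
    rewrite -(enorm_swap (x - y)) (_ : swap (x - y) = swap x - swap y)//.
    exact: enorm_le_diameter.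
  apply/eqP; rewrite eq_le swap_le /=; apply: le_trans (swap_le _).
  by apply: le_diameter => x Ux; rewrite /= swapK.
apply: ereal_inf_lbound; exists (fun i => swap @^-1` (U i)).
  split; last by move=> i; rewrite dU.
  by move=> x /BU[i _ Ui]; exists i.
by apply: eq_eseriesr => i _; exact: dU.
Qed.

Lemma hausdorff1_swap (B : set (R * R)) : H (swap @^-1` B) = H B.
Proof.
apply/eqP; rewrite eq_le hausdorff1_swap_le /=.
apply: le_trans (hausdorff1_swap_le _).
by apply: le_hausdorff1 => x Bx; rewrite /= swapK.
Qed.

Lemma measurable_swap : measurable_fun setT (swap : borel_plane R -> borel_plane R).
Proof. by apply: measurable_fun_pair; [exact: measurable_snd|exact: measurable_fst]. Qed.

Lemma lebesgue2_swap A : measurable A -> lebesgue2 (swap @^-1` A) = lebesgue2 A.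
Proof.
move=> mA; apply/esym; apply: (product_measure_unique (m' :=
  measure_function_pushforward__canonical__measure_function_Measure (@lebesgue2 R) measurable_swap)) => //.
move=> B C mB mC; rewrite /= /pushforward.
rewrite (_ : swap @^-1` _ = C `*` B); last by apply/seteqP; split => x [].
by rewrite /lebesgue2 product_measure1E// muleC.
Qed.

Lemma ge0_integral_swap (D : set (borel_plane R)) (f : borel_plane R -> \bar R) :
  measurable D -> measurable_fun D f -> (forall x, D x -> (0 <= f x)%E) ->
  (\int[@lebesgue2 R]_(x in swap @^-1` D) f (swap x) = \int[@lebesgue2 R]_(x in D) f x)%E.
Proof.
move=> mD mf f0.
have f0' : {in D, forall x, (0 <= f x)%E} by move=> x; rewrite inE; exact: f0.
have <- := @ge0_integral_pushforward _ _ (borel_plane R) (borel_plane R) R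
  (swap : borel_plane R -> borel_plane R) measurable_swap (@lebesgue2 R) D f mD mf f0'.
apply: (eq_measure_integral (@lebesgue2 R) (m1 :=
  measure_function_pushforward__canonical__measure_function_Measure (@lebesgue2 R) measurable_swap)) => B mB _.
exact: lebesgue2_swap.
Qed.

Lemma coarea_on_swap s s1 s2 A : measurable A ->
  measurable_fun A (fun x => enorm (s1 x, s2 x)) ->
  coarea_on (s \o swap) (s2 \o swap) (s1 \o swap) (swap @^-1` A) ->
  coarea_on s s1 s2 A.
Proof.
move=> mA me.
have E y : H (swap @^-1` A `&` (s \o swap) @^-1` [set y]) = H (A `&` s @^-1` [set y]).
  by rewrite -(hausdorff1_swap (A `&` s @^-1` [set y])).
move=> [mf If]; split.
  by move: mf; under eq_fun do rewrite E.
under [RHS]eq_integral do rewrite -E.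
rewrite -If -ge0_integral_swap//.
- by apply: eq_integral => x _ /=; rewrite -enorm_swap.
- exact/measurable_EFinP.
- by move=> x _; rewrite lee_fin enorm_ge0.
Qed.

Lemma C1_on_swap O s s1 s2 : C1_on O s s1 s2 ->
  C1_on (swap @^-1` O) (s \o swap) (s2 \o swap) (s1 \o swap).
Proof.
move=> h x /= /h[d1 d2 c c1 c2].
have cs : {for x, continuous swap} by exact: (cvg_pair cvg_snd cvg_fst).
have dE (e : R * R) d : is_derive (swap x) (swap e) s d -> is_derive x e (s \o swap) d.
  have E : (fun h : R => h^-1 *: (((s \o swap) \o shift x) (h *: e) - (s \o swap) x)) =
    (fun h => h^-1 *: ((s \o shift (swap x)) (h *: swap e) - s (swap x))).
    by apply/funext => k /=; congr (_ *: (s _ - _)).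
  by case=> [df dfE]; split; [rewrite /derivable E|rewrite /derive E].
split; [exact: dE|exact: dE| | |]; exact: continuous_comp.
Qed.

(** Four open sets, on each of which one partial derivative has a sign, cover [O]. A change of sign
    and a reflection reduce each of them to [coarea_pos]. *)
Theorem coarea_regular O s s1 s2 A : open O -> C1_on O s s1 s2 ->
  (forall x, O x -> (s1 x, s2 x) != 0) -> measurable A -> A `<=` O ->
  coarea_on s s1 s2 A.
Proof.
move=> oO sC sne0 mA AO.
have opos (f : R * R -> R) : (forall x, O x -> {for x, continuous f}) ->
    open (O `&` [set x | 0 < f x]).
  move=> cf; rewrite openE => x [Ox fx]; apply: filterI; first exact: open_nbhs_nbhs.
  by move: (cf _ Ox [set x | 0 < x]); apply; apply: open_nbhs_nbhs; split => //; exact: open_gt.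
pose N i : set (borel_plane R) := match i with
  | 0 => O `&` [set x | 0 < s2 x] | 1 => O `&` [set x | 0 < - s2 x]
  | 2 => O `&` [set x | 0 < s1 x] | _ => O `&` [set x | 0 < - s1 x] end.
have oN i : open (N i : set (R * R)).
  case: i => [|[|[|i]]]; apply: opos => x /sC[_ _ _ c1 c2]; [exact: c2|exact: cvgN c2|exact: c1|exact: cvgN c1].
have NO i : N i `<=` O by case: i => [|[|[|i]]] x [].
have me (B : set (borel_plane R)) : measurable B -> B `<=` O ->
    measurable_fun B (fun x => enorm (s1 x, s2 x) : measurableTypeR R).
  move=> mB BO; apply: (@measurable_funS _ _ _ _ (O : set (borel_plane R))) => //; first exact: open_borel_plane.
  apply: continuous_on_measurable => // x /sC[_ _ _ c1 c2].
  apply: (@continuous_comp _ _ _ (fun x => dot (s1 x, s2 x) (s1 x, s2 x)) Num.sqrt).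
    by apply: cvgD => /=; apply: cvgM.
  exact: sqrt_continuous.
have oswap (V : set (R * R)) : open V -> open (swap @^-1` V).
  have /continuousP : continuous (swap : R * R -> R * R).
    by move=> x; exact: (cvg_pair cvg_snd cvg_fst).
  exact.
have mswap B : measurable B -> measurable (swap @^-1` B : set (borel_plane R)).
  by move=> mB; rewrite -[X in measurable X]setTI; exact: measurable_swap.
suff [] : A `<=` O /\ coarea_on s s1 s2 A by [].
apply: (@countable_cover_ind _ _ (fun A => A `<=` O /\ coarea_on s s1 s2 A) N) => //.
- by move=> i; exact: open_borel_plane.
- move=> i B mB BN; have BO := subset_trans BN (NO i); split => //.
  case: i BN => [|[|[|i]]] BN.
  + apply: (coarea_pos (oN 0) _ _ mB BN); last by move=> x [].
    exact: C1_onS sC.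
  + apply: coarea_onN; apply: (coarea_pos (oN 1) _ _ mB BN); last by move=> x [].
    by apply: C1_onN; exact: C1_onS sC.
  + apply: (coarea_on_swap mB (me B mB BO)).
    apply: (coarea_pos (oswap _ (oN 2)) _ _ (mswap B mB)); [|by move=> x []|by move=> x /BN].
    by apply: C1_on_swap; exact: C1_onS sC.
  + apply: (coarea_on_swap mB (me B mB BO)).
    apply: coarea_onN; apply: (coarea_pos (oswap _ (oN 3)) _ _ (mswap B mB)); [|by move=> x []|by move=> x /BN].
    by apply: C1_onN; apply: C1_on_swap; exact: C1_onS sC.
- move=> F mF tF FP; split; first by move=> x [i _]; have [FO _] := FP i; exact: FO.
  by apply: (coarea_on_bigcup oO sC) => // i; have [] := FP i.
move=> x /AO Ox; have := sne0 _ Ox.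
have [s2x|s2x|s2x] := ltgtP (s2 x) 0.
- by move=> _; exists 1%N => //; split => //=; rewrite oppr_gt0.
- by move=> _; exists 0%N.
have [s1x|s1x|s1x] := ltgtP (s1 x) 0.
- by move=> _; exists 3%N => //; split => //=; rewrite oppr_gt0.
- by move=> _; exists 2%N.
by rewrite s1x s2x eqxx.
Qed.


(** The version for sets says that the measure with density [|grad s|] on [O] disintegrates along
    the Hausdorff measures of the level sets. *)
Theorem coarea O s s1 s2 (f : borel_plane R -> \bar R) : open O -> C1_on O s s1 s2 ->
  (forall x, O x -> (s1 x, s2 x) != 0) ->
  measurable_fun setT f -> (forall x, (0 <= f x)%E) ->
  measurable_fun setT (fun y : measurableTypeR R =>
    (\int[H]_(x in O `&` s @^-1` [set y]) f x)%E) /\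
  (\int[@lebesgue2 R]_(x in O) ((enorm (s1 x, s2 x))%:E * f x) =
   \int[leb]_y \int[H]_(x in O `&` s @^-1` [set y]) f x)%E.
Proof.
move=> oO sC sne0 mf f0.
have mO : measurable (O : set (borel_plane R)) by exact: open_borel_plane.
have mOs y : measurable (O `&` s @^-1` [set y] : set (borel_plane R)).
  have ms : measurable_fun (O : set (borel_plane R)) s.
    by apply: continuous_on_measurable => // x /sC[].
  by apply: ms => //; exact: measurable_set1.
pose k (y : measurableTypeR R) : {measure set (borel_plane R) -> \bar R} := mrestr H (mOs y).
pose r := (fun x => enorm (s1 x, s2 x)) \_ O.
have mr : measurable_fun setT (fun x : borel_plane R => (r x)%:E).
  apply/measurable_EFinP.
  apply: (@measurable_restrictT _ _ (borel_plane R) (measurableTypeR R) O _ _).1 => //.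
  apply: continuous_on_measurable => // x /sC[_ _ _ c1 c2].
  apply: (@continuous_comp _ _ _ (fun x => dot (s1 x, s2 x) (s1 x, s2 x)) Num.sqrt).
    by apply: cvgD => /=; apply: cvgM.
  exact: sqrt_continuous.
have r0 (x : borel_plane R) : (0 <= (r x)%:E)%E.
  by rewrite lee_fin /r /patch; case: ifP => // _; exact: enorm_ge0.
have kE y : (\int[k y]_x f x = \int[H]_(x in O `&` s @^-1` [set y]) f x)%E.
  exact: ge0_integral_mrestr.
have reg A : measurable A -> coarea_on s s1 s2 (A `&` O).
  by move=> mA; apply: (coarea_regular oO) => //; exact: measurableI.
have mk A : measurable A -> measurable_fun setT (fun y => k y A).
  move=> mA; have [+ _] := reg A mA.
  by apply: eq_measurable_fun => y _; rewrite /k /= /mrestr setIA.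
have muE A : measurable A -> (density (@lebesgue2 R) mr r0 A = \int[leb]_y k y A)%E.
  move=> mA; have [_ E] := reg A mA.
  transitivity (\int[leb]_y H (A `&` O `&` s @^-1` [set y]))%E; last first.
    by apply: eq_integral => y _; rewrite /k /= /mrestr setIA.
  rewrite -E /density integral_mkcondr; apply: eq_integral => x _.
  by rewrite /r /patch; case: ifP.
split.
  have := disintegration_measurable mk mf f0.
  by apply: eq_measurable_fun => y _; exact: kE.
under [RHS]eq_integral do rewrite -kE.
rewrite -(disintegration mk muE)// ge0_integral_density// [LHS]integral_mkcond.
by apply: eq_integral => x _; rewrite /r /patch; case: ifP => // _; rewrite mul0e.
Qed.

End coarea.

(** * Smooth splines *)

Section smooth1.
Context {R : realType}.
Implicit Types (f g : R -> R) (x : R).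

Fixpoint smooth1 (k : nat) f : Prop :=
  (forall x, derivable f x 1) /\ if k is k'.+1 then smooth1 k' f^`()%classic else True.

Lemma smooth1_derivable k f x : smooth1 k f -> derivable f x 1.
Proof. by case: k => [|k] [h _]; exact: h. Qed.

Lemma smooth1S k f : smooth1 k.+1 f -> smooth1 k f.
Proof.
elim: k f => [|k IH] f [df h]; first by split.
by split => //; exact: IH.
Qed.

Lemma smooth1_is_derive k f (f' : R -> R) :
  (forall x, is_derive x 1 f (f' x)) -> smooth1 k f' -> smooth1 k.+1 f.
Proof.
move=> df sf'; split; first by move=> x; have [] := df x.
have -> : f^`()%classic = f' by apply/funext => x; rewrite derive1E; have [] := df x.
exact: sf'.
Qed.

Lemma smooth1_D k f : smooth1 k.+1 f -> forall x, is_derive x 1 f (f^`()%classic x).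
Proof. by move=> [df _] x; rewrite derive1E; exact: DeriveDef. Qed.

Lemma smooth1_cst k (c : R) : smooth1 k (cst c).
Proof.
elim: k c => [|k IH] c; first by split => // x; exact: derivable_cst.
exact: (@smooth1_is_derive k _ (cst 0)).
Qed.

Lemma smooth1_id k : smooth1 k id.
Proof.
case: k => [|k]; first by split => // x; exact: derivable_id.
by apply: (@smooth1_is_derive k _ (cst 1)) => //; exact: smooth1_cst.
Qed.

Lemma smooth1_add k f g : smooth1 k f -> smooth1 k g -> smooth1 k (f + g).
Proof.
elim: k f g => [|k IH] f g sf sg.
  by split => // x; apply: derivableD; [case: sf|case: sg].
apply: (@smooth1_is_derive k _ (f^`()%classic + g^`()%classic)).
  by move=> x; exact: is_deriveD (smooth1_D sf x) (smooth1_D sg x).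
by apply: IH; [case: sf|case: sg].
Qed.

Lemma smooth1_mul k f g : smooth1 k f -> smooth1 k g -> smooth1 k (f * g).
Proof.
elim: k f g => [|k IH] f g sf sg.
  by split => // x; apply: derivableM; [case: sf|case: sg].
apply: (@smooth1_is_derive k _ (f * g^`()%classic + g * f^`()%classic)).
  by move=> x; exact: is_deriveM (smooth1_D sf x) (smooth1_D sg x).
by apply: smooth1_add; apply: IH; [exact: smooth1S|case: sg|exact: smooth1S|case: sf].
Qed.

Lemma smooth1_affine k f (a b : R) : smooth1 k f -> smooth1 k (fun x => f (a * x + b)).
Proof.
have dab x : is_derive x 1 (fun x : R => a * x + b) a.
  have := is_deriveD (is_deriveZ a (is_derive_id x (1 : R))) (is_derive_cst b x (1 : R)).
  by congr is_derive; rewrite addr0 [LHS]mulr1.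
elim: k f => [|k IH] f sf.
  split => // x.
  have : is_derive (a * x + b) 1 f (f^`()%classic (a * x + b)).
    by rewrite derive1E; apply: DeriveDef => //; case: sf.
  by move=> h; have [] := @is_derive1_comp _ f (fun x => a * x + b) _ _ _ h (dab x).
apply: (@smooth1_is_derive k (fun x => f (a * x + b)) ((fun x => f^`()%classic (a * x + b)) * cst a)).
  move=> x; exact: (@is_derive1_comp _ f (fun x => a * x + b) _ _ _ (smooth1_D sf _) (dab x)).
by apply: smooth1_mul; [apply: IH; case: sf|exact: smooth1_cst].
Qed.

Lemma smooth1_inv k f : (forall x, f x != 0) -> smooth1 k f -> smooth1 k (fun x => (f x)^-1).
Proof.
move=> f0; elim: k => [|k IH] sf.
  by split => // x; case: sf => df _; have [] := is_deriveV (f0 x) (derivableP (df x)).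
have IH' := IH (smooth1S sf).
apply: (@smooth1_is_derive k (fun x => (f x)^-1) (cst (-1) * ((fun x => (f x)^-1) * (fun x => (f x)^-1)) * f^`()%classic)).
  move=> x; have := is_deriveV (f0 x) (smooth1_D sf x).
  congr is_derive; rewrite /= /GRing.scale /=.
  by rewrite -[RHS]/(-1 * ((f x)^-1 * (f x)^-1) * _) mulN1r -expr2 exprVn.
apply: smooth1_mul; last by case: sf.
by apply: smooth1_mul; [exact: smooth1_cst|exact: smooth1_mul].
Qed.

(** The classical flat function is the case [n = 0]. The family in [n] is there because derivatives
    of its members are combinations of its members, so that smoothness is an induction on the
    order. *)
Definition flat (n : nat) (x : R) : R :=
  if 0 < x then x^-1 ^+ n * expR (- x^-1) else 0.

Lemma flat_ge0 n x : 0 <= flat n x.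
Proof.
rewrite /flat; case: ifPn => // x0; rewrite mulr_ge0 ?expR_ge0// exprn_ge0//.
by rewrite invr_ge0 ltW.
Qed.

(** The Taylor bound for [exp (1 / x)] with the term of degree [n + 1] leaves one factor [x]: enough
    for continuity at 0. *)
Lemma flat_le n x : flat n x <= n.+1`!%:R * `|x|.
Proof.
rewrite /flat; case: ifPn => [x0|_]; last by rewrite mulr_ge0.
rewrite gtr0_norm// expRN ler_pdivrMr ?expR_gt0//.
have x0' : 0 <= x^-1 by rewrite invr_ge0 ltW.
have := expR_ge1Dxn n x0'.
move=> h; have {}h : x^-1 ^+ n.+1 / n.+1`!%:R <= expR x^-1.
  by apply: le_trans h; rewrite lerDr.
rewrite ler_pdivrMr ?ltr0n ?fact_gt0// in h.
rewrite -mulrA [X in _ * X]mulrC mulrA -ler_pdivrMr// -exprSr.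
by rewrite mulrC.
Qed.

Lemma is_derive_flat n (x : R) : is_derive x 1 (flat n : R -> R) (- n%:R * flat n.+1 x + flat n.+2 x).
Proof.
have [x0|x0|->] := ltgtP x 0.
- have f0 m : flat m x = 0 by rewrite /flat ltNge ltW.
  rewrite !f0 mulr0 addr0.
  apply: (near_eq_is_derive _ (is_derive_cst (0 : R) x (1 : R))).
  near=> y; rewrite /flat ifF//; apply/negbTE; rewrite -leNgt ltW//.
  by near: y; exact: lt_nbhsl.
- apply: (@near_eq_is_derive _ _ _ (fun x => x^-1 ^+ n * expR (- x^-1))).
    near=> y; rewrite /flat ifT//; near: y; exact: lt_nbhsr.
  have xn0 : x != 0 by rewrite gt_eqF.
  have dV : is_derive x 1 (fun x : R => x^-1) (- (x ^- 2)).
    by have := is_deriveV xn0 (is_derive_id x 1); rewrite /GRing.scale /= mulr1.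
  have dX := is_deriveX n dV.
  have dE : is_derive x 1 (fun x : R => expR (- x^-1)) (expR (- x^-1) * x ^- 2).
    have := @is_derive1_comp _ expR (fun x => - x^-1) _ _ _ (is_derive_expR (- x^-1)) (is_deriveN dV).
    by rewrite opprK.
  case: n dX => [|n] dX.
    rewrite mulr0n oppr0 mul0r add0r /flat x0.
    have -> : (fun x : R => x^-1 ^+ 0 * expR (- x^-1)) = (fun x : R => expR (- x^-1)).
      by apply/funext => y; rewrite expr0 mul1r.
    by move: dE; congr is_derive; rewrite mulrC exprVn.
  have := is_deriveM dX dE; congr is_derive.
    by apply/funext => y; rewrite exprfctE.
  rewrite exprfctE /flat x0 /= /GRing.scale /=.
  rewrite -(exprVn x 2) !exprS expr0 mulr1 mulNr -mulr_natl.
  by move: (x^-1) (x^-1 ^+ n) (expR _) (n.+1%:R) => y p e m; ring.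
have f0 m : flat m 0 = 0 by rewrite /flat ltxx.
rewrite !f0 mulr0 addr0.
(* At 0 the difference quotient of [flat n] is [flat n.+1], which tends to 0 by [flat_le]. *)
apply/is_derive1_caratheodory; exists (flat n.+1); split => //.
- move=> z; rewrite f0 !subr0 /flat; case: ifPn => z0; last by rewrite mul0r.
  by rewrite exprS; field; rewrite gt_eqF.
- apply/cvgrPdist_lt => e e0; rewrite f0.
  have d0 : 0 < e / n.+2`!%:R by rewrite divr_gt0// ltr0n fact_gt0.
  near=> z; rewrite sub0r normrN (ger0_norm (flat_ge0 _ _)).
  apply: le_lt_trans (flat_le _ _) _.
  rewrite mulrC -ltr_pdivlMr ?ltr0n ?fact_gt0//.
Unshelve. all: by end_near. Qed.

Lemma smooth1_flat k n : smooth1 k (flat n).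
Proof.
elim: k n => [|k IH] n; first by split => // x; have [] := is_derive_flat n x.
apply: (@smooth1_is_derive k _ (cst (- n%:R) * flat n.+1 + flat n.+2)).
  exact: is_derive_flat.
by apply: smooth1_add => //; apply: smooth1_mul => //; exact: smooth1_cst.
Qed.

Definition step (x : R) := flat 0 x / (flat 0 x + flat 0 (1 - x)).

Lemma step_den x : flat 0 x + flat 0 (1 - x) != 0.
Proof.
rewrite gt_eqF//; have [x0|x0] := ltP 0 x.
  by rewrite ltr_wpDr ?flat_ge0// /flat x0 mul1r expR_gt0.
rewrite ltr_wpDl ?flat_ge0// /flat ifT ?mul1r ?expR_gt0//.
by rewrite subr_gt0 (le_lt_trans x0).
Qed.

Lemma smooth1_step k : smooth1 k step.
Proof.
apply: smooth1_mul; first exact: smooth1_flat.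
apply: smooth1_inv; first exact: step_den.
apply: smooth1_add; first exact: smooth1_flat.
have -> : (fun x => flat 0 (1 - x)) = (fun x => flat 0 (-1 * x + 1)).
  by apply/funext => x; rewrite mulN1r addrC.
exact/smooth1_affine/smooth1_flat.
Qed.

(** A smooth positive part. Its second difference is the spline, as for B-splines, and its slope is
    exactly 1 beyond 1, which makes the translates of [dbump1] sum to 1. *)
Definition ramp (x : R) := x * step x.

Lemma smooth1_ramp k : smooth1 k ramp.
Proof. by apply: smooth1_mul; [exact: smooth1_id|exact: smooth1_step]. Qed.

Lemma ramp_le0 x : x <= 0 -> ramp x = 0.
Proof. by move=> x0; rewrite /ramp /step [X in X / _]/flat ltNge x0 /= mul0r mulr0. Qed.

Lemma ramp_ge1 x : 1 <= x -> ramp x = x.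
Proof.
move=> x1; have x0 : 0 < x by rewrite (lt_le_trans ltr01).
rewrite /ramp /step [X in _ + X]/flat ifF ?addr0 ?divff ?mulr1//.
  by rewrite /flat x0 mul1r gt_eqF// expR_gt0.
by apply/negbTE; rewrite -leNgt subr_le0.
Qed.

Definition bump1 (x : R) := ramp x - ramp (x - 1).
(** Two differences serve two purposes: translates of [spline] form a partition of unity, and those
    of [dbump1], which appear after summation by parts, form another. *)
Definition spline (x : R) := bump1 x - bump1 (x - 1).

Lemma smooth1_shift k f : smooth1 k f -> smooth1 k (fun x => f (x - 1)).
Proof.
by move=> /(smooth1_affine 1 (-1)); under eq_fun do rewrite mul1r.
Qed.

Lemma smooth1_sub k f g : smooth1 k f -> smooth1 k g -> smooth1 k (fun x => f x - g x).
Proof.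
move=> sf sg.
have -> : (fun x => f x - g x) = f + cst (-1) * g.
  by apply/funext => x; rewrite -[in RHS]/(f x + -1 * g x) mulN1r.
by apply: smooth1_add => //; apply: smooth1_mul => //; exact: smooth1_cst.
Qed.

Lemma smooth1_bump1 k : smooth1 k bump1.
Proof.
by apply: smooth1_sub; [|apply: smooth1_shift]; exact: smooth1_ramp.
Qed.

Lemma smooth1_spline k : smooth1 k spline.
Proof.
by apply: smooth1_sub; [|apply: smooth1_shift]; exact: smooth1_bump1.
Qed.

Lemma bump1_le0 x : x <= 0 -> bump1 x = 0.
Proof. by move=> x0; rewrite /bump1 !ramp_le0 ?subrr//; lra. Qed.

Lemma bump1_ge2 x : 2 <= x -> bump1 x = 1.
Proof. by move=> x2; rewrite /bump1 !ramp_ge1; lra. Qed.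

Lemma spline_out x : ~ (0 < x < 3) -> spline x = 0.
Proof.
move=> /negP; rewrite negb_and -!leNgt => /orP[x0|x3]; rewrite /spline.
  by rewrite !bump1_le0 ?subrr//; lra.
by rewrite !bump1_ge2 ?subrr//; lra.
Qed.

Definition dbump1 : R -> R := bump1^`()%classic.

Lemma is_derive_bump1 x : is_derive x 1 bump1 (dbump1 x).
Proof. exact: (smooth1_D (smooth1_bump1 1)). Qed.

Lemma is_derive_spline x : is_derive x 1 spline (dbump1 x - dbump1 (x - 1)).
Proof.
have h : is_derive x 1 (fun x => bump1 (x - 1)) (dbump1 (x - 1)).
  have := @is_derive1_comp _ bump1 (fun x => x - 1) _ _ _ (is_derive_bump1 (x - 1))
    (is_deriveB (is_derive_id x (1 : R)) (is_derive_cst (1 : R) x (1 : R))).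
  by rewrite subr0 mulr1.
exact: is_deriveB (is_derive_bump1 x) h.
Qed.

(** The interval is half open to match [sum_norm_le], where it contains exactly three points of each
    translate of the integers. *)
Lemma dbump1_out x : ~ (0 <= x < 3) -> dbump1 x = 0.
Proof.
move=> /negP; rewrite negb_and -ltNge -leNgt => /orP[x0|x3].
  have : is_derive x 1 bump1 0.
    apply: (near_eq_is_derive _ (is_derive_cst (0 : R) x (1 : R))).
    near=> y; rewrite /= bump1_le0// ltW//; near: y; exact: lt_nbhsl.
  by move=> [_ <-]; rewrite /dbump1 derive1E.
have : is_derive x 1 bump1 0.
  apply: (near_eq_is_derive _ (is_derive_cst (1 : R) x (1 : R))).
  near=> y; rewrite /= bump1_ge2// ltW//; near: y; apply: lt_nbhsr.
  by rewrite (lt_le_trans _ x3)// ltr_nat.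
by move=> [_ <-]; rewrite /dbump1 derive1E.
Unshelve. all: by end_near. Qed.

End smooth1.

(** * Partitions of unity by integer translates *)

Section partition.
Context {R : realType}.
Implicit Types (f : R -> R) (x Z W C B G : R).

Lemma telescope_shift (V : R -> R) (N : nat) Z :
  \sum_(i < N) (V (Z - i%:R) - V (Z - i%:R - 1)) = V Z - V (Z - N%:R).
Proof.
elim: N => [|N IH]; first by rewrite big_ord0 subr0 subrr.
rewrite big_ord_recr /= IH -[N.+1]addn1 natrD.
by rewrite addrA subrK opprD addrA.
Qed.

Lemma sum_spline (N : nat) Z : 2 <= Z -> Z <= N%:R ->
  \sum_(i < N) spline (Z - i%:R) = 1.
Proof.
move=> Z2 ZN; rewrite (telescope_shift bump1) bump1_ge2// bump1_le0 ?subr0//.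
by rewrite subr_le0.
Qed.

Lemma dbump1_ramp x : dbump1 x = (ramp^`()%classic x - ramp^`()%classic (x - 1)).
Proof.
have h := @smooth1_D R 0 ramp (smooth1_ramp 1).
rewrite /dbump1 derive1E.
have h1 : is_derive x 1 (fun x : R => ramp (x - 1)) (ramp^`()%classic (x - 1)).
  have := @is_derive1_comp _ ramp (fun x => x - 1) _ _ _ (h (x - 1))
    (is_deriveB (is_derive_id x (1 : R)) (is_derive_cst (1 : R) x (1 : R))).
  by rewrite subr0 mulr1.
by have [_ ->] := is_deriveB (h x) h1.
Qed.

Lemma sum_dbump1 (N : nat) Z : 1 < Z -> Z < N%:R ->
  \sum_(i < N) dbump1 (Z - i%:R) = 1.
Proof.
move=> Z1 ZN; under eq_bigr do rewrite dbump1_ramp.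
rewrite (telescope_shift (ramp^`()%classic)) !derive1E.
have -> : 'D_1 ramp Z = 1.
  have : is_derive Z 1 ramp 1.
    apply: (near_eq_is_derive _ (is_derive_id Z (1 : R))).
    by near=> y; rewrite ramp_ge1// ltW//; near: y; exact: lt_nbhsr.
  by case.
have -> : 'D_1 ramp (Z - N%:R) = 0.
  have : is_derive (Z - N%:R) 1 ramp 0.
    apply: (near_eq_is_derive _ (is_derive_cst (0 : R) (Z - N%:R) (1 : R))).
    near=> y; rewrite /= ramp_le0// ltW//; near: y; apply: lt_nbhsl.
    by rewrite subr_lt0.
  by case.
by rewrite subr0.
Unshelve. all: by end_near. Qed.

(** At most three translates are nonzero. The counting is done by a telescoping sum:
    [V x - V (x - 1)] is [B] times the indicator of [[0, 3[]. *)
Lemma sum_norm_le f (B : R) (N : nat) Z : 0 <= B -> (forall x, `|f x| <= B) ->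
  (forall x, ~ (0 <= x < 3) -> f x = 0) ->
  \sum_(i < N) `|f (Z - i%:R)| <= 3 * B.
Proof.
move=> B0 fB f0.
pose h (x : R) : R := (0 <= x)%R%:R.
pose V x := B * (h x + h (x - 1) + h (x - 2)).
have h01 x : 0 <= h x <= 1 by rewrite /h; case: (0 <= x); rewrite ler01 lexx.
have hV x : `|f x| <= V x - V (x - 1).
  have -> : V x - V (x - 1) = B * (h x - h (x - 3)).
    rewrite /V; have -> : x - 1 - 1 = x - 2 by ring.
    have -> : x - 1 - 2 = x - 3 by ring.
    by ring.
  have [x3|/f0 ->] := pselect (0 <= x < 3).
    apply: le_trans (fB x) _; move: x3 => /andP[x0 x3].
    by rewrite /h x0 subr_ge0 (leNgt 3) x3 /= subr0 mulr1.
  rewrite normr0 mulr_ge0// subr_ge0 /h ler_nat.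
  have [x3|] := boolP (0 <= x - 3); last by [].
  by have -> : 0 <= x by lra.
apply: (@le_trans _ _ (\sum_(i < N) (V (Z - i%:R) - V (Z - i%:R - 1)))).
  by apply: ler_sum => i _; exact: hV.
rewrite telescope_shift /V.
have := h01 Z; have := h01 (Z - 1); have := h01 (Z - 2).
have := h01 (Z - N%:R); have := h01 (Z - N%:R - 1); have := h01 (Z - N%:R - 2).
move: (h _) (h _) (h _) (h _) (h _) (h _) => p q r s t u.
by move=> /andP[? ?] /andP[? ?] /andP[? ?] /andP[? ?] /andP[? ?] /andP[? ?]; nra.
Qed.

Lemma smooth1_bounded f (a b : R) k : smooth1 k f -> (forall x, ~ (a <= x <= b) -> f x = 0) ->
  exists2 B, 0 <= B & forall x, `|f x| <= B.
Proof.
move=> sf f0.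
have cf : continuous f.
  by move=> x; apply: differentiable_continuous; apply/derivable1_diffP; exact: smooth1_derivable sf.
have [ab|ab] := leP a b; last first.
  exists 0 => // x; rewrite f0 ?normr0//; move=> /andP[ax xb].
  by have := le_trans ax xb; rewrite leNgt ab.
have cn : {within `[a, b], continuous (fun x => `|f x|)}.
  apply: continuous_subspaceT => x.
  by apply: continuous_comp; [exact: cf|exact: norm_continuous].
have [c _ hc] := EVT_max ab cn.
exists `|f c| => // x.
have [xab|/f0 ->] := pselect (a <= x <= b); last by rewrite normr0.
by apply: hc; rewrite in_itv.
Qed.

Lemma spline_bounded : exists2 B : R, 0 <= B & forall x, `|spline x| <= B /\ `|dbump1 x| <= B.
Proof.
have [|B1 B10 hB1] := @smooth1_bounded spline 0 3 0 (smooth1_spline 0).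
  by move=> x h; apply: spline_out => /andP[h1 h2]; apply: h; rewrite !ltW.
have [||B2 B20 hB2] := @smooth1_bounded dbump1 0 3 0.
- by case: (smooth1_bump1 (R := R) 1).
- by move=> x h; apply: dbump1_out => /andP[h1 h2]; apply: h; rewrite h1 ltW.
exists (B1 + B2); first by rewrite addr_ge0.
move=> x; split; first by rewrite (le_trans (hB1 x))// lerDl.
by rewrite (le_trans (hB2 x))// lerDr.
Qed.

(* Summation by parts moves the difference quotient from the spline to its coefficients. *)
Lemma sum_parts (p : nat -> R) (u : R -> R) (N : nat) Z : p 0%N = 0 -> p N = 0 ->
  \sum_(i < N.+1) p i * (u (Z - i%:R) - u (Z - i%:R - 1)) =
  \sum_(i < N) (p i.+1 - p i) * u (Z - 1 - i%:R).
Proof.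
move=> p0 pN.
under eq_bigr do rewrite mulrBr; rewrite big_split /= sumrN.
rewrite big_ord_recl /= p0 mul0r add0r big_ord_recr /= pN mul0r addr0.
under [RHS]eq_bigr do rewrite mulrBl; rewrite [RHS]big_split /= sumrN.
congr (_ - _); apply: eq_bigr => i _.
  by rewrite /bump /= add1n -[i.+1%:R]natr1 opprD addrA addrAC.
by rewrite addrAC.
Qed.

(** In each variable at most three terms are nonzero, each at most [B], hence the factor
    [(3 * B) ^+ 2]. *)
Lemma quasi_bound (B : R) (g : nat -> nat -> R) (N N' : nat) Z W C : 0 <= C -> 0 <= B ->
  (forall x, `|spline x| <= B /\ `|dbump1 x| <= B) ->
  (forall i k, (i < N)%N -> (k < N')%N -> 0 <= Z - i%:R < 3 -> 0 <= W - k%:R < 3 -> `|g i k| <= C) ->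
  `|\sum_(i < N) \sum_(k < N') g i k * dbump1 (Z - i%:R) * spline (W - k%:R)| <= C * (3 * B) ^+ 2.
Proof.
move=> C0 B0 hB hg.
have sp0 x : ~ (0 <= x < 3) -> spline x = 0 :> R.
  by move=> h; apply: spline_out => /andP[h1 h2]; apply: h; rewrite ltW.
apply: (@le_trans _ _ (\sum_(i < N) \sum_(k < N') C * (`|dbump1 (Z - i%:R)| * `|spline (W - k%:R)|))).
  apply: le_trans (ler_norm_sum _ _ _) _; apply: ler_sum => i _.
  apply: le_trans (ler_norm_sum _ _ _) _; apply: ler_sum => k _.
  rewrite !normrM -mulrA.
  have [zi|zi] := pselect (0 <= Z - i%:R < 3); last first.
    by rewrite dbump1_out// normr0 !mul0r !mulr0.
  have [wk|wk] := pselect (0 <= W - k%:R < 3); last first.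
    by rewrite sp0// normr0 !mulr0.
  by apply: ler_wpM2r; rewrite ?mulr_ge0// hg.
have -> : \sum_(i < N) \sum_(k < N') C * (`|dbump1 (Z - i%:R)| * `|spline (W - k%:R)|) =
    C * ((\sum_(i < N) `|dbump1 (Z - i%:R)|) * (\sum_(k < N') `|spline (W - k%:R)|)).
  rewrite mulr_suml mulr_sumr; apply: eq_bigr => i _.
  by rewrite mulr_sumr mulr_sumr.
apply: ler_wpM2l => //; rewrite expr2; apply: ler_pM; rewrite ?sumr_ge0//.
  by apply: sum_norm_le => //; [move=> x; case: (hB x)|exact: dbump1_out].
by apply: sum_norm_le => //; move=> x; case: (hB x).
Qed.

(** Both families of translates sum to 1 and so reproduce the constant [G]; the error is the same
    sum with [g - G] in place of [g]. *)
Lemma quasi_approx (B : R) (g : nat -> nat -> R) (N N' : nat) Z W G C : 0 <= C -> 0 <= B ->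
  (forall x, `|spline x| <= B /\ `|dbump1 x| <= B) ->
  1 < Z < N%:R -> 2 <= W <= N'%:R ->
  (forall i k, (i < N)%N -> (k < N')%N -> 0 <= Z - i%:R < 3 -> 0 <= W - k%:R < 3 -> `|g i k - G| <= C) ->
  `|\sum_(i < N) \sum_(k < N') g i k * dbump1 (Z - i%:R) * spline (W - k%:R) - G| <= C * (3 * B) ^+ 2.
Proof.
move=> C0 B0 hB /andP[Z1 ZN] /andP[W2 WN] hg.
have -> : G = \sum_(i < N) \sum_(k < N') G * dbump1 (Z - i%:R) * spline (W - k%:R).
  under eq_bigr do rewrite -mulr_sumr sum_spline// mulr1.
  by rewrite -mulr_sumr sum_dbump1// mulr1.
rewrite -sumrB; under eq_bigr do rewrite -sumrB.
under eq_bigr do (under eq_bigr do rewrite -mulrBl -mulrBl).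
exact: (@quasi_bound B (fun i k => g i k - G)).
Qed.

End partition.

Section Ck.
Context {R : realType}.
Implicit Types (f g : R * R -> R) (a b : R -> R).

Let eqE (e : R * R) : (e = (1, 0) \/ e = (0, 1)) -> {b : bool | e = if b then (1, 0) else (0, 1)}.
Proof.
have [->|ne] := eqVneq e (1, 0); first by exists true.
by move=> h; exists false; case: h => // h; rewrite h eqxx in ne.
Qed.

Lemma CkD k f g : Ck k f -> Ck k g -> Ck k (f + g).
Proof.
elim: k f g => [|k IH] f g [cf hf] [cg hg]; split => //; try by move=> x; apply: continuousD; [exact: cf|exact: cg].
move=> e he; have [df kf] := hf e he; have [dg kg] := hg e he; split.
  by move=> x; exact: derivableD.
have -> : 'D_e (f + g) = 'D_e f + 'D_e g by apply/funext => x; rewrite deriveD.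
exact: IH.
Qed.

Lemma Ck0 k : Ck k (cst 0 : R * R -> R).
Proof.
elim: k => [|k IH]; split => //; try by move=> x; exact: cst_continuous.
move=> e he; split; first by move=> x; exact: derivable_cst.
by have -> : 'D_e (cst 0 : R * R -> R) = cst 0 by apply/funext => x; rewrite derive_cst.
Qed.

Lemma Ck_sum k (I : Type) (r : seq I) (F : I -> R * R -> R) : (forall i, Ck k (F i)) ->
  Ck k (fun x => \sum_(i <- r) F i x).
Proof.
move=> hF; elim: r => [|i r IH].
  under [X in Ck k X]eq_fun do rewrite big_nil.
  exact: Ck0.
under [X in Ck k X]eq_fun do rewrite big_cons.
exact: (@CkD k (F i) (fun x => \sum_(j <- r) F j x)).
Qed.

Lemma is_derive_of_section1 f (t z d : R) :
  is_derive t 1 (fun t => f (t, z)) d -> is_derive (t, z) ((1, 0) : R * R) f d.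
Proof.
have E : (fun h : R => h^-1 *: (((fun t => f (t, z)) \o shift t) (h *: 1) - f (t, z))) =
    (fun h => h^-1 *: ((f \o shift (t, z)) (h *: ((1, 0) : R * R)) - f (t, z))).
  apply/funext => h /=; congr (_ *: (f _ - _)).
  by apply: injective_projections => //=; rewrite scaler0 add0r.
case=> [df dE]; split; first by rewrite /derivable -E.
by rewrite /derive -E.
Qed.

Lemma is_derive_of_section2 f (t z d : R) :
  is_derive z 1 (fun z => f (t, z)) d -> is_derive (t, z) ((0, 1) : R * R) f d.
Proof.
have E : (fun h : R => h^-1 *: (((fun z => f (t, z)) \o shift z) (h *: 1) - f (t, z))) =
    (fun h => h^-1 *: ((f \o shift (t, z)) (h *: ((0, 1) : R * R)) - f (t, z))).
  apply/funext => h /=; congr (_ *: (f _ - _)).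
  by apply: injective_projections => //=; rewrite scaler0 add0r.
case=> [df dE]; split; first by rewrite /derivable -E.
by rewrite /derive -E.
Qed.

Lemma is_derive_tensor1 a b (x : R * R) d : is_derive x.1 1 a d ->
  is_derive x ((1, 0) : R * R) (fun x => a x.1 * b x.2) (d * b x.2).
Proof.
case: x => t z /= da; apply: is_derive_of_section1 => /=.
have := is_deriveM da (is_derive_cst (b z) t (1 : R)).
by rewrite scaler0 add0r (mulrC d).
Qed.

Lemma is_derive_tensor2 a b (x : R * R) d : is_derive x.2 1 b d ->
  is_derive x ((0, 1) : R * R) (fun x => a x.1 * b x.2) (a x.1 * d).
Proof.
case: x => t z /= db; apply: is_derive_of_section2 => /=.
have := is_deriveM (is_derive_cst (a t) z (1 : R)) db.
by rewrite scaler0 addr0.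
Qed.

Lemma smooth1_continuous k a : smooth1 k a -> continuous a.
Proof.
move=> sa x; apply: differentiable_continuous; apply/derivable1_diffP.
exact: smooth1_derivable sa.
Qed.

Lemma Ck_tensor k a b : (forall j, smooth1 j a) -> (forall j, smooth1 j b) ->
  Ck k (fun x => a x.1 * b x.2).
Proof.
have ct a' b' : smooth1 0 a' -> smooth1 0 b' -> continuous (fun x : R * R => a' x.1 * b' x.2).
  move=> sa sb x; apply: continuousM.
    by apply: continuous_comp; [exact: cvg_fst|exact: smooth1_continuous sa _].
  by apply: continuous_comp; [exact: cvg_snd|exact: smooth1_continuous sb _].
elim: k a b => [|k IH] a b sa sb; split => //; try exact: ct.
move=> e /eqE[[] ->].
  have d x := is_derive_tensor1 b (smooth1_D (sa 1%N) x.1).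
  split; first by move=> x; case: (d x).
  have -> : 'D_((1, 0) : R * R) (fun x => a x.1 * b x.2) = (fun x => a^`()%classic x.1 * b x.2).
    by apply/funext => x; have [_ ->] := d x.
  by apply: IH => // j; case: (sa j.+1).
have d x := is_derive_tensor2 a (smooth1_D (sb 1%N) x.2).
split; first by move=> x; case: (d x).
have -> : 'D_((0, 1) : R * R) (fun x => a x.1 * b x.2) = (fun x => a x.1 * b^`()%classic x.2).
  by apply/funext => x; have [_ ->] := d x.
by apply: IH => // j; case: (sb j.+1).
Qed.

End Ck.

(** * Approximation by tensor product splines *)

Section quasi.
Context {R : realType}.
Variables (n M : nat).
(** With mesh at most 1/3, points at distance at least 1 from the boundary of the square of side
    [2 M] see complete partitions of unity. *)
Hypothesis n3 : (3 <= n)%N.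
Implicit Types (phi : R * R -> R) (x y : R * R) (C e : R).

Let N := (2 * M * n)%N.
Definition node (i : nat) : R := i%:R / n%:R - M%:R.

Definition quasi phi x := \sum_(i < N.+1) \sum_(k < N.+1)
  phi (node i, node k) * spline (n%:R * (x.1 + M%:R) - i%:R) * spline (n%:R * (x.2 + M%:R) - k%:R).

(** The horizontal derivative of [quasi phi] after summation by parts. The coefficients have become
    difference quotients of [phi], that is, values of its derivative. *)
Definition dquasi phi x := \sum_(i < N) \sum_(k < N.+1)
  (n%:R * (phi (node i.+1, node k) - phi (node i, node k)))
  * dbump1 (n%:R * (x.1 + M%:R) - 1 - i%:R) * spline (n%:R * (x.2 + M%:R) - k%:R).

Let n0 : 0 < n%:R :> R.
Proof. by rewrite ltr0n (leq_trans _ n3). Qed.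

Let n3R : 3 <= n%:R :> R.
Proof. by rewrite (ler_nat _ 3). Qed.

Let NE : N%:R = 2 * M%:R * n%:R :> R.
Proof. by rewrite /N !natrM. Qed.

Let node0 : node 0 = - M%:R.
Proof. by rewrite /node mul0r add0r. Qed.

Let nodeN : node N = M%:R.
Proof. by rewrite /node NE mulfK ?gt_eqF//; ring. Qed.

Let nodeS i : node i.+1 - node i = n%:R^-1.
Proof. by rewrite /node -natr1; field; rewrite gt_eqF. Qed.

Let nodeE i (t : R) : t - node i = n%:R^-1 * (n%:R * (t + M%:R) - i%:R).
Proof. by rewrite /node; field; rewrite gt_eqF. Qed.

(** Allows the vertical derivative to be read off from the horizontal one. *)
Lemma quasi_swap phi x : quasi phi x = quasi (phi \o swap) (swap x).
Proof.
rewrite /quasi exchange_big /=; apply: eq_bigr => i _; apply: eq_bigr => k _ /=.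
by rewrite mulrAC.
Qed.

Lemma Ck_quasi phi k : Ck k (quasi phi).
Proof.
apply: Ck_sum => i; apply: Ck_sum => j.
have sp l m : smooth1 m (fun t : R => spline (n%:R * (t + M%:R) - l%:R)).
  have -> : (fun t : R => spline (n%:R * (t + M%:R) - l%:R)) =
      (fun t : R => spline (n%:R * t + (n%:R * M%:R - l%:R))).
    by apply/funext => t; rewrite mulrDr addrA.
  exact/smooth1_affine/smooth1_spline.
apply: (@Ck_tensor R k (fun t => phi (node i, node j) * spline (n%:R * (t + M%:R) - i%:R))
  (fun t => spline (n%:R * (t + M%:R) - j%:R))) => m; last exact: sp.
by apply: smooth1_mul; [exact: smooth1_cst|exact: sp].
Qed.

Lemma is_derive_quasi phi x : (forall x, M%:R <= `|x.1| -> phi x = 0) ->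
  is_derive x ((1, 0) : R * R) (quasi phi) (dquasi phi x).
Proof.
move=> phi0.
pose Z : R := n%:R * (x.1 + M%:R); pose W : R := n%:R * (x.2 + M%:R).
have dsp (c : R) (i : nat) : is_derive x.1 1 (fun t : R => c * spline (n%:R * (t + M%:R) - i%:R))
    (c * n%:R * (dbump1 (Z - i%:R) - dbump1 (Z - i%:R - 1))).
  have da : is_derive x.1 1 (fun t : R => n%:R * (t + M%:R) - i%:R) n%:R.
    have := is_deriveB (is_deriveZ n%:R (is_deriveD (is_derive_id x.1 (1 : R)) (is_derive_cst (M%:R : R) x.1 (1 : R))))
      (is_derive_cst (i%:R : R) x.1 (1 : R)).
    by congr is_derive; rewrite subr0 addr0 [LHS]mulr1.
  have := is_deriveZ c (@is_derive1_comp _ spline (fun t => n%:R * (t + M%:R) - i%:R) _ _ _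
    (is_derive_spline _) da).
  by congr is_derive; exact: etrans (congr1 ( *%R c) (mulrC _ _)) (mulrA _ _ _).
have -> : dquasi phi x = \sum_(i < N.+1) \sum_(k < N.+1) (phi (node i, node k) * n%:R *
    (dbump1 (Z - i%:R) - dbump1 (Z - i%:R - 1))) * spline (W - k%:R).
  rewrite /dquasi exchange_big [RHS]exchange_big /=; apply: eq_bigr => k _.
  rewrite -!mulr_suml; congr (_ * _).
  have := @sum_parts R (fun i => phi (node i, node k) * n%:R) dbump1 N Z.
  rewrite node0 nodeN !phi0 ?mul0r /= ?normrN ?ger0_norm// => /(_ erefl erefl) ->.
  by apply: eq_bigr => i _; rewrite -mulrBl (mulrC n%:R).
have -> : quasi phi = \sum_(i < N.+1) \sum_(k < N.+1) (fun x : R * R =>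
    phi (node i, node k) * spline (n%:R * (x.1 + M%:R) - i%:R) * spline (n%:R * (x.2 + M%:R) - k%:R)).
  apply/funext => z; rewrite fct_sumE; apply: eq_bigr => i _.
  by rewrite fct_sumE.
apply: is_derive_sum => i; apply: is_derive_sum => k.
exact: (is_derive_tensor1 (fun t => spline (n%:R * (t + M%:R) - k%:R)) (dsp _ i)).
Qed.

(** Each spline lives within three mesh widths to the right of its node, so the approximants of
    [phi] have supports in a slight thickening of that of [phi]. *)
Lemma quasi_support phi x : quasi phi x != 0 ->
  exists2 y, phi y != 0 & 0 <= x.1 - y.1 <= 3 / n%:R /\ 0 <= x.2 - y.2 <= 3 / n%:R.
Proof.
move=> q0; have : exists i k : 'I_N.+1, phi (node i, node k) * spline (n%:R * (x.1 + M%:R) - i%:R)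
    * spline (n%:R * (x.2 + M%:R) - k%:R) != 0.
  apply: contrapT => h; move/eqP: q0; apply.
  apply: big1 => i _; apply: big1 => k _; apply/eqP/negP => /negP ik.
  by apply: h; exists i, k.
have sp i (t : R) : spline (n%:R * (t + M%:R) - i%:R) != 0 -> 0 <= t - node i <= 3 / n%:R.
  move=> h; have {h} : 0 < n%:R * (t + M%:R) - i%:R < 3.
    by apply: contrapT => /spline_out /eqP; rewrite (negbTE h).
  rewrite nodeE => /andP[/ltW h1 /ltW h2].
  rewrite [_^-1 * _]mulrC; apply/andP; split; first by rewrite divr_ge0// ltW.
  by rewrite ler_pM2r ?invr_gt0.
move=> [i [k]]; rewrite !mulf_eq0 !negb_or => /andP[/andP[p0 /sp si] /sp sk].
by exists (node i, node k).
Qed.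

Variables (B : R) (G1 G2 : R * R -> R).
Hypothesis B0 : 0 <= B.
Hypothesis hB : forall x : R, `|spline x| <= B /\ `|dbump1 x| <= B.

Let slopeP phi i k : C1_on setT phi G1 G2 ->
  exists2 t, node i <= t <= node i.+1 &
    n%:R * (phi (node i.+1, node k) - phi (node i, node k)) = G1 (t, node k).
Proof.
move=> sC.
have ii : node i <= node i.+1 by rewrite -subr_ge0 nodeS invr_ge0 ltW.
have [|t] := @MVT_between R (fun t => phi (t, node k)) (fun t => G1 (t, node k)) (node i) (node i.+1).
  by move=> t _; apply: is_derive_section1; case: (sC (t, node k)).
rewrite (min_idPl ii) (max_idPr ii) => ht E; exists t => //.
by rewrite E nodeS mulrCA mulfV ?gt_eqF ?mulr1.
Qed.

(** Uniform in the mesh, as dominated convergence requires. *)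
Lemma dquasi_bound phi x C : C1_on setT phi G1 G2 -> 0 <= C -> (forall y, `|G1 y| <= C) ->
  `|dquasi phi x| <= C * (3 * B) ^+ 2.
Proof.
move=> sC C0 hG; apply: (@quasi_bound R B (fun i k => n%:R * (phi (node i.+1, node k) - phi (node i, node k)))) => //.
by move=> i k _ _ _ _; have [t _ ->] := slopeP i k sC.
Qed.

(** The distance [4 / n] consists of three mesh widths for the support of the splines and one for
    the shift by 1 that summation by parts leaves in [dquasi]. *)
Lemma dquasi_approx phi x e : C1_on setT phi G1 G2 -> 0 <= e ->
  `|x.1| <= M%:R - 1 -> `|x.2| <= M%:R - 1 ->
  (forall y, `|x.1 - y.1| <= 4 / n%:R -> `|x.2 - y.2| <= 4 / n%:R -> `|G1 y - G1 x| <= e) ->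
  `|dquasi phi x - G1 x| <= e * (3 * B) ^+ 2.
Proof.
move=> sC e0 x1 x2 hG.
have zz (t : R) : `|t| <= M%:R - 1 -> 3 <= n%:R * (t + M%:R) <= N%:R - 3.
  rewrite ler_norml NE => /andP[t1 t2].
  have t0 : 0 <= t + M%:R - 1 by lra.
  have t3 : 0 <= M%:R - 1 - t by lra.
  by have := n3R; nra.
have /andP[Z1 Z2] := zz _ x1; have /andP[W1 W2] := zz _ x2.
apply: (@quasi_approx R B (fun i k => n%:R * (phi (node i.+1, node k) - phi (node i, node k)))) => //.
- by apply/andP; split; lra.
- by rewrite -natr1; apply/andP; split; lra.
move=> i k _ _ hi hk; have [t /andP[t1 t2] ->] := slopeP i k sC.
have ni : 0 < n%:R^-1 :> R by rewrite invr_gt0.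
apply: hG => /=.
  have := nodeE i x.1; have := nodeS i.
  move: hi => /andP[]; move: t1 t2; set u := node i; set w := node i.+1.
  set z := _ * (_ + _); move: ni; set m := n%:R^-1.
  by move=> m0 h1 h2 h3 h4 h5 h6; rewrite ler_norml; apply/andP; split; nra.
have := nodeE k x.2; move: hk => /andP[]; move: ni; set m := n%:R^-1.
set z := _ * (_ + _) => m0 h1 h2 ->.
by rewrite ger0_norm; nra.
Qed.

End quasi.

(** * C^1 test functions *)

Lemma dominated_cvgR d (T : measurableType d) (R : realType) (mu : {measure set T -> \bar R})
    (D : set T) (h_ : nat -> T -> R) (h g : T -> R) : measurable D ->
  (forall n, measurable_fun D (h_ n)) ->
  (forall x, D x -> h_ n x @[n --> \oo] --> h x) ->
  mu.-integrable D (EFin \o g) ->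
  (forall n x, D x -> `|h_ n x| <= g x) ->
  (\int[mu]_(x in D) (h_ n x)%:E)%E @[n --> \oo] --> (\int[mu]_(x in D) (h x)%:E)%E.
Proof.
move=> mD mh ch ig hg.
apply: (@dominated_cvg _ _ _ mu D mD (fun n => EFin \o h_ n) (EFin \o h) (EFin \o g)) => //.
- by move=> n; apply/measurable_EFinP; exact: mh.
- by move=> x Dx; apply: cvg_EFin; [exact: nearW|exact: ch].
Qed.

Section planar.
Context {R : realType}.
Local Notation leb := (@lebesgue_measure R).
Implicit Types (K T O Omega : set (R * R)) (f phi : R * R -> R) (x y : R * R).

Definition box (M : R) : set (R * R) := [set x | `|x.1| <= M /\ `|x.2| <= M].

Lemma boxE M : box M = `[- M, M]%classic `*` `[- M, M]%classic.
Proof.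
by apply/seteqP; split => x /=; rewrite /box /= !in_itv /= !ler_norml.
Qed.

Lemma compact_box M : compact (box M).
Proof. by rewrite boxE; apply: compact_setX; exact: segment_compact. Qed.

Lemma measurable_box M : measurable (box M : set (borel_plane R)).
Proof. by rewrite boxE; apply: measurableX; exact: measurable_itv. Qed.

Lemma lebesgue2_box (M : R) : 0 <= M -> lebesgue2 (box M) = ((2 * M) ^+ 2)%:E.
Proof.
move=> M0; rewrite boxE.
pose I : set (measurableTypeR R) := `[- M, M]%classic.
have mI : measurable I by exact: measurable_itv.
transitivity (leb I * leb I)%E.
  by apply: product_measure1E.
rewrite /I lebesgue_measure_itv /= lte_fin.
have E : (if - M < M then (M%:E - (- M)%:E)%E else 0%E) = (2 * M)%:E.
  case: ifPn => h; first by rewrite -EFinB; congr EFin; lra.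
  by congr EFin; lra.
by rewrite E -EFinM expr2.
Qed.

Lemma closed_compact K : compact K -> closed K.
Proof. by apply: compact_closed; exact: norm_hausdorff. Qed.

Lemma compact_openC K : compact K -> open (~` K).
Proof. by move=> cK; rewrite openC; exact: closed_compact. Qed.

Lemma compact_measurable K : compact K -> measurable (K : set (borel_plane R)).
Proof.
move=> cK; rewrite -[K]setCK; apply: measurableC; apply: open_borel_plane.
exact: compact_openC.
Qed.

Lemma compact_bound K f : compact K -> {within K, continuous f} ->
  exists2 C, 0 < C & forall x, K x -> `|f x| <= C.
Proof.
move=> cK cf; have /compact_bounded := continuous_compact cf cK.
move=> /pinfty_ex_gt0[C C0 hC]; exists C => // x Kx.
by apply: (hC (f x)); exists x.
Qed.

Lemma compact_sub_box K : compact K -> exists2 M : nat, (0 < M)%N & K `<=` box M%:R.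
Proof.
move=> cK.
have [C1 C10 h1] := @compact_bound K fst cK (continuous_subspaceT (fun=> cvg_fst)).
have [C2 C20 h2] := @compact_bound K snd cK (continuous_subspaceT (fun=> cvg_snd)).
have [k hk] := exists_nat_gt (C1 + C2).
exists k.+1 => // x Kx; rewrite /box /= -natr1; have := h1 x Kx; have := h2 x Kx.
by split; lra.
Qed.

(** The set [T] is the sum of [K] and a small box. It contains the supports of all spline
    approximants of a function supported in [K]. *)
Lemma compact_thicken K O : compact K -> open O -> K `<=` O ->
  exists2 e, 0 < e & exists2 T, compact T /\ T `<=` O &
    forall x y, K x -> `|y.1 - x.1| <= e -> `|y.2 - x.2| <= e -> T y.
Proof.
move=> cK oO KO.
have : \forall e \near 0^'+, K `<=` [set x | forall y, `|y.1 - x.1| <= e -> `|y.2 - x.2| <= e -> O y].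
  move/compact_near_coveringP: cK; apply => x Kx.
  have /nbhs_boxP[r r0 hr] : nbhs x O by apply: open_nbhs_nbhs; split => //; exact: KO.
  exists ([set z | `|x.1 - z.1| < r / 2 /\ `|x.2 - z.2| < r / 2], [set e | e < r / 2]) => /=.
    split; last by apply: nbhs_right_lt; rewrite divr_gt0.
    by apply/nbhs_boxP; exists (r / 2); rewrite ?divr_gt0.
  move=> [z e] /= [[z1 z2] er] y y1 y2; apply: hr => /=.
  - have -> : x.1 - y.1 = (x.1 - z.1) - (y.1 - z.1) by ring.
    by rewrite (le_lt_trans (ler_normB _ _))//; lra.
  - have -> : x.2 - y.2 = (x.2 - z.2) - (y.2 - z.2) by ring.
    by rewrite (le_lt_trans (ler_normB _ _))//; lra.
move=> h; have [e [e0 he]] : exists e : R, 0 < e /\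
    K `<=` [set x | forall y, `|y.1 - x.1| <= e -> `|y.2 - x.2| <= e -> O y].
  near (0 : R)^'+ => e; exists e; split; first by near: e; exact: nbhs_right_gt.
  by near: e.
exists e => //; exists ((fun p : (R * R) * (R * R) => p.1 + p.2) @` (K `*` box e)).
  split.
    apply: continuous_compact; last exact: compact_setX cK (@compact_box e).
    by apply: continuous_subspaceT => p; exact: add_continuous.
  move=> _ [[x y] [/= Kx [y1 y2]] <-]; apply: (he x) => //=.
    by rewrite addrAC subrr add0r.
  by rewrite addrAC subrr add0r.
move=> x y Kx y1 y2; exists (x, y - x) => //=.
by rewrite addrC subrK.
Unshelve. all: by end_near. Qed.

Lemma integrable_on_box (D : set (borel_plane R)) f (M C : R) : measurable D -> measurable_fun D f ->
  0 <= M -> 0 <= C -> (forall x, D x -> `|f x| <= C) -> (forall x, D x -> ~ box M x -> f x = 0) ->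
  (@lebesgue2 R).-integrable D (EFin \o f).
Proof.
move=> mD mf M0 C0 fC f0; apply/integrableP; split; first exact/measurable_EFinP.
apply: (@le_lt_trans _ _ (\int[@lebesgue2 R]_(x in D) (C%:E * (\1_(box M) x)%:E))%E).
  apply: ge0_le_integral => //.
  - by apply: measurableT_comp => //; exact/measurable_EFinP.
  - apply/measurable_EFinP; apply: measurable_funM => //.
    apply: (@measurable_funTS _ _ (borel_plane R)); apply: measurable_indic; exact: measurable_box.
  move=> x Dx /=; rewrite -EFinM lee_fin indicE.
  have [bx|nbx] := pselect (box M x); first by rewrite mem_set// mulr1 fC.
  by rewrite f0// normr0 memNset// mulr0.
rewrite ge0_integralZl//; last first.
  apply/measurable_EFinP; apply: (@measurable_funTS _ _ (borel_plane R)).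
  by apply: measurable_indic; exact: measurable_box.
rewrite integral_indic//; last exact: measurable_box.
apply: (@le_lt_trans _ _ (C%:E * ((2 * M) ^+ 2)%:E)%E); last by rewrite -EFinM ltry.
apply: lee_wpmul2l; first by rewrite lee_fin.
rewrite -lebesgue2_box//; apply: le_measure; rewrite ?inE.
- by apply: measurableI => //; exact: measurable_box.
- exact: measurable_box.
by move=> x [].
Qed.

Lemma is_derive_near0 f x e d : (\forall y \near x, f y = 0) -> is_derive x e f d -> d = 0.
Proof.
move=> f0 [_ <-]; rewrite -(@near_eq_derive _ _ _ (cst 0) f) ?derive_cst//.
by near=> y; apply/esym; near: y.
Unshelve. all: by end_near. Qed.

Lemma C1_on_supp K phi G1 G2 : compact K -> C1_on setT phi G1 G2 -> (forall x, ~ K x -> phi x = 0) ->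
  forall x, ~ K x -> G1 x = 0 /\ G2 x = 0.
Proof.
move=> cK sC phi0 x Kx.
have h : \forall y \near x, phi y = 0.
  have : nbhs x (~` K) by apply: open_nbhs_nbhs; split => //; exact: compact_openC.
  by apply: filterS => y; exact: phi0.
by have [d1 d2 _ _ _] := sC x I; split; [exact: is_derive_near0 h d1|exact: is_derive_near0 h d2].
Qed.

Lemma C1_on_glue O K phi G1 G2 : compact K -> K `<=` O -> C1_on O phi G1 G2 ->
  (forall x, ~ K x -> [/\ phi x = 0, G1 x = 0 & G2 x = 0]) -> C1_on setT phi G1 G2.
Proof.
move=> cK KO sC h0 x _; have [/KO /sC//|Kx] := pselect (K x).
have hK : nbhs x (~` K) by apply: open_nbhs_nbhs; split => //; exact: compact_openC.
have [_ E1 E2] := h0 x Kx.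
have nc f : (forall y, ~ K y -> f y = 0) -> {for x, continuous f}.
  by move=> f0; apply: (near_cst_continuous (0 : R)); apply: filterS hK.
have hd e : is_derive x e phi 0.
  apply: (near_eq_is_derive _ (is_derive_cst (0 : R) x e)).
  by apply: filterS hK => y /h0[].
split.
- by rewrite E1.
- by rewrite E2.
- by apply: nc => y /h0[].
- by apply: nc => y /h0[].
- by apply: nc => y /h0[].
Qed.

(* A C^1 function with compact support is approximated, together with its gradient, by
   the tensor product splines [quasi], which are smooth test functions. *)
Theorem div_free_C1 Omega (F1 F2 : R * R -> R) phi G1 G2 K : open Omega ->
  (forall x, Omega x -> {for x, continuous F1} /\ {for x, continuous F2}) ->
  div_free Omega (fun x => (F1 x, F2 x)) ->
  compact K -> K `<=` Omega -> C1_on setT phi G1 G2 -> (forall x, ~ K x -> phi x = 0) ->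
  (\int[@lebesgue2 R]_(x in Omega) (F1 x * G1 x + F2 x * G2 x)%:E = 0)%E.
Proof.
move=> oO cF dF cK KO sC phi0.
have G0 := C1_on_supp cK sC phi0.
have [e e0 [T [cT TO] hT]] := compact_thicken cK oO KO.
have KT : K `<=` T by move=> x Kx; apply: (hT x) => //; rewrite subrr normr0 ltW.
(* The extra unit provides the distance between [T] and the boundary of the square that
   [dquasi_approx] asks for. *)
have [M0 _ TM0] := compact_sub_box cT; pose M := M0.+1.
have TM x : T x -> `|x.1| <= M%:R - 1 /\ `|x.2| <= M%:R - 1.
  by move=> /TM0; rewrite /M -natr1 addrK.
have phiM x : M%:R <= `|x.1| \/ M%:R <= `|x.2| -> phi x = 0.
  by move=> h; apply: phi0 => /KT /TM[h1 h2]; case: h; lra.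
have [B B0 hB] := @spline_bounded R.
have bd (f : R * R -> R) : (forall x, Omega x -> {for x, continuous f}) ->
    exists2 C, 0 < C & forall x, T x -> `|f x| <= C.
  move=> cf; apply: compact_bound => //; apply: continuous_in_subspaceT => x.
  by rewrite inE => /TO; exact: cf.
have [CF1 CF10 hF1] := bd F1 (fun x Ox => (cF x Ox).1).
have [CF2 CF20 hF2] := bd F2 (fun x Ox => (cF x Ox).2).
have [CG1 CG10 hG1'] := bd G1 (fun x _ => let: And5 _ _ _ c _ := sC x I in c).
have [CG2 CG20 hG2'] := bd G2 (fun x _ => let: And5 _ _ _ _ c := sC x I in c).
have hG1 x : `|G1 x| <= CG1.
  have [/hG1'//|Tx] := pselect (T x).
  by rewrite (G0 x _).1 ?normr0 ?ltW// => /KT.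
have hG2 x : `|G2 x| <= CG2.
  have [/hG2'//|Tx] := pselect (T x).
  by rewrite (G0 x _).2 ?normr0 ?ltW// => /KT.
have [n1 hn1] := exists_nat_gt (3 / e).
(* The mesh must be at most 1/3 and satisfy [3 / N n <= e], so that the support of [psi n] stays in
   [T]. *)
pose N n := (n + n1 + 3)%N.
have N3 n : (3 <= N n)%N by rewrite /N leq_addl.
have N0 n : 0 < (N n)%:R :> R by rewrite ltr0n (leq_trans _ (N3 n)).
have Ne n : 3 / (N n)%:R <= e.
  rewrite ler_pdivrMr// mulrC -ler_pdivrMr//; apply: le_trans (ltW hn1) _.
  by rewrite ler_nat /N -addnA addnC -addnA leq_addr.
pose psi n := quasi (N n) M phi.
pose d1 n x := dquasi (N n) M phi x.
pose d2 n x := dquasi (N n) M (phi \o swap) (swap x).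
have sC' : C1_on setT (phi \o swap) (G2 \o swap) (G1 \o swap).
  by have := C1_on_swap sC; rewrite preimage_setT.
have dpsi1 n x : is_derive x ((1, 0) : R * R) (psi n) (d1 n x).
  by apply: is_derive_quasi => // y h; apply: phiM; left.
have dpsi2 n x : is_derive x ((0, 1) : R * R) (psi n) (d2 n x).
  have /= : is_derive (swap x) ((1, 0) : R * R) (quasi (N n) M (phi \o swap)) (d2 n x).
    by apply: is_derive_quasi => // y h; apply: phiM; right.
  case: x => t z /= /is_derive_section1 /= h; apply: is_derive_of_section2.
  rewrite /psi; under eq_fun do rewrite quasi_swap.
  exact: h.
have psiT n x : ~ T x -> psi n x = 0.
  move=> Tx; apply/eqP; apply: contraPT Tx => /(quasi_support (N3 n))[y phiy [/andP[a1 a2] /andP[b1 b2]]].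
  move=> nT; apply: nT; apply: (hT y).
  - by apply: contrapT => /phi0 /eqP; rewrite (negbTE phiy).
  - by rewrite ger0_norm// (le_trans a2).
  - by rewrite ger0_norm// (le_trans b2).
have dT n x : ~ T x -> d1 n x = 0 /\ d2 n x = 0.
  move=> Tx.
  have h : \forall y \near x, psi n y = 0.
    have : nbhs x (~` T) by apply: open_nbhs_nbhs; split => //; exact: compact_openC.
    by apply: filterS => y; exact: psiT.
  by split; [exact: is_derive_near0 h (dpsi1 n x)|exact: is_derive_near0 h (dpsi2 n x)].
have tpsi n : test_function Omega (psi n).
  have cl : closure [set x | psi n x != 0] `<=` T.
    apply: (subset_trans _ (closed_compact cT)); apply: closure_subset => x /= h; apply: contrapT => /(psiT n) E.
    by rewrite E eqxx in h.
  split; first by move=> k; exact: Ck_quasi.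
    by apply: subclosed_compact cl => //; exact: closed_closure.
  exact: subset_trans cl TO.
have I0 n : (\int[@lebesgue2 R]_(x in Omega) (F1 x * d1 n x + F2 x * d2 n x)%:E = 0)%E.
  rewrite -[RHS](dF _ (tpsi n)); apply: eq_integral => x _.
  by rewrite /dot /grad /=; have [_ ->] := dpsi1 n x; have [_ ->] := dpsi2 n x.
have bd1 n x : `|d1 n x| <= CG1 * (3 * B) ^+ 2.
  by apply: (@dquasi_bound R (N n) M (N3 n) B G1 G2 B0 hB) => //; exact: ltW.
have bd2 n x : `|d2 n x| <= CG2 * (3 * B) ^+ 2.
  apply: (@dquasi_bound R (N n) M (N3 n) B _ _ B0 hB _ _ _ sC'); first exact: ltW.
  by move=> y; exact: hG2.
pose E := CF1 * (CG1 * (3 * B) ^+ 2) + CF2 * (CG2 * (3 * B) ^+ 2).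
have E0 : 0 <= E.
  have h (c d : R) : 0 < c -> 0 < d -> 0 <= c * (d * (3 * B) ^+ 2).
    by move=> c0 d0; apply: mulr_ge0; [exact: ltW|apply: mulr_ge0; [exact: ltW|exact: sqr_ge0]].
  by apply: addr_ge0; exact: h.
have mO : measurable (Omega : set (borel_plane R)) by exact: open_borel_plane.
have mT : measurable (T : set (borel_plane R)) by exact: compact_measurable.
have cpsi n : continuous (d1 n) /\ continuous (d2 n).
  have [+ _ _] := tpsi n => /(_ 1%N) [_ h]; split.
    have [_ [+ _]] := h ((1, 0) : R * R) (or_introl erefl).
    suff -> : 'D_((1, 0) : R * R) (psi n) = d1 n by [].
    by apply/funext => x; have [_ ->] := dpsi1 n x.
  have [_ [+ _]] := h ((0, 1) : R * R) (or_intror erefl).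
  suff -> : 'D_((0, 1) : R * R) (psi n) = d2 n by [].
  by apply/funext => x; have [_ ->] := dpsi2 n x.
have capp (g : R * R -> R) (dg : nat -> R * R -> R) x : {for x, continuous g} ->
    (forall n, (~ T x) -> dg n x = 0) -> (~ T x -> g x = 0) ->
    (forall n d, T x -> 0 <= d ->
      (forall y, `|x.1 - y.1| <= 4 / (N n)%:R -> `|x.2 - y.2| <= 4 / (N n)%:R -> `|g y - g x| <= d) ->
      `|dg n x - g x| <= d * (3 * B) ^+ 2) ->
    dg n x @[n --> \oo] --> g x.
  move=> cg h1 h2 h3; have [Tx|Tx] := pselect (T x); last first.
    rewrite (h2 Tx); apply: cvg_near_cst; apply: nearW => n; exact: h1.
  apply/cvgrPdist_le => d d0.
  have q0 : 0 < (3 * B) ^+ 2 + 1 by rewrite ltr_wpDl ?sqr_ge0.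
  pose d' := d / ((3 * B) ^+ 2 + 1).
  have d'0 : 0 < d' by rewrite divr_gt0.
  have /nbhs_boxP[r r0 hr] : \forall y \near x, `|g y - g x| <= d'.
    by move/cvgrPdist_le: cg => /(_ _ d'0); apply: filterS => y; rewrite distrC.
  have [m hm] := exists_nat_gt (4 / r).
  exists m => // n /= mn.
  have Nr : 4 / (N n)%:R < r.
    rewrite ltr_pdivrMr// mulrC -ltr_pdivrMr//; apply: lt_le_trans hm _.
    by rewrite ler_nat (leq_trans mn)// /N -addnA leq_addr.
  rewrite distrC; apply: (@le_trans _ _ (d' * (3 * B) ^+ 2)).
    apply: h3 => //; first exact: ltW.
    by move=> y y1 y2; apply: hr => /=; [exact: le_lt_trans y1 Nr|exact: le_lt_trans y2 Nr].
  have dE : d = d' * ((3 * B) ^+ 2 + 1) by rewrite divfK// gt_eqF.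
  by rewrite [leRHS]dE mulrDr mulr1 lerDl ltW.
have cv : (\int[@lebesgue2 R]_(x in Omega) (F1 x * d1 n x + F2 x * d2 n x)%:E)%E @[n --> \oo] -->
    (\int[@lebesgue2 R]_(x in Omega) (F1 x * G1 x + F2 x * G2 x)%:E)%E.
  apply: (@dominated_cvgR _ _ _ (@lebesgue2 R) Omega _ _ (fun x => E * \1_T x)) => //.
  - move=> n; apply: continuous_on_measurable => // x Ox.
    have [c1 c2] := cF x Ox; have [c3 c4] := cpsi n.
    by apply: continuousD; apply: continuousM => //; [exact: c3|exact: c4].
  - move=> x Ox; apply: cvgD; apply: cvgM; try exact: cvg_cst.
      apply: (capp G1 d1); first by case: (sC x I).
      + by move=> n /(dT n)[].
      + by move=> Tx; apply: (G0 x _).1 => /KT.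
      + by move=> n d /TM[? ?] ? h; apply: (dquasi_approx (N3 n) B0 hB sC).
    apply: (capp G2 d2); first by case: (sC x I).
    + by move=> n /(dT n)[].
    + by move=> Tx; apply: (G0 x _).2 => /KT.
    + move=> n d /TM[? ?] d0 h.
      rewrite (_ : G2 x = (G2 \o swap) (swap x)) in h *; last by rewrite /= swapK.
      by apply: (dquasi_approx (N3 n) B0 hB sC') => //= y y1 y2; apply: h.
  - apply: (@integrable_on_box _ _ M%:R E) => //.
    + by apply: measurable_funM => //; apply: (@measurable_funTS _ _ (borel_plane R)); exact: measurable_indic.
    + move=> x _; rewrite normrM ger0_norm// indicE; case: (_ \in _) => /=.
        by rewrite normr1 mulr1.
      by rewrite normr0 mulr0.
    + move=> x _ bx; rewrite indicE memNset ?mulr0// => /TM[h1 h2].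
      by apply: bx; split; lra.
  move=> n x Ox; rewrite indicE; have [Tx|Tx] := pselect (T x); last first.
    by have [-> ->] := dT n x Tx; rewrite memNset// !mulr0 addr0 normr0.
  rewrite mem_set// mulr1 (le_trans (ler_normD _ _))// !normrM lerD//.
    by apply: ler_pM => //; exact: hF1.
  by apply: ler_pM => //; exact: hF2.
have cv0 : (\int[@lebesgue2 R]_(x in Omega) (F1 x * d1 n x + F2 x * d2 n x)%:E)%E @[n --> \oo] --> 0%E.
  by apply: cvg_near_cst; apply: nearW => n; exact: I0.
exact: (cvg_unique _ cv cv0).
Qed.

End planar.

(** * Balance of the flux along the slope *)

Section C1_algebra.
Context {R : realType}.
Implicit Types (K O : set (R * R)) (f g : R * R -> R) (x : R * R).

Lemma C1_on_eq O f f1 f2 g g1 g2 : open O ->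
  (forall x, O x -> [/\ g x = f x, g1 x = f1 x & g2 x = f2 x]) ->
  C1_on O f f1 f2 -> C1_on O g g1 g2.
Proof.
move=> oO E fC x Ox; have [d1 d2 c c1 c2] := fC x Ox; have [_ E1 E2] := E x Ox.
have nO : nbhs x O by exact: open_nbhs_nbhs.
have nc (h k : R * R -> R) : (forall y, O y -> k y = h y) -> {for x, continuous h} -> {for x, continuous k}.
  move=> hk ch; have : h y @[y --> x] --> k x by rewrite (hk _ Ox).
  apply: cvg_trans; apply: near_eq_cvg; apply: filterS nO => y Oy; exact/esym/hk.
have nd e d : is_derive x e f d -> is_derive x e g d.
  by apply: near_eq_is_derive; apply: filterS nO => y /E[->].
split; [rewrite E1; exact: nd|rewrite E2; exact: nd|..].
- by apply: nc c => y /E[].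
- by apply: nc c1 => y /E[].
- by apply: nc c2 => y /E[].
Qed.

Lemma C1_on_mul O f f1 f2 g g1 g2 : C1_on O f f1 f2 -> C1_on O g g1 g2 ->
  C1_on O (fun x => f x * g x) (fun x => f x * g1 x + g x * f1 x) (fun x => f x * g2 x + g x * f2 x).
Proof.
move=> fC gC x Ox; have [d1 d2 c c1 c2] := fC x Ox; have [d1' d2' c' c1' c2'] := gC x Ox.
split.
- exact: is_deriveM.
- exact: is_deriveM.
- exact: continuousM.
- by apply: continuousD; exact: continuousM.
- by apply: continuousD; exact: continuousM.
Qed.

Lemma C1_on_comp O f f1 f2 (h h' : R -> R) : C1_on O f f1 f2 ->
  (forall x, O x -> is_derive (f x) 1 h (h' (f x)) /\ {for f x, continuous h'}) ->
  C1_on O (fun x => h (f x)) (fun x => h' (f x) * f1 x) (fun x => h' (f x) * f2 x).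
Proof.
move=> fC hC x Ox; have [d1 d2 c c1 c2] := fC x Ox; have [dh ch'] := hC x Ox.
have ch : {for f x, continuous h}.
  by apply: differentiable_continuous; apply/derivable1_diffP; case: dh.
have c' : {for x, continuous (fun x => h' (f x))} by exact: (@continuous_comp _ _ _ f h').
split.
- case: x {Ox c c1 c2 ch ch' c' d2} d1 dh => t z d1 dh; apply: is_derive_of_section1.
  exact: (@is_derive1_comp _ h (fun t => f (t, z)) _ _ _ dh (is_derive_section1 d1)).
- case: x {Ox c c1 c2 ch ch' c' d1} d2 dh => t z d2 dh; apply: is_derive_of_section2.
  exact: (@is_derive1_comp _ h (fun z => f (t, z)) _ _ _ dh (is_derive_section2 d2)).
- exact: (@continuous_comp _ _ _ f h).
- exact: continuousM.
- exact: continuousM.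
Qed.

Lemma C1_on_div O f f1 f2 g g1 g2 : C1_on O f f1 f2 -> C1_on O g g1 g2 -> open O ->
  (forall x, O x -> g x != 0) ->
  C1_on O (fun x => f x / g x) (fun x => (f1 x * g x - f x * g1 x) / g x ^+ 2)
    (fun x => (f2 x * g x - f x * g2 x) / g x ^+ 2).
Proof.
move=> fC gC oO g0.
have vC : C1_on O (fun x => (g x)^-1) (fun x => - (g x) ^- 2 * g1 x) (fun x => - (g x) ^- 2 * g2 x).
  apply: (@C1_on_comp O g g1 g2 (fun z : R => z^-1) (fun z : R => - z ^- 2)) => // x /g0 gx0.
  split.
    have := is_deriveV gx0 (is_derive_id (g x) (1 : R)).
    by congr is_derive; rewrite [LHS]mulr1.
  apply: continuousN; apply: continuousV; first by rewrite expf_neq0.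
  exact: exprn_continuous.
apply: (C1_on_eq oO _ (C1_on_mul fC vC)) => x /g0 gx0; split => //; by field.
Qed.

Lemma C1_extend O K f f1 f2 : open O -> C1_on O f f1 f2 -> compact K -> K `<=` O ->
  (forall x, O x -> ~ K x -> [/\ f x = 0, f1 x = 0 & f2 x = 0]) ->
  C1_on setT (f \_ O) (f1 \_ O) (f2 \_ O).
Proof.
move=> oO fC cK KO f0; apply: (C1_on_glue cK KO).
  by apply: C1_on_eq oO _ fC => x Ox; rewrite !patchE mem_set.
move=> x Kx; rewrite !patchE; case: ifPn => // xO.
by apply: f0 => //; exact: set_mem.
Qed.

(** The square of the positive part is a C^1 function vanishing on a half line; both [cut] and [rmp]
    are made from it. *)
Lemma is_derive_pos2 (t : R) : is_derive t 1 (fun t : R => Num.max t 0 ^+ 2) (2 * Num.max t 0).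
Proof.
have [t0|t0|->] := ltgtP t 0.
- rewrite mulr0; apply: (near_eq_is_derive _ (is_derive_cst (0 : R) t (1 : R))).
  near=> y; have /ltW/max_idPr -> : y < 0 by near: y; exact: lt_nbhsl.
  by rewrite expr0n.
- have -> : 2 * t = t *: (1 : R) + t *: (1 : R) by rewrite /GRing.scale /= !mulr1; ring.
  apply: (near_eq_is_derive _ (is_deriveM (is_derive_id t (1 : R)) (is_derive_id t (1 : R)))).
  near=> y; have /ltW/max_idPl -> // : 0 < y by near: y; exact: lt_nbhsr.
apply/is_derive1_caratheodory; exists (fun z => Num.max z 0); split.
- move=> z; rewrite maxxx expr0n /= !subr0 expr2.
  by rewrite /Num.max; case: ifPn; rewrite ?mulr0 ?mul0r.
- by apply: continuous_max; [exact: cvg_id|exact: cvg_cst].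
- by rewrite maxxx mulr0.
Unshelve. all: by end_near. Qed.

End C1_algebra.

Section balance.
Context {R : realType}.
Implicit Types (Omega K : set (R * R)) (x : R * R) (a b : R * R -> R).

Local Notation int2 D f := (\int[@lebesgue2 R]_(x in D) (f x)%:E)%E.

(* These conditions survive [(a, b) -> (a, - b)] and, in the plane, [(a, b) -> (b, a)]. *)
Record tame Omega a a1 a2 b b1 b2 : Prop := Tame {
  tame_open : open Omega;
  tame_C1a : C1_on Omega a a1 a2;
  tame_C1b : C1_on Omega b b1 b2;
  tame_bounded : forall M : R, exists2 C, 0 <= C & forall x, Omega x -> box M x ->
    [/\ `|a x| <= C, `|a1 x| <= C & `|a2 x| <= C] /\ [/\ `|b x| <= C, `|b1 x| <= C & `|b2 x| <= C];
  tame_compact : forall M e : R, 0 < e -> compact (Omega `&` box M `&` [set x | e <= b x]);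
  tame_div : forall phi G1 G2 K, compact K -> K `<=` Omega -> C1_on setT phi G1 G2 ->
    (forall x, ~ K x -> phi x = 0) ->
    int2 Omega (fun x => (a x * b1 x - b x * a1 x) * G1 x + (a x * b2 x - b x * a2 x) * G2 x) = 0%E;
  tame_energy : (int2 Omega (fun x => ((a x * b1 x - b x * a1 x) ^+ 2 + (a x * b2 x - b x * a2 x) ^+ 2)
      / (a x ^+ 2 + b x ^+ 2)) < +oo)%E;
  tame_cutoff : exists2 C0, 0 <= C0 & forall M d : R, 0 < d -> exists eta e1 e2 L,
    [/\ C1_on setT eta e1 e2, forall x, box M x -> eta x = 1,
       forall x, `|eta x| <= C0, 0 <= L /\ forall x, ~ box L x -> eta x = 0 &
       (int2 Omega (fun x => Num.sqrt ((a x * b1 x - b x * a1 x) ^+ 2 + (a x * b2 x - b x * a2 x) ^+ 2)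
         * (`|e1 x| + `|e2 x|)) <= d%:E)%E]
}.

(* [cut e] vanishes on [t <= e], tends to 1 on [t > 0] as e -> 0, and satisfies
   [0 <= t * cut' t <= 2] uniformly in e. *)
Definition cut (e t : R) := Num.max (t - e) 0 ^+ 2 * (t ^+ 2)^-1.
Definition dcut (e t : R) := 2 * Num.max (t - e) 0 * (t - Num.max (t - e) 0) * (t ^+ 3)^-1.

Let max_bound (e t : R) : 0 <= e -> 0 < t -> 0 <= Num.max (t - e) 0 <= t.
Proof.
move=> e0 t0; rewrite le_max lexx orbT /= ge_max (ltW t0) andbT.
by rewrite lerBlDr lerDl.
Qed.

Lemma cut_bound (e t : R) : 0 <= e -> 0 < t -> 0 <= cut e t <= 1.
Proof.
move=> e0 t0; have /andP[m0 mt] := max_bound e0 t0.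
rewrite /cut mulr_ge0 ?sqr_ge0 ?invr_ge0 ?sqr_ge0//= ler_pdivrMr ?exprn_gt0// mul1r.
by rewrite ler_pXn2r ?nnegrE// ltW.
Qed.

Lemma dcut_bound (e t : R) : 0 <= e -> 0 < t -> 0 <= dcut e t * t <= 2.
Proof.
move=> e0 t0; have /andP[m0 mt] := max_bound e0 t0.
rewrite /dcut; set m := Num.max _ _ in m0 mt *.
have -> : 2 * m * (t - m) * (t ^+ 3)^-1 * t = 2 * m * (t - m) / t ^+ 2.
  by field; rewrite gt_eqF.
have tm : 0 <= t - m by rewrite subr_ge0.
rewrite mulr_ge0 ?invr_ge0 ?sqr_ge0 ?mulr_ge0//= ler_pdivrMr ?exprn_gt0// -mulrA.
by rewrite ler_pM2l// expr2; apply: ler_pM => //; rewrite lerBlDr lerDl.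
Qed.

Lemma cut_le (e t : R) : t <= e -> cut e t = 0 /\ dcut e t = 0.
Proof.
move=> te; rewrite /cut /dcut (max_idPr _) ?subr_le0//.
by rewrite expr0n !mulr0 !mul0r.
Qed.

Lemma is_derive_cut (e t : R) : 0 < t -> is_derive t 1 (cut e) (dcut e t).
Proof.
move=> t0; have tn0 : t != 0 by rewrite gt_eqF.
have d1 : is_derive t 1 (fun t : R => Num.max (t - e) 0 ^+ 2) (2 * Num.max (t - e) 0).
  have := @is_derive1_comp _ (fun t : R => Num.max t 0 ^+ 2) (fun t => t - e) _ _ _ (is_derive_pos2 (t - e))
    (is_deriveB (is_derive_id t (1 : R)) (is_derive_cst e t (1 : R))).
  by rewrite subr0 mulr1.
have t20 : t ^+ 2 != 0 by rewrite expf_neq0.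
have d2 := @is_deriveV R (fun t : R => t ^+ 2) t _ _ t20
  (is_deriveM (is_derive_id t (1 : R)) (is_derive_id t (1 : R))).
have := is_deriveM d1 d2; congr is_derive.
rewrite /dcut /GRing.scale /= !mulr1; field.
all: by rewrite ?tn0.
Qed.

Lemma cut_cvg (e : nat -> R) (t : R) : 0 < t -> e n @[n --> \oo] --> (0 : R) ->
  cut (e n) t @[n --> \oo] --> (1 : R) /\ dcut (e n) t @[n --> \oo] --> (0 : R).
Proof.
move=> t0 he.
have hm : Num.max (t - e n) 0 @[n --> \oo] --> t.
  have : t - e n @[n --> \oo] --> t - 0 by apply: cvgB => //; exact: cvg_cst.
  rewrite subr0 => h.
  have : Num.max (t - e n) 0 @[n --> \oo] --> Num.max t 0.
    have c : {for t, continuous (fun z : R => Num.max z 0)}.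
      by apply: continuous_max; [exact: cvg_id|exact: cvg_cst].
    exact: cvg_comp h c.
  by rewrite (max_idPl (ltW t0)).
split.
  have : Num.max (t - e n) 0 * Num.max (t - e n) 0 * (t ^+ 2)^-1 @[n --> \oo] --> t * t * (t ^+ 2)^-1.
    by apply: cvgM; [exact: cvgM|exact: cvg_cst].
  by rewrite -expr2 mulfV ?expf_neq0 ?gt_eqF.
have : 2 * Num.max (t - e n) 0 * (t - Num.max (t - e n) 0) * (t ^+ 3)^-1 @[n --> \oo] -->
    2 * t * (t - t) * (t ^+ 3)^-1.
  apply: cvgM; last exact: cvg_cst.
  apply: cvgM; first by apply: cvgM => //; exact: cvg_cst.
  by apply: cvgB => //; exact: cvg_cst.
by rewrite subrr mulr0 mul0r.
Qed.

Variables (Omega : set (R * R)) (a a1 a2 b b1 b2 : R * R -> R).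
Hypothesis tOmega : tame Omega a a1 a2 b b1 b2.

Definition pos : set (R * R) := Omega `&` [set x | 0 < b x].
Definition slope x := a x / b x.
Definition slope1 x := (a1 x * b x - a x * b1 x) / b x ^+ 2.
Definition slope2 x := (a2 x * b x - a x * b2 x) / b x ^+ 2.
Definition flux1 x := a x * b1 x - b x * a1 x.
Definition flux2 x := a x * b2 x - b x * a2 x.
(** Equals both [|F| |grad s|], which the coarea formula integrates along levels, and
    [- F . grad s], which testing the equation produces. *)
Definition weight x := (flux1 x ^+ 2 + flux2 x ^+ 2) / b x ^+ 2.

Lemma open_pos : open pos.
Proof.
rewrite openE => x [Ox bx]; apply: filterI.
  by apply: open_nbhs_nbhs; split => //; exact: tame_open tOmega.
have [_ _ cb _ _] := tame_C1b tOmega Ox.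
by move: (cb [set x | 0 < x]); apply; apply: open_nbhs_nbhs; split => //; exact: open_gt.
Qed.

Lemma measurable_pos : measurable (pos : set (borel_plane R)).
Proof. apply: open_borel_plane; exact: open_pos. Qed.

Let aC : C1_on pos a a1 a2.
Proof. by apply: C1_onS (tame_C1a tOmega) => x []. Qed.

Let bC : C1_on pos b b1 b2.
Proof. by apply: C1_onS (tame_C1b tOmega) => x []. Qed.

Let bn0 x : pos x -> b x != 0.
Proof. by case=> _ bx; rewrite gt_eqF. Qed.

Lemma slope_C1 : C1_on pos slope slope1 slope2.
Proof. exact: C1_on_div aC bC open_pos bn0. Qed.

Lemma flux_continuous x : Omega x -> {for x, continuous flux1} /\ {for x, continuous flux2}.
Proof.
move=> Ox; have [_ _ ca ca1 ca2] := tame_C1a tOmega Ox; have [_ _ cb cb1 cb2] := tame_C1b tOmega Ox.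
by split; apply: continuousB; exact: continuousM.
Qed.

Lemma weight_continuous x : pos x -> {for x, continuous weight}.
Proof.
move=> px; have [c1 c2] := flux_continuous px.1; have [_ _ cb _ _] := tame_C1b tOmega px.1.
apply: continuousM.
  by apply: continuousD; apply: continuousM.
apply: continuousV; first by rewrite expf_neq0// bn0.
exact: continuousM.
Qed.

Lemma flux_slope x : pos x -> flux1 x = - b x ^+ 2 * slope1 x /\ flux2 x = - b x ^+ 2 * slope2 x.
Proof.
by move=> /bn0 b0; split; rewrite /flux1 /flux2 /slope1 /slope2; field.
Qed.

Variables (H H' : R -> R) (S CH : R).
Hypotheses (dH : forall z : R, is_derive z 1 H (H' z)) (cH' : continuous H').
Hypotheses (CH0 : 0 <= CH) (bH : forall z, `|H z| <= CH /\ `|H' z| <= CH).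
Hypothesis H0 : forall z, S < `|z| -> H z = 0 /\ H' z = 0.
Hypothesis S0 : 0 <= S.

Let H_continuous : continuous H.
Proof.
move=> z; apply: differentiable_continuous; apply/derivable1_diffP.
by have [] := dH z.
Qed.

(** Where [|slope| <= S] one has [|a| <= S b], so the flux is of order [b]. This pays for the
    derivative of [cut], which is of order [1 / b]. *)
Let flux_bound x C : pos x -> `|slope x| <= S -> 0 <= C ->
  [/\ `|a x| <= C, `|a1 x| <= C & `|a2 x| <= C] /\ [/\ `|b x| <= C, `|b1 x| <= C & `|b2 x| <= C] ->
  `|flux1 x| <= b x * ((S + 1) * C) /\ `|flux2 x| <= b x * ((S + 1) * C).
Proof.
move=> px sx C0 [[_ ha1 ha2] [_ hb1 hb2]]; have b0 := px.2; rewrite /= in b0.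
have ax : `|a x| <= S * b x.
  by move: sx; rewrite /slope normrM normfV (gtr0_norm b0) ler_pdivrMr.
have key (p q : R) : `|p| <= C -> `|q| <= C -> `|a x * p - b x * q| <= b x * ((S + 1) * C).
  move=> pC qC; rewrite (le_trans (ler_normB _ _))// !normrM (gtr0_norm b0).
  have -> : b x * ((S + 1) * C) = S * b x * C + b x * C by ring.
  by apply: lerD; [exact: ler_pM|rewrite ler_pM2l].
by split; exact: key.
Qed.

(** The test function is [eta cut(b) H(slope)]; its support is compact in [Omega] by [tame_compact].
    The term with [dcut] is bounded by [flux_bound] and [dcut_bound] and tends to 0 pointwise, so
    dominated convergence removes the truncation. *)
Lemma balance_cutoff eta e1 e2 (L : R) : C1_on setT eta e1 e2 -> 0 <= L ->
  (forall x, ~ box L x -> eta x = 0) ->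
  int2 pos (fun x => eta x * (H' (slope x) * weight x)) =
  int2 pos (fun x => H (slope x) * (flux1 x * e1 x + flux2 x * e2 x)).
Proof.
move=> etaC L0 eta0.
have e0 := C1_on_supp (@compact_box R L) etaC eta0.
have [C C0 hC] := tame_bounded tOmega L.
pose A x := H (slope x) * (flux1 x * e1 x + flux2 x * e2 x).
pose B x := eta x * (H' (slope x) * weight x).
pose D n x := eta x * H (slope x) * dcut n.+1%:R^-1 (b x) * (flux1 x * b1 x + flux2 x * b2 x).
(* [G n] is the scalar product of the flux with the gradient of the test function [f n]; [D n] is
   the share of the gradient of [cut], and [B] enters with a minus sign because [weight] is
   [- F . grad s]. *)
pose G n x := cut n.+1%:R^-1 (b x) * (A x - B x) + D n x.
have n0 n : 0 < n.+1%:R^-1 :> R by rewrite invr_gt0.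
pose f n x := eta x * (cut n.+1%:R^-1 (b x) * H (slope x)).
pose f_ n (bi si ei : R * R -> R) x := eta x * (cut n.+1%:R^-1 (b x) * (H' (slope x) * si x) +
  H (slope x) * (dcut n.+1%:R^-1 (b x) * bi x)) + cut n.+1%:R^-1 (b x) * H (slope x) * ei x.
have fC n : C1_on pos (f n) (f_ n b1 slope1 e1) (f_ n b2 slope2 e2).
  apply: C1_on_mul; first by apply: C1_onS etaC.
  apply: C1_on_mul.
    apply: C1_on_comp bC _ => x [_ bx]; split; first exact: is_derive_cut.
    apply: continuousM.
      apply: continuousM.
        apply: continuousM; first exact: cvg_cst.
        by apply: continuous_max; [apply: continuousB; [exact: cvg_id|exact: cvg_cst]|exact: cvg_cst].
      apply: continuousB; first exact: cvg_id.
      by apply: continuous_max; [apply: continuousB; [exact: cvg_id|exact: cvg_cst]|exact: cvg_cst].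
    by apply: continuousV; [rewrite expf_neq0// gt_eqF|exact: exprn_continuous].
  by apply: C1_on_comp slope_C1 _ => x _; split; [exact: dH|exact: cH'].
have fK n x : pos x -> ~ (Omega `&` box L `&` [set x | n.+1%:R^-1 <= b x]) x ->
    [/\ f n x = 0, f_ n b1 slope1 e1 x = 0 & f_ n b2 slope2 e2 x = 0].
  move=> px nK; rewrite /f /f_.
  have [Lx|Lx] := pselect (box L x); last first.
    by rewrite eta0// (e0 x Lx).1 (e0 x Lx).2 !mul0r !mulr0 addr0.
  have /cut_le[-> ->] : b x <= n.+1%:R^-1.
    by rewrite leNgt; apply/negP => h; apply: nK; split; [split => //; exact: px.1|exact: ltW].
  by split; ring.
have KP n : Omega `&` box L `&` [set x | n.+1%:R^-1 <= b x] `<=` pos.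
  by move=> x [[Ox _] /= bx]; split => //=; rewrite (lt_le_trans (n0 n)).
have I0 n : int2 pos (G n) = 0%E.
  have cK := tame_compact (M := L) tOmega (n0 n).
  have := tame_div tOmega cK _ (C1_extend open_pos (fC n) cK (KP n) (fK n)).
  rewrite -/flux1 -/flux2 => E; rewrite -[RHS]E; last first.
  - move=> x nK; rewrite patchE; case: ifPn => // /set_mem px.
    by have [] := fK n x px nK.
  - by move=> x /KP[].
  have -> : int2 pos (G n) = (\int[@lebesgue2 R]_(x in Omega) (((EFin \o G n) \_ pos) x))%E.
    by rewrite -integral_mkcondr; congr integral; apply/seteqP; split => [x px|x []//]; split => //; exact: px.1.
  apply: eq_integral => x _; rewrite !patchE; case: ifPn => [|_]; last by rewrite !mulr0 addr0.
  rewrite inE => px; congr EFin.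
  have b0 := bn0 px.
  rewrite /G /D /A /B /f_ /weight -/(flux1 x) -/(flux2 x).
  have [E1 E2] := flux_slope px.
  have -> : (flux1 x ^+ 2 + flux2 x ^+ 2) / b x ^+ 2 = - (flux1 x * slope1 x + flux2 x * slope2 x).
    rewrite {2}E1 {2}E2 E1 E2; field. by [].
  by rewrite /=; ring.
pose W := (S + 1) * C.
have W0 : 0 <= W by rewrite mulr_ge0// addr_ge0.
have [Ce Ce0 hCe] : exists2 Ce, 0 <= Ce & forall x, `|eta x| <= Ce /\ (`|e1 x| <= Ce /\ `|e2 x| <= Ce).
  have cb h := @compact_bound R (box L) h (@compact_box R L).
  have cw (h : R * R -> R) : (forall x, {for x, continuous h}) -> {within box L, continuous h}.
    by move=> ch; apply: continuous_in_subspaceT => x _; exact: ch.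
  have [c c0 hc] := cb eta (cw _ (fun x => let: And5 _ _ c _ _ := etaC x I in c)).
  have [c1 c10 hc1] := cb e1 (cw _ (fun x => let: And5 _ _ _ c _ := etaC x I in c)).
  have [c2 c20 hc2] := cb e2 (cw _ (fun x => let: And5 _ _ _ _ c := etaC x I in c)).
  exists (c + c1 + c2); first by rewrite !addr_ge0// ltW.
  move=> x; have [Lx|Lx] := pselect (box L x); last first.
    by rewrite eta0// (e0 x Lx).1 (e0 x Lx).2 normr0 !addr_ge0// ltW.
  by have := hc x Lx; have := hc1 x Lx; have := hc2 x Lx; split; [|split]; lra.
pose E := CH * (2 * C * W * Ce) + Ce * CH * (2 * W ^+ 2) + 4 * Ce * CH * W * C.
have bA x : pos x -> box L x -> `|slope x| <= S -> `|A x| <= CH * (2 * C * W * Ce).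
  move=> px Lx sx; have [f1 f2] := flux_bound px sx C0 (hC x px.1 Lx).
  have [_ [he1 he2]] := hCe x; have b0 := px.2; rewrite /= in b0.
  have bxC : b x <= C.
    by apply: le_trans (ler_norm _) _; have [_ []] := hC x px.1 Lx.
  rewrite /A normrM; apply: ler_pM => //; first exact: (bH _).1.
  rewrite (le_trans (ler_normD _ _))// !normrM.
  have k (p q : R) : `|p| <= b x * W -> `|q| <= Ce -> `|p| * `|q| <= C * W * Ce.
    move=> hp hq; apply: ler_pM => //; apply: le_trans hp _; exact: ler_wpM2r.
  by have := k _ _ f1 he1; have := k _ _ f2 he2; lra.
have bB x : pos x -> box L x -> `|slope x| <= S -> `|B x| <= Ce * CH * (2 * W ^+ 2).
  move=> px Lx sx; have [f1 f2] := flux_bound px sx C0 (hC x px.1 Lx).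
  have [he _] := hCe x; have b0 := px.2; rewrite /= in b0.
  rewrite /B !normrM mulrA; apply: ler_pM => //.
    by apply: ler_pM => //; exact: (bH _).2.
  rewrite normfV ger0_norm ?addr_ge0 ?sqr_ge0// ger0_norm ?sqr_ge0//.
  rewrite ler_pdivrMr ?exprn_gt0// -(real_normK (num_real (flux1 x))) -(real_normK (num_real (flux2 x))).
  have k (p : R) : `|p| <= b x * W -> `|p| ^+ 2 <= b x ^+ 2 * W ^+ 2.
    by move=> hp; rewrite -exprMn; apply: lerXn2r; rewrite ?nnegrE// mulr_ge0// ltW.
  by have := k _ f1; have := k _ f2; lra.
have bD n x : pos x -> box L x -> `|slope x| <= S -> `|D n x| <= 4 * Ce * CH * W * C.
  move=> px Lx sx; have [f1 f2] := flux_bound px sx C0 (hC x px.1 Lx).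
  have [he _] := hCe x; have b0 := px.2; rewrite /= in b0.
  have /andP[d0 d2] := dcut_bound (ltW (n0 n)) b0.
  have dn0 : 0 <= dcut n.+1%:R^-1 (b x) by rewrite -(pmulr_lge0 _ b0).
  have [_ [_ hb1 hb2]] := hC x px.1 Lx.
  have -> : 4 * Ce * CH * W * C = (Ce * CH) * (2 * (2 * W * C)) by ring.
  rewrite /D 3!normrM -mulrA; apply: ler_pM => //.
    by apply: ler_pM => //; exact: (bH _).1.
  rewrite (ger0_norm dn0).
  apply: (@le_trans _ _ (dcut n.+1%:R^-1 (b x) * (b x * (2 * W * C)))).
    apply: ler_wpM2l => //; rewrite (le_trans (ler_normD _ _))// !normrM.
    have k (p q : R) : `|p| <= b x * W -> `|q| <= C -> `|p| * `|q| <= b x * W * C.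
      by move=> hp hq; apply: ler_pM.
    by have := k _ _ f1 hb1; have := k _ _ f2 hb2; lra.
  rewrite [leLHS]mulrA.
  have k0 : 0 <= 2 * W * C.
    by rewrite !mulr_ge0 ?addr_ge0.
  exact: ler_wpM2r.
have out n x : pos x -> ~ (box L x /\ `|slope x| <= S) -> [/\ A x = 0, B x = 0 & D n x = 0].
  move=> px nLs; rewrite /A /B /D; have [Lx|Lx] := pselect (box L x); last first.
    by rewrite eta0// (e0 x Lx).1 (e0 x Lx).2 !mul0r !mulr0 addr0 mulr0.
  have [-> ->] : H (slope x) = 0 /\ H' (slope x) = 0.
    by apply: H0; rewrite ltNge; apply/negP => h; apply: nLs.
  by rewrite !(mul0r, mulr0).
have cH x : pos x -> {for x, continuous (H \o slope)}.
  by move=> px; apply: continuous_comp; [have [] := slope_C1 px|exact: H_continuous].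
have cH'' x : pos x -> {for x, continuous (H' \o slope)}.
  by move=> px; apply: continuous_comp; [have [] := slope_C1 px|exact: cH'].
have mA : measurable_fun (pos : set (borel_plane R)) A.
  apply: continuous_on_measurable; first exact: open_pos.
  move=> x px; have [_ _ ce ce1 ce2] := etaC x I; have [c1 c2] := flux_continuous px.1.
  apply: continuousM; first exact: cH.
  by apply: continuousD; exact: continuousM.
have mB : measurable_fun (pos : set (borel_plane R)) B.
  apply: continuous_on_measurable; first exact: open_pos.
  move=> x px; have [_ _ ce ce1 ce2] := etaC x I.
  apply: continuousM => //; apply: continuousM; first exact: cH''.
  exact: weight_continuous.
have mG n : measurable_fun (pos : set (borel_plane R)) (G n).
  have mF1 : measurable_fun (pos : set (borel_plane R)) flux1.
    by apply: continuous_on_measurable; [exact: open_pos|move=> x [/flux_continuous[]]].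
  have mF2 : measurable_fun (pos : set (borel_plane R)) flux2.
    by apply: continuous_on_measurable; [exact: open_pos|move=> x [/flux_continuous[]]].
  have mb (h : R * R -> R) : (forall x, pos x -> {for x, continuous h}) ->
      measurable_fun (pos : set (borel_plane R)) h.
    by move=> ch; apply: continuous_on_measurable => //; exact: open_pos.
  have cc x : pos x -> {for x, continuous (fun x => dcut n.+1%:R^-1 (b x))}.
    move=> px; have [_ _ cb _ _] := bC px.
    have cm : {for x, continuous (fun x => Num.max (b x - n.+1%:R^-1) 0)}.
      by apply: continuous_max; [apply: continuousB => //; exact: cvg_cst|exact: cvg_cst].
    apply: continuousM.
      apply: continuousM; last exact: continuousB.
      by apply: continuousM => //; exact: cvg_cst.
    apply: continuousV; first by rewrite expf_neq0// bn0.
    by apply: (@continuous_comp _ _ _ b (fun z : R => z ^+ 3)) => //; exact: exprn_continuous.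
  have cc' x : pos x -> {for x, continuous (fun x => cut n.+1%:R^-1 (b x))}.
    move=> px; have [_ _ cb _ _] := bC px; have b0 := px.2.
    apply: (@continuous_comp _ _ _ b (cut n.+1%:R^-1)) => //.
    apply: differentiable_continuous; apply/derivable1_diffP.
    by have [] := is_derive_cut n.+1%:R^-1 b0.
  apply: measurable_funD.
    by apply: measurable_funM; [exact: mb|exact: measurable_funB].
  apply: measurable_funM.
    apply: measurable_funM; last exact: mb.
    by apply: measurable_funM; apply: mb => x px; [have [] := etaC x I|exact: cH].
  by apply: measurable_funD; apply: measurable_funM => //; apply: mb => x px; have [] := bC px.
have iA : (@lebesgue2 R).-integrable pos (EFin \o A).
  apply: (@integrable_on_box _ _ _ L (CH * (2 * C * W * Ce))) => //.
  - exact: measurable_pos.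
  - by rewrite !mulr_ge0 ?addr_ge0.
  - move=> x px; have [[h1 h2]|h] := pselect (box L x /\ `|slope x| <= S); first exact: bA.
    by have [-> _ _] := out 0%N x px h; rewrite normr0 !mulr_ge0 ?addr_ge0.
  - by move=> x px nL; have [|-> _ _] := out 0%N x px; first by case.
have iB : (@lebesgue2 R).-integrable pos (EFin \o B).
  apply: (@integrable_on_box _ _ _ L (Ce * CH * (2 * W ^+ 2))) => //.
  - exact: measurable_pos.
  - by rewrite !mulr_ge0 ?addr_ge0 ?sqr_ge0.
  - move=> x px; have [[h1 h2]|h] := pselect (box L x /\ `|slope x| <= S); first exact: bB.
    by have [_ -> _] := out 0%N x px h; rewrite normr0 !mulr_ge0 ?addr_ge0 ?sqr_ge0.
  - by move=> x px nL; have [|_ -> _] := out 0%N x px; first by case.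
have E0 : 0 <= E.
  by rewrite !addr_ge0 ?mulr_ge0 ?addr_ge0 ?sqr_ge0.
have cv : int2 pos (G n) @[n --> \oo] --> int2 pos (fun x => A x - B x).
  apply: (@dominated_cvgR _ _ _ (@lebesgue2 R) pos G _ (fun x => E * \1_(box L) x)) => //.
  - exact: measurable_pos.
  - move=> x px; have [c1 c2] := @cut_cvg (fun n => n.+1%:R^-1) (b x) px.2 (@cvg_harmonic R).
    rewrite -[A x - B x]mul1r -[1 * _]addr0; apply: cvgD.
      by apply: cvgM => //; exact: cvg_cst.
    have : D n x @[n --> \oo] --> eta x * H (slope x) * 0 * (flux1 x * b1 x + flux2 x * b2 x).
      apply: cvgM; last exact: cvg_cst.
      by apply: cvgM => //; exact: cvg_cst.
    by rewrite mulr0 mul0r.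
  - apply: (@integrable_on_box _ _ _ L E) => //.
    + exact: measurable_pos.
    + apply: measurable_funM => //; apply: (@measurable_funTS _ _ (borel_plane R)).
      by apply: measurable_indic; exact: measurable_box.
    + move=> x _; rewrite normrM ger0_norm// indicE; case: (_ \in _) => /=.
        by rewrite normr1 mulr1.
      by rewrite normr0 mulr0.
    + by move=> x _ bx; rewrite indicE memNset// mulr0.
  move=> n x px; have [[h1 h2]|h] := pselect (box L x /\ `|slope x| <= S); last first.
    have [hA hB hD] := out n x px h.
    by rewrite /G hA hB hD subrr mulr0 addr0 normr0 mulr_ge0// indicE ler0n.
  rewrite indicE mem_set// mulr1 /G (le_trans (ler_normD _ _))//.
  apply: lerD; last exact: bD.
  have /andP[k0 k1] := cut_bound (ltW (n0 n)) px.2.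
  rewrite normrM (ger0_norm k0); apply: (@le_trans _ _ (1 * `|A x - B x|)).
    exact: ler_wpM2r.
  by rewrite mul1r (le_trans (ler_normB _ _))// lerD// ?bA ?bB.
have cv0 : int2 pos (G n) @[n --> \oo] --> 0%E.
  by apply: cvg_near_cst; apply: nearW => n; exact: I0.
have AB0 : int2 pos (fun x => A x - B x) = 0%E by exact: (cvg_unique _ cv cv0).
have := integralB_EFin measurable_pos iA iB.
under eq_integral do rewrite -EFinB.
rewrite AB0 -/(int2 pos B) -/(int2 pos A).
have fA := integrable_fin_num measurable_pos iA; have fB := integrable_fin_num measurable_pos iB.
by move=> /esym/eqP; rewrite sube_eq ?add0e ?fin_num_adde_defl// => /eqP.
Qed.

Definition edens x := (flux1 x ^+ 2 + flux2 x ^+ 2) / (a x ^+ 2 + b x ^+ 2).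

Lemma edens_ge0 x : 0 <= edens x.
Proof. by rewrite divr_ge0// addr_ge0 ?sqr_ge0. Qed.

Lemma edens_weight x : pos x -> weight x = edens x * (1 + slope x ^+ 2).
Proof.
move=> px; have b0 := px.2; rewrite /= in b0.
rewrite /weight /edens /slope; field.
by rewrite bn0//= gt_eqF// ltr_wpDl ?sqr_ge0// exprn_gt0.
Qed.

Lemma integrable_edens : (@lebesgue2 R).-integrable pos (EFin \o edens).
Proof.
have oO := tame_open tOmega.
have ca x : Omega x -> {for x, continuous (fun x => a x ^+ 2 + b x ^+ 2)}.
  move=> Ox; have [_ _ ca _ _] := tame_C1a tOmega Ox; have [_ _ cb _ _] := tame_C1b tOmega Ox.
  by apply: continuousD; exact: continuousM.
pose O' := Omega `&` [set x | 0 < a x ^+ 2 + b x ^+ 2].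
have oO' : open O'.
  rewrite openE => x [Ox bx]; apply: filterI; first exact: open_nbhs_nbhs.
  by move: (ca x Ox [set x | 0 < x]); apply; apply: open_nbhs_nbhs; split => //; exact: open_gt.
have mO' : measurable_fun (O' : set (borel_plane R)) edens.
  apply: continuous_on_measurable => // x [Ox abx]; have [c1 c2] := flux_continuous Ox.
  apply: continuousM; first by apply: continuousD; exact: continuousM.
  by apply: continuousV; [rewrite gt_eqF|exact: ca].
have pO' : pos `<=` O'.
  by move=> x [Ox bx]; split => //=; rewrite ltr_wpDl ?sqr_ge0// exprn_gt0.
have mp := measurable_pos.
have mO : measurable (O' : set (borel_plane R)) by exact: open_borel_plane.
apply/integrableP; split.
  by apply/measurable_EFinP; apply: measurable_funS mO'.
apply: le_lt_trans (tame_energy tOmega).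
(* Where [a] and [b] both vanish the quotient is 0 since the inverse of 0 is 0; elsewhere the
   integrand is continuous, hence measurable. *)
have -> : int2 Omega edens = int2 O' edens.
  have -> : O' = Omega `&` O' by apply/seteqP; split => [x []|x [? []]].
  rewrite [RHS]integral_mkcondr; apply: eq_integral => x; rewrite inE => Ox.
  rewrite patchE; case: ifPn => // /negP; rewrite inE => nx.
  congr EFin; rewrite /edens (_ : a x ^+ 2 + b x ^+ 2 = 0) ?invr0 ?mulr0//.
  apply/eqP; rewrite eq_le addr_ge0 ?sqr_ge0// andbT leNgt; apply/negP => h.
  by apply: nx; split.
have -> : (\int[@lebesgue2 R]_(x in pos) `|(EFin \o edens) x| = int2 pos edens)%E.
  by apply: eq_integral => x _ /=; rewrite ger0_norm// edens_ge0.
apply: ge0_subset_integral => //; first exact/measurable_EFinP.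
by move=> x _; rewrite lee_fin edens_ge0.
Qed.

(** In [balance_cutoff] the right-hand side is at most [CH] times the integral made small by
    [tame_cutoff]. On the left the cutoffs can be removed, since on the support of [H' o slope] the
    weight is at most [1 + S ^+ 2] times the integrable energy density. *)
Theorem slope_balance : int2 pos (fun x => H' (slope x) * weight x) = 0%E.
Proof.
have mp := measurable_pos.
have oO := tame_open tOmega.
have mO : measurable (Omega : set (borel_plane R)) by exact: open_borel_plane.
have cH'' x : pos x -> {for x, continuous (H' \o slope)}.
  by move=> px; apply: continuous_comp; [have [] := slope_C1 px|exact: cH'].
have [C0 C00 hcut] := tame_cutoff tOmega.
have /choice[eta heta] : forall n : nat, exists eta : R * R -> R,
    [/\ forall x, box n%:R x -> eta x = 1, forall x, `|eta x| <= C0, continuous eta &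
      (`|int2 pos (fun x => eta x * (H' (slope x) * weight x))| <= (CH * n.+1%:R^-1)%:E)%E].
  move=> n; have [|eta [e1 [e2 [L [etaC eta1 etab [L0 etaL] I0]]]]] := hcut n%:R n.+1%:R^-1.
    by rewrite invr_gt0.
  exists eta; split => //; first by move=> x; have [] := etaC x I.
  rewrite (balance_cutoff etaC L0 etaL).
  pose Fe x := Num.sqrt (flux1 x ^+ 2 + flux2 x ^+ 2) * (`|e1 x| + `|e2 x|).
  have Fe0 x : 0 <= Fe x by rewrite mulr_ge0 ?sqrtr_ge0 ?addr_ge0.
  have mFe : measurable_fun (Omega : set (borel_plane R)) Fe.
    apply: continuous_on_measurable => // x Ox; have [c1 c2] := flux_continuous Ox.
    have [_ _ _ ce1 ce2] := etaC x I.
    apply: continuousM.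
      apply: (@continuous_comp _ _ _ (fun x => flux1 x ^+ 2 + flux2 x ^+ 2) Num.sqrt).
        by apply: continuousD; exact: continuousM.
      exact: sqrt_continuous.
    by apply: continuousD; (apply: continuous_comp; [|exact: norm_continuous]).
  have mA : measurable_fun (pos : set (borel_plane R)) (fun x => H (slope x) * (flux1 x * e1 x + flux2 x * e2 x)).
    apply: continuous_on_measurable; first exact: open_pos.
    move=> x px; have [_ _ _ ce1 ce2] := etaC x I; have [c1 c2] := flux_continuous px.1.
    apply: continuousM.
      by apply: continuous_comp; [have [] := slope_C1 px|exact: H_continuous].
    by apply: continuousD; exact: continuousM.
  apply: le_trans (le_abse_integral _ mp _) _; first exact/measurable_EFinP.
  have mFe' : measurable_fun (pos : set (borel_plane R)) Fe by apply: measurable_funS mFe => // x [].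
  apply: (@le_trans _ _ (\int[@lebesgue2 R]_(x in pos) (CH%:E * (Fe x)%:E))%E).
    apply: ge0_le_integral => //.
    - by apply: measurableT_comp => //; exact/measurable_EFinP.
    - by apply/measurable_EFinP; exact: measurable_funM.
    move=> x px; rewrite -EFinM lee_fin normrM; apply: ler_pM => //; first exact: (bH _).1.
    rewrite (le_trans (ler_normD _ _))// !normrM /Fe mulrDr.
    have k (p q : R) : `|p| <= Num.sqrt (p ^+ 2 + q ^+ 2).
      by rewrite -sqrtr_sqr ler_sqrt ?addr_ge0 ?sqr_ge0// lerDl sqr_ge0.
    by apply: lerD; apply: ler_wpM2r => //; rewrite 1?addrC; exact: k.
  rewrite ge0_integralZl//; last 2 first.
  - exact/measurable_EFinP.
  - by move=> x _; rewrite lee_fin.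
  rewrite EFinM; apply: lee_wpmul2l; first by rewrite lee_fin.
  apply: le_trans I0; apply: ge0_subset_integral => //; last by move=> x [].
  - exact/measurable_EFinP.
  - by move=> x _; rewrite lee_fin.
have cv : int2 pos (fun x => eta n x * (H' (slope x) * weight x)) @[n --> \oo] -->
    int2 pos (fun x => H' (slope x) * weight x).
  apply: (@dominated_cvgR _ _ _ (@lebesgue2 R) pos _ _ (fun x => C0 * CH * (1 + S ^+ 2) * edens x)) => //.
  - move=> n; apply: continuous_on_measurable; first exact: open_pos.
    move=> x px; apply: continuousM; first by have [_ _ c _] := heta n; exact: c.
    by apply: continuousM; [exact: cH''|exact: weight_continuous].
  - move=> x px; apply: cvg_near_cst.
    have [k hk] := exists_nat_gt (`|x.1| + `|x.2|).
    exists k => // n /= kn; have [h _ _ _] := heta n.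
    have kn' : k%:R <= n%:R :> R by rewrite ler_nat.
    rewrite h ?mul1r//; split; apply: le_trans kn'; apply: le_trans (ltW hk).
      by rewrite lerDl.
    by rewrite lerDr.
  - have -> : EFin \o (fun x => C0 * CH * (1 + S ^+ 2) * edens x) =
       (fun x => ((C0 * CH * (1 + S ^+ 2))%:E * (EFin \o edens) x)%E) by [].
    by apply: integrableZl => //; exact: integrable_edens.
  move=> n x px; have [_ hb _ _] := heta n.
  have [hs|hs] := leP `|slope x| S; last first.
    have [_ ->] := H0 hs; rewrite mul0r mulr0 normr0.
    by apply: mulr_ge0; [rewrite !mulr_ge0 ?addr_ge0 ?sqr_ge0|exact: edens_ge0].
  rewrite normrM [X in _ * X]normrM -[leRHS]mulrA -[leRHS]mulrA.
  apply: ler_pM => //; apply: ler_pM => //; first exact: (bH _).2.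
  rewrite edens_weight// normrM (ger0_norm (edens_ge0 x)) mulrC; apply: ler_wpM2r; first exact: edens_ge0.
  rewrite ger0_norm ?addr_ge0 ?sqr_ge0// lerD2l -(real_normK (num_real (slope x))).
  by apply: lerXn2r; rewrite ?nnegrE.
have cvN := cvg_abse cv.
have cv0 : `|int2 pos (fun x => eta n x * (H' (slope x) * weight x))|%E @[n --> \oo] --> 0%E.
  apply: (@squeeze_cvge _ _ _ _ (cst 0%E) _ (fun n => (CH * n.+1%:R^-1)%:E)).
  - by apply: nearW => n /=; have [_ _ _ ->] := heta n; rewrite abse_ge0.
  - exact: cvg_cst.
  - apply: cvg_EFin; first exact: nearW.
    rewrite -[0](mulr0 CH); apply: cvgM; first exact: cvg_cst.
    exact: cvg_harmonic.
have /eqP : `|int2 pos (fun x => H' (slope x) * weight x)|%E = 0%E.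
  by apply: (cvg_unique _ _ cv0); [exact: ereal_hausdorff|exact: cvN].
by rewrite abse_eq0 => /eqP.
Qed.

End balance.

(** * Level sets of the slope *)

Section level.
Context {R : realType}.
Variables (Omega : set (R * R)) (a a1 a2 b b1 b2 : R * R -> R).
Hypothesis tOmega : tame Omega a a1 a2 b b1 b2.
Local Notation leb := (@lebesgue_measure R).
Local Notation P := (pos Omega b).
Local Notation s := (slope a b).
Local Notation s1 := (slope1 a a1 b b1).
Local Notation s2 := (slope2 a a2 b b2).
Local Notation F1 := (flux1 a a1 b b1).
Local Notation F2 := (flux2 a a2 b b2).
Local Notation w := (weight a a1 a2 b b1 b2).
Local Notation edens := (edens a a1 a2 b b1 b2).
Local Notation int2 D f := (\int[@lebesgue2 R]_(x in D) (f x)%:E)%E.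
Local Notation H := (@hausdorff1 R).

Definition fluxn x := Num.sqrt (F1 x ^+ 2 + F2 x ^+ 2).
Definition level (y : measurableTypeR R) : \bar R :=
  (\int[H]_(x in P `&` s @^-1` [set y]) (fluxn x)%:E)%E.

Lemma fluxn_ge0 x : 0 <= fluxn x. Proof. exact: sqrtr_ge0. Qed.

Lemma level_ge0 y : (0 <= level y)%E.
Proof. by apply: integral_ge0 => x _; rewrite lee_fin fluxn_ge0. Qed.

Let mP : measurable (P : set (borel_plane R)).
Proof. exact: measurable_pos tOmega. Qed.

Lemma measurable_slope : measurable_fun (P : set (borel_plane R)) s.
Proof.
apply: continuous_on_measurable; first exact: open_pos tOmega.
by move=> x /(slope_C1 tOmega)[].
Qed.

Lemma measurable_fluxn : measurable_fun (P : set (borel_plane R)) fluxn.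
Proof.
apply: continuous_on_measurable; first exact: open_pos tOmega.
move=> x [Ox _]; have [c1 c2] := flux_continuous tOmega Ox.
apply: (@continuous_comp _ _ _ (fun x => F1 x ^+ 2 + F2 x ^+ 2) Num.sqrt).
  by apply: continuousD; exact: continuousM.
exact: sqrt_continuous.
Qed.

Let sqr_fluxn x : fluxn x ^+ 2 = F1 x ^+ 2 + F2 x ^+ 2.
Proof. by rewrite sqr_sqrtr// addr_ge0 ?sqr_ge0. Qed.

Let fluxn_slope x : P x -> fluxn x = b x ^+ 2 * enorm (s1 x, s2 x).
Proof.
move=> px; have [E1 E2] := flux_slope a a1 a2 b1 b2 px.
have bx2 : 0 <= b x ^+ 2 by exact: sqr_ge0.
apply/eqP; rewrite -(@eqrXn2 _ 2) ?fluxn_ge0 ?(mulr_ge0 bx2 (enorm_ge0 _))//; apply/eqP.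
by rewrite sqr_fluxn exprMn sqr_enorm /= E1 E2; ring.
Qed.

Let weight_slope x : P x -> w x = enorm (s1 x, s2 x) * fluxn x.
Proof.
move=> px; rewrite /weight -sqr_fluxn {1}(fluxn_slope px) fluxn_slope//.
by field; rewrite gt_eqF// px.2.
Qed.

(** The coarea formula is applied where [grad s] does not vanish, with integrand [|F| g(s)]. At the
    remaining points the flux vanishes together with [grad s], so they contribute to neither
    side. *)
Lemma coarea_slope (g : R -> R) : measurable_fun (setT : set (measurableTypeR R)) g ->
  (forall y, 0 <= g y) ->
  measurable_fun setT level /\
  int2 P (fun x => w x * g (s x)) = (\int[leb]_y ((g y)%:E * level y))%E.
Proof.
move=> mg g0.
pose O := P `&` [set x | 0 < s1 x ^+ 2 + s2 x ^+ 2].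
have OP : O `<=` P by move=> x [].
have oO : open O.
  rewrite openE => x [px bx]; have [_ _ _ c1 c2] := slope_C1 tOmega px; apply: filterI.
    by apply: open_nbhs_nbhs; split => //; exact: open_pos tOmega.
  have cs : {for x, continuous (fun x => s1 x ^+ 2 + s2 x ^+ 2)}.
    by apply: continuousD; exact: continuousM.
  by move: (cs [set x | 0 < x]); apply; apply: open_nbhs_nbhs; split => //; exact: open_gt.
have mO : measurable (O : set (borel_plane R)) by exact: open_borel_plane.
have sC : C1_on O s s1 s2 by exact: C1_onS (slope_C1 tOmega).
have sn0 x : O x -> (s1 x, s2 x) != 0.
  move=> [_ /= h]; apply/negP => /eqP[E1 E2].
  by rewrite E1 E2 expr0n addr0 ltxx in h.
have fO x : P x -> ~ O x -> fluxn x = 0.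
  move=> px nO; rewrite fluxn_slope//; apply/eqP; rewrite mulf_eq0 orbC -sqrf_eq0 sqr_enorm /=.
  apply/orP; left; rewrite eq_le addr_ge0 ?sqr_ge0// andbT leNgt.
  by apply/negP => h; apply: nO.
have mgs : measurable_fun (P : set (borel_plane R)) (g \o s).
  by apply: (measurable_comp (F := setT)) => //; exact: measurable_slope.
have main (h : R -> R) : measurable_fun (setT : set (measurableTypeR R)) h -> (forall y, 0 <= h y) ->
    measurable_fun setT (fun y : measurableTypeR R => ((h y)%:E * level y)%E) /\
    int2 P (fun x => w x * h (s x)) = (\int[leb]_y ((h y)%:E * level y))%E.
  move=> mh h0.
  have mhs : measurable_fun (P : set (borel_plane R)) (h \o s).
    by apply: (measurable_comp (F := setT)) => //; exact: measurable_slope.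
  pose f : borel_plane R -> \bar R := (fun x => (fluxn x * h (s x))%:E) \_ O.
  have mf0 : measurable_fun (O : set (borel_plane R)) (fun x => (fluxn x * h (s x))%:E).
    apply/measurable_EFinP; apply: measurable_funM.
      exact: measurable_funS measurable_fluxn.
    exact: measurable_funS mhs.
  have mf : measurable_fun setT f by apply/(measurable_restrictT _ mO).
  have f0 x : (0 <= f x)%E.
    by rewrite /f patchE; case: ifPn => // _; rewrite lee_fin mulr_ge0 ?fluxn_ge0.
  have [mI EI] := coarea oO sC sn0 mf f0.
  have mlev y : measurable (O `&` s @^-1` [set y] : set (borel_plane R)).
    have := measurable_slope mP (measurable_set1 (y : measurableTypeR R)).
    move=> /(measurableI _ _ mO); rewrite setIA (_ : O `&` P = O)//.
    exact/setIidPl.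
  have inner y : (\int[H]_(x in O `&` s @^-1` [set y]) f x = (h y)%:E * level y)%E.
    transitivity (\int[H]_(x in O `&` s @^-1` [set y]) ((h y)%:E * (fluxn x)%:E))%E.
      apply: eq_integral => x; rewrite inE => -[Ox <-].
      by rewrite /f patchE mem_set// -EFinM mulrC.
    rewrite ge0_integralZl//; first last.
    - by rewrite lee_fin.
    - by move=> x _; rewrite lee_fin fluxn_ge0.
    - apply/measurable_EFinP; apply: measurable_funS measurable_fluxn => //.
      by move=> x [/OP].
    congr (_ * _)%E; rewrite /level [LHS]integral_mkcond [RHS]integral_mkcond.
    apply: eq_integral => x _; rewrite !patchE.
    case: ifPn => [/set_mem[Ox sx]|nx].
      by rewrite mem_set//; split => //; exact: OP.
    case: ifPn => // /set_mem[px sx]; rewrite fO// => Ox.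
    by move/negP: nx; apply; apply: mem_set.
  split.
    by move: mI; under eq_fun do rewrite inner.
  transitivity (\int[@lebesgue2 R]_(x in O) ((enorm (s1 x, s2 x))%:E * f x))%E.
    rewrite [LHS]integral_mkcond [RHS]integral_mkcond.
    apply: eq_integral => x _; rewrite !patchE.
    case: ifPn => [/set_mem px|nx]; last first.
      by rewrite ifN//; apply: contra nx => /set_mem Ox; apply: mem_set; exact: OP.
    case: ifPn => [/set_mem Ox|nx].
      by rewrite /f patchE mem_set// -EFinM weight_slope// mulrA.
    rewrite weight_slope// fO// ?mulr0 ?mul0r// => Ox.
    by move/negP: nx; apply; apply: mem_set.
  by rewrite EI; apply: eq_integral => y _; exact: inner.
have [m1 _] := main (cst 1) (@measurable_cst _ _ _ _ _ _) (fun=> ler01).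
split; last by have [] := main g mg g0.
by move: m1; under eq_fun do rewrite mul1e.
Qed.

(** A C^1 approximation of the positive part: its derivative [drmp N] grows linearly from 0 to 1 on
    [[0, 1 / N]] and tends to the indicator of the positive half line. *)
Let rmp (N z : R) := N / 2 * (Num.max z 0 ^+ 2 - Num.max (z - N^-1) 0 ^+ 2).
Let drmp (N z : R) := N * (Num.max z 0 - Num.max (z - N^-1) 0).

Let is_derive_rmp (N z : R) : is_derive z 1 (rmp N) (drmp N z).
Proof.
have h := @is_derive1_comp _ (fun t : R => Num.max t 0 ^+ 2) (fun t => t - N^-1) _ _ _
  (is_derive_pos2 (z - N^-1)) (is_deriveB (is_derive_id z (1 : R)) (is_derive_cst N^-1 z (1 : R))).
have := is_deriveZ (N / 2) (is_deriveB (is_derive_pos2 z) h).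
by congr is_derive; rewrite /drmp /GRing.scale /= subr0 mulr1; field.
Qed.

Let drmp_continuous (N : R) : continuous (drmp N).
Proof.
move=> z.
have c1 : {for z, continuous (fun z : R => Num.max z 0)}.
  by apply: continuous_max; [exact: cvg_id|exact: cvg_cst].
have c2 : {for z, continuous (fun z : R => Num.max (z - N^-1) 0)}.
  by apply: continuous_max; [apply: continuousB; [exact: cvg_id|exact: cvg_cst]|exact: cvg_cst].
by apply: cvgM; [exact: cvg_cst|exact: cvgB].
Qed.

Let drmp_bound (N z : R) : 0 < N -> 0 <= drmp N z <= 1.
Proof.
move=> N0; have Nv : 0 < N^-1 by rewrite invr_gt0.
rewrite /drmp mulrC -ler_pdivlMr// div1r pmulr_lge0//.
by rewrite /Num.max; do 2 case: ifPn; rewrite -?leNgt; lra.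
Qed.

Let rmp_le0 (N z : R) : 0 < N -> z <= 0 -> rmp N z = 0 /\ drmp N z = 0.
Proof.
move=> N0 z0; have Nv : 0 < N^-1 by rewrite invr_gt0.
rewrite /rmp /drmp (max_idPr z0) (max_idPr _) ?subrr ?mulr0//.
by lra.
Qed.

(** The offset [(2 * N)^-1] does not depend on [z], hence cancels in the differences of [rmp] from
    which [H] is built. *)
Let rmp_ge (N z : R) : 0 < N -> N^-1 <= z -> rmp N z = z - (2 * N)^-1 /\ drmp N z = 1.
Proof.
move=> N0 Nz; have Nv : 0 < N^-1 by rewrite invr_gt0.
rewrite /rmp /drmp (max_idPl _) ?(max_idPl _); try lra.
by split; field; rewrite gt_eqF.
Qed.

Let drmp_cvg (z : R) : drmp n.+1%:R z @[n --> \oo] --> ((0 < z)%R%:R : R).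
Proof.
apply: cvg_near_cst; have [z0|z0] := ltP 0 z; last first.
  by apply: nearW => n; have [] := @rmp_le0 n.+1%:R z (ltr0Sn _ n) z0.
have [k hk] := exists_nat_gt z^-1.
exists k => // n /= kn; have [] // := @rmp_ge n.+1%:R z (ltr0Sn _ n) _.
rewrite -[leRHS]invrK lef_pV2 ?posrE ?invr_gt0//.
by apply: (le_trans (ltW hk)); rewrite ler_nat leqW.
Qed.

Let integrable_slope (f : R * R -> R) (K S : R) : measurable_fun (P : set (borel_plane R)) f ->
  0 <= K -> 0 <= S -> (forall x, P x -> `|f x| <= K) -> (forall x, P x -> S < `|s x| -> f x = 0) ->
  (@lebesgue2 R).-integrable P (EFin \o (fun x => w x * f x)) /\
  forall x, P x -> `|w x * f x| <= K * (1 + S ^+ 2) * edens x.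
Proof.
move=> mf K0 S0 fK f0.
have bd x : P x -> `|w x * f x| <= K * (1 + S ^+ 2) * edens x.
  move=> px; have e0 := edens_ge0 a a1 a2 b b1 b2 x.
  have [hs|hs] := leP `|s x| S; last first.
    by rewrite f0// mulr0 normr0 mulr_ge0// mulr_ge0// addr_ge0// sqr_ge0.
  rewrite mulrC normrM -[leRHS]mulrA; apply: ler_pM => //; first exact: fK.
  rewrite (edens_weight a a1 a2 b1 b2 px) normrM (ger0_norm e0) mulrC; apply: ler_wpM2r => //.
  rewrite ger0_norm ?addr_ge0 ?sqr_ge0// lerD2l -(real_normK (num_real (s x))).
  by apply: lerXn2r; rewrite ?nnegrE.
split => //.
apply: (le_integrable mP _ _ (integrableZl mP (K * (1 + S ^+ 2)) (integrable_edens tOmega))).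
  apply/measurable_EFinP; apply: measurable_funM => //.
  apply: continuous_on_measurable; first exact: open_pos tOmega.
  by move=> x /(weight_continuous tOmega).
move=> x px /=; rewrite lee_fin; apply: le_trans (bd x px) _; exact: ler_norm.
Qed.

(** By the coarea formula, the integral of [level] over []p, q]]. It is kept as an integral over the
    plane because [slope_balance] speaks of those. *)
Definition mass (p q : R) := int2 P (fun x => w x * ((p < s x)%R%:R - (q < s x)%R%:R)).

Let measurable_indicator (p q : R) :
  measurable_fun (setT : set (measurableTypeR R)) (fun z : R => (p < z)%R%:R - (q < z)%R%:R : R).
Proof.
have m r : measurable_fun (setT : set (measurableTypeR R)) (fun z : R => (r < z)%R%:R : R).
  have -> : (fun z : R => (r < z)%R%:R : R) = \1_(`]r, +oo[%classic).
    by apply/funext => z; rewrite indicE mem_setE in_itv /= andbT.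
  exact: measurable_indic.
exact: measurable_funB.
Qed.

Let integrable_mass (p q : R) : p <= q ->
  (@lebesgue2 R).-integrable P (EFin \o (fun x => w x * ((p < s x)%R%:R - (q < s x)%R%:R))).
Proof.
move=> pq; have h := @integrable_slope (fun x => (p < s x)%R%:R - (q < s x)%R%:R) 1 (`|p| + `|q|).
apply: (h _ _ _ _ _).1 => //; clear h.
- by apply: (measurable_comp (F := setT)) (measurable_indicator p q) measurable_slope.
- by move=> x _; case: (p < s x); case: (q < s x); rewrite ?subrr ?subr0 ?sub0r ?normrN ?normr0 ?normr1.
move=> x _ h; have := ler_norm p; have := ler_norm (- p); have := ler_norm q; have := ler_norm (- q).
rewrite !normrN => h1 h2 h3 h4.
have [sx|sx] := leP 0 (s x).
  rewrite (ger0_norm sx) in h.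
  have -> : p < s x by lra.
  have -> : q < s x by lra.
  by rewrite subrr.
rewrite (ltr0_norm sx) in h.
have -> : (p < s x) = false by apply/negbTE; rewrite -leNgt; lra.
have -> : (q < s x) = false by apply/negbTE; rewrite -leNgt; lra.
by rewrite subrr.
Qed.

Lemma mass_proportional (p q c d : R) : p <= q -> c <= d ->
  ((d - c)%:E * mass p q = (q - p)%:E * mass c d)%E.
Proof.
move=> pq cd.
(* [H' n] tends to [(d - c) 1_]p, q] - (q - p) 1_]c, d]], whose integral is zero: this makes
   the support of [H n] compact. *)
pose H n z := (d - c) * (rmp n.+1%:R (z - p) - rmp n.+1%:R (z - q)) -
  (q - p) * (rmp n.+1%:R (z - c) - rmp n.+1%:R (z - d)).
pose H' n z := (d - c) * (drmp n.+1%:R (z - p) - drmp n.+1%:R (z - q)) -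
  (q - p) * (drmp n.+1%:R (z - c) - drmp n.+1%:R (z - d)).
(* Beyond [S] each of the four shifted functions [drmp] is constantly 0 or 1; the summand 1 accounts
   for the width [1 / n.+1] of the transition. *)
pose S := `|p| + `|q| + `|c| + `|d| + 1.
pose K := (d - c) + (q - p).
have K0 : 0 <= K by rewrite /K; lra.
have S0 : 0 <= S by rewrite !addr_ge0.
have n0 n : 0 < n.+1%:R :> R by rewrite ltr0Sn.
have dsh n (e z : R) : is_derive z 1 (fun z => rmp n.+1%:R (z - e)) (drmp n.+1%:R (z - e)).
  have := @is_derive1_comp _ (rmp n.+1%:R) (fun t => t - e) _ _ _ (is_derive_rmp n.+1%:R (z - e))
    (is_deriveB (is_derive_id z (1 : R)) (is_derive_cst e z (1 : R))).
  by rewrite subr0 mulr1.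
have dH n (z : R) : is_derive z 1 (H n) (H' n z).
  exact: (is_deriveB (is_deriveZ (d - c) (is_deriveB (dsh n p z) (dsh n q z)))
    (is_deriveZ (q - p) (is_deriveB (dsh n c z) (dsh n d z)))).
have cH' n : continuous (H' n).
  have csh e : continuous (fun z => drmp n.+1%:R (z - e)).
    move=> z; apply: (@continuous_comp _ _ _ (fun z => z - e) (drmp n.+1%:R)); last exact: drmp_continuous.
    by apply: continuousB; [exact: cvg_id|exact: cvg_cst].
  move=> z; apply: cvgB; apply: cvgM; try exact: cvg_cst.
    by apply: cvgB; exact: csh.
  by apply: cvgB; exact: csh.
have H'K n z : `|H' n z| <= K.
  have k e : 0 <= drmp n.+1%:R (z - e) <= 1 by exact: drmp_bound.
  have k2 e e' : `|drmp n.+1%:R (z - e) - drmp n.+1%:R (z - e')| <= 1.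
    have := k e; have := k e'; rewrite ler_norml => /andP[? ?] /andP[? ?].
    by apply/andP; split; lra.
  rewrite /H' (le_trans (ler_normB _ _))// !normrM; apply: lerD.
    by rewrite ger0_norm ?subr_ge0// ler_piMr ?subr_ge0.
  by rewrite ger0_norm ?subr_ge0// ler_piMr ?subr_ge0.
have H0 n z : S < `|z| -> H n z = 0 /\ H' n z = 0.
  have := ler_norm p; have := ler_norm (- p); have := ler_norm q; have := ler_norm (- q).
  have := ler_norm c; have := ler_norm (- c); have := ler_norm d; have := ler_norm (- d).
  rewrite !normrN => h1 h2 h3 h4 h5 h6 h7 h8.
  have Nv : n.+1%:R^-1 <= 1 :> R by rewrite invf_le1// ler1n.
  have p0 := normr_ge0 p; have q0 := normr_ge0 q; have c0 := normr_ge0 c; have d0 := normr_ge0 d.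
  have [z0|z0] := leP 0 z.
    rewrite ger0_norm// /S => hS; rewrite /H /H'.
    have k e : e <= z - 1 -> rmp n.+1%:R (z - e) = z - e - (2 * n.+1%:R)^-1 /\ drmp n.+1%:R (z - e) = 1.
      by move=> ez; apply: rmp_ge => //; apply: le_trans Nv _; lra.
    have [|-> ->] := k p; first by lra.
    have [|-> ->] := k q; first by lra.
    have [|-> ->] := k c; first by lra.
    have [|-> ->] := k d; first by lra.
    by split; ring.
  rewrite ltr0_norm// /S => hS; rewrite /H /H'.
  have k e : z <= e -> rmp n.+1%:R (z - e) = 0 /\ drmp n.+1%:R (z - e) = 0.
    by move=> ez; apply: rmp_le0 => //; lra.
  have [|-> ->] := k p; first by lra.
  have [|-> ->] := k q; first by lra.
  have [|-> ->] := k c; first by lra.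
  have [|-> ->] := k d; first by lra.
  by split; ring.
have I0 n : int2 P (fun x => w x * H' n (s x)) = 0%E.
  have [||B B0 hB] := @smooth1_bounded R (H n) (- S) S 0.
  - by split => // z; have [] := dH n z.
  - by move=> z hz; apply: (H0 n z _).1; rewrite ltNge ler_norml; apply/negP.
  under eq_integral do rewrite mulrC.
  apply: (@slope_balance R Omega a a1 a2 b b1 b2 tOmega (H n) (H' n) S (B + K)) => //.
  - by rewrite addr_ge0.
  - by move=> z; have := hB z; have := H'K n z; split; lra.
  - exact: H0.
have cv : int2 P (fun x => w x * H' n (s x)) @[n --> \oo] -->
   int2 P (fun x => w x * ((d - c) * ((p < s x)%R%:R - (q < s x)%R%:R)
      - (q - p) * ((c < s x)%R%:R - (d < s x)%R%:R))).
  have is_ n : measurable_fun (P : set (borel_plane R)) (H' n \o s).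
    apply: (measurable_comp (F := setT)) => //; last exact: measurable_slope.
    exact: continuous_measurable_fun.
  have ib n := integrable_slope (is_ n) K0 S0 (fun x _ => H'K n (s x)) (fun x _ h => (H0 n _ h).2).
  apply: (@dominated_cvgR _ _ _ (@lebesgue2 R) P _ _ (fun x => K * (1 + S ^+ 2) * edens x)) => //.
  - move=> n; have [/integrableP[h _] _] := ib n.
    exact/measurable_EFinP.
  - move=> x px; apply: cvgM; first exact: cvg_cst.
    have cz e : drmp n.+1%:R (s x - e) @[n --> \oo] --> ((e < s x)%R%:R : R).
      by rewrite -(subr_gt0 e); exact: drmp_cvg.
    by apply: cvgB; apply: cvgM; try exact: cvg_cst; apply: cvgB; exact: cz.
  - exact: (integrableZl mP (K * (1 + S ^+ 2)) (integrable_edens tOmega)).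
  by move=> n x px; apply: (ib n).2.
have cv0 : int2 P (fun x => w x * H' n (s x)) @[n --> \oo] --> 0%E.
  by apply: cvg_near_cst; apply: nearW => n; exact: I0.
have E0 : int2 P (fun x => w x * ((d - c) * ((p < s x)%R%:R - (q < s x)%R%:R)
      - (q - p) * ((c < s x)%R%:R - (d < s x)%R%:R))) = 0%E by exact: (cvg_unique _ cv cv0).
have i1 := integrable_mass pq; have i2 := integrable_mass cd.
have j1 := integrableZl mP (d - c) i1; have j2 := integrableZl mP (q - p) i2.
have f1 := integrable_fin_num mP j1; have f2 := integrable_fin_num mP j2.
have := integralB mP j1 j2.
rewrite (integralZl mP i1) (integralZl mP i2) in f1 f2 *.
move=> E1.
have : (0 = (d - c)%:E * mass p q - (q - p)%:E * mass c d)%E.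
  rewrite -E0 -[RHS]E1; apply: eq_integral => x _ /=.
  by rewrite -!EFinM -EFinB; congr EFin; ring.
by move=> /esym/eqP; rewrite sube_eq ?add0e ?fin_num_adde_defl// => /eqP.
Qed.

Let oneDsqr_gt0 (y : R) : 0 < oneDsqr y.
Proof. exact: lt_le_trans ltr01 (oneDsqr_ge1 y). Qed.

Lemma integral_oneDsqrT : (\int[leb]_y ((oneDsqr y)^-1)%:E = pi%:E)%E.
Proof.
rewrite ge0_symfun_integralT; first last.
- by move=> y; rewrite /= /oneDsqr sqrrN.
- by move=> y; apply: continuousV; [rewrite gt_eqF// oneDsqr_gt0|exact: continuous_oneDsqr].
- by move=> y; rewrite invr_ge0 (ltW (oneDsqr_gt0 _)).
rewrite (_ : [set x : R | 0 <= x] = `[0, +oo[%classic); last first.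
  by apply/seteqP; split => x /=; rewrite in_itv/= andbT.
by rewrite integral0y_oneDsqr -EFinM; congr EFin; field.
Qed.

(** By [mass_proportional], [level] has integral [c (q - p)] over []p, q]], so its measure is [c]
    times Lebesgue measure and [level] is [c] almost everywhere. The energy density is
    [weight / (1 + slope ^+ 2)], which the coarea formula turns into [c] times the integral of
    [1 / (1 + y ^+ 2)]. *)
Theorem level_const : exists2 c : R, 0 <= c &
  (exists N : set (measurableTypeR R), [/\ measurable N, leb N = 0%E &
    forall y, ~ N y -> level y = c%:E]) /\ int2 P edens = (c * pi)%:E.
Proof.
have fm p q : p <= q -> mass p q \is a fin_num.
  by move=> pq; exact: integrable_fin_num (integrable_mass pq).
have i01 (p q z : R) : p <= q -> 0 <= (p < z)%R%:R - (q < z)%R%:R :> R.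
  move=> pq; have [qz|] := boolP (q < z); last by rewrite subr0 ler0n.
  by rewrite (le_lt_trans pq qz) subrr.
have w0 x : 0 <= w x by rewrite /weight divr_ge0 ?addr_ge0 ?sqr_ge0.
have m0 p q : p <= q -> (0 <= mass p q)%E.
  by move=> pq; apply: integral_ge0 => x _; rewrite lee_fin mulr_ge0// i01.
pose c := fine (mass 0 1).
have c0 : 0 <= c by rewrite fine_ge0// m0.
have mE p q : p <= q -> mass p q = (c * (q - p))%:E.
  move=> pq; have := mass_proportional pq ler01.
  rewrite subr0 mul1e => ->; rewrite -(fineK (fm _ _ ler01)) -/c -EFinM.
  by rewrite mulrC.
have [mlev _] := coarea_slope (@measurable_cst _ _ _ _ _ (1 : R)) (fun=> ler01).
pose kap := density leb mlev level_ge0.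
have kapE p q : p < q -> kap `]p, q]%classic = (c * (q - p))%:E.
  move=> pq; rewrite -mE ?ltW// /mass.
  have [_ ->] := coarea_slope (measurable_indicator p q) (fun z => i01 p q z (ltW pq)).
  rewrite /kap /density integral_mkcond; apply: eq_integral => y _.
  rewrite patchE mem_setE in_itv /=.
  have [py|py] := ltP p y; have [qy|qy] := ltP q y => /=; rewrite ?subrr ?subr0 ?mul0e ?mul1e//.
  by have := lt_trans (le_lt_trans py pq) qy; rewrite ltxx.
have kE (B : set (measurableTypeR R)) : measurable B -> kap B = (c%:E * leb B)%E.
  move=> mB.
  apply: (@measure_unique _ R (measurableTypeR R) (@ocitv R)
    (fun k => `](- k%:R), k%:R]%classic) erefl (@ocitvI R) (fun k => is_ocitv _ _) _
    kap (mscale (NngNum c0) leb)) => //.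
  + apply/seteqP; split => // x _; have [n nx] := exists_nat_gt `|x|.
    exists n => //=; rewrite in_itv/=; move: nx; rewrite ltr_norml => /andP[-> /ltW ->//].
  + move=> _ [[p q] _ <-] /=; have [pq|pq] := ltP p q.
      rewrite -/(kap _) kapE// /mscale /= lebesgue_measure_itv /= lte_fin pq.
      by rewrite -EFinB -EFinM.
    rewrite (_ : [set` _] = set0) ?measure0//.
    by apply: set_itv_ge; rewrite bnd_simp -leNgt.
  + move=> [|n].
      by rewrite oppr0 set_itvoc0 measure0.
    have nn : - n.+1%:R < n.+1%:R :> R by rewrite gtrN// ltr0Sn.
    apply: (@le_lt_trans _ _ (c * (n.+1%:R - - n.+1%:R))%:E); last exact: ltry.
    by rewrite -(kapE _ _ nn).
exists c => //.
have [N [mN N0 hN]] : exists N : set (measurableTypeR R), [/\ measurable N, leb N = 0%E &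
    forall y, ~ N y -> level y = c%:E].
  (* Functions with equal integrals over all measurable subsets are compared on bounded intervals,
     where they are integrable. *)
  have : {ae leb, forall y, forall n : nat, `](- n%:R), n%:R]%classic y -> level y = c%:E}.
    apply: ae_foralln => n.
    apply: (@integral_ae_eq _ _ _ leb `](- n%:R), n%:R]%classic _ (cst c%:E) level) => //.
      apply/integrableP; split; first exact: measurable_funTS.
      rewrite (_ : (\int[leb]_(x in _) _)%E = kap `](- n%:R), n%:R]%classic); last first.
        by apply: eq_integral => y _; rewrite gee0_abs// level_ge0.
      rewrite kE// lebesgue_measure_itv /=; case: ifP => _; last by rewrite mule0.
      by rewrite -EFinB -EFinM ltry.
    move=> E _ mE'; rewrite integral_cst//; exact: kE.
  move=> [N [mN N0 hN]]; exists N; split => // y nNy; have [n ny] := exists_nat_gt `|y|.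
  have {}hN : forall n : nat, `](- n%:R), n%:R]%classic y -> level y = c%:E.
    by apply: contrapT => h; apply: nNy; apply: hN.
  apply: (hN n) => /=; rewrite in_itv /=; move: ny; rewrite ltr_norml => /andP[-> /ltW ->//].
split; first by exists N.
have mV : measurable_fun (setT : set (measurableTypeR R)) (fun y : R => (oneDsqr y)^-1).
  apply: continuous_measurable_fun => y.
  by apply: continuousV; [rewrite gt_eqF// oneDsqr_gt0|exact: continuous_oneDsqr].
have V0 (y : R) : 0 <= (oneDsqr y)^-1 by rewrite invr_ge0 (ltW (oneDsqr_gt0 _)).
transitivity (int2 P (fun x => w x * (oneDsqr (s x))^-1)).
  apply: eq_integral => x /set_mem px; congr EFin.
  by rewrite (edens_weight a a1 a2 b1 b2 px) mulfK// gt_eqF// (oneDsqr_gt0 (s x)).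
have [_ ->] := coarea_slope mV V0.
transitivity (\int[leb]_y (c%:E * ((oneDsqr y)^-1)%:E))%E.
  apply: ae_eq_integral => //.
  - by apply: emeasurable_funM => //; exact/measurable_EFinP.
  - by apply: emeasurable_funM => //; exact/measurable_EFinP.
  exists N; split => // y /= h; apply: contrapT => /hN E; apply: h => _.
  by rewrite E muleC.
rewrite ge0_integralZl//; first by rewrite integral_oneDsqrT -EFinM.
exact/measurable_EFinP.
Qed.

End level.

(** * Logarithmic cutoffs *)

(** With [T k] the energy in the k-th dyadic box, this finds, arbitrarily far out, a dyadic annulus
    of energy at most [e / k.+1]. *)
Lemma slow_increment (R : realType) (T : nat -> R) (M e : R) (K : nat) : 0 < e ->
  (forall n, T n <= M) -> (forall n, 0 <= T n) ->
  exists2 k, (K <= k)%N & k.+1%:R * (T k.+1 - T k) <= e.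
Proof.
move=> e0 TM T0.
(* Otherwise [T] would dominate a multiple of the harmonic series. *)
apply: contrapT => h.
have {}h k : (K <= k)%N -> e * k.+1%:R^-1 <= T k.+1 - T k.
  move=> Kk; rewrite ler_pdivrMr ?ltr0Sn// mulrC.
  by apply/ltW; rewrite ltNge; apply/negP => hk; apply: h; exists k.
apply: (@dvg_harmonic R).
rewrite -(is_cvg_series_restrict K).
apply: nondecreasing_is_cvgn.
  apply/nondecreasing_seqP => n; rewrite /series/=.
  have [Kn|nK] := leqP K n; last by rewrite !big_geq// ltnW.
  by rewrite big_nat_recr//= lerDl invr_ge0 ler0n.
exists (M / e) => _ [n _ <-]; rewrite ler_pdivlMr// mulrC mulr_sumr.
have [Kn|nK] := leqP K n; last by rewrite big_geq 1?ltnW// (le_trans (T0 0%N)).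
apply: (@le_trans _ _ (\sum_(K <= k < n) (T k.+1 - T k))).
  by rewrite big_nat [leRHS]big_nat; apply: ler_sum => i /andP[Ki _]; exact: h.
by rewrite telescope_sumr// lerBlDr (le_trans (TM n))// lerDl.
Qed.

Section theta.
Context {R : realType}.

(** The affine arguments send [|t| = 1] to 2 and [|t| = 2] to 0, the points where [bump1] has
    reached 1 and 0. *)
Definition theta (t : R) := bump1 (-2 * t + 4) * bump1 (2 * t + 4).

Lemma smooth1_theta k : smooth1 k theta.
Proof. by apply: smooth1_mul; apply: smooth1_affine; exact: smooth1_bump1. Qed.

Lemma theta_in (t : R) : `|t| <= 1 -> theta t = 1.
Proof.
rewrite ler_norml => /andP[t1 t2]; rewrite /theta !bump1_ge2 ?mulr1//; lra.
Qed.

Lemma theta_out (t : R) : 2 <= `|t| -> theta t = 0.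
Proof.
have [t0|t0] := leP 0 t => h; rewrite /theta.
  by rewrite bump1_le0 ?mul0r//; rewrite ger0_norm// in h; lra.
by rewrite [X in _ * X]bump1_le0 ?mulr0//; rewrite ltr0_norm// in h; lra.
Qed.

Definition dtheta : R -> R := theta^`()%classic.

Lemma is_derive_theta (t : R) : is_derive t 1 theta (dtheta t).
Proof. exact: (smooth1_D (smooth1_theta 1)). Qed.

Lemma dtheta_in (t : R) : `|t| < 1 -> dtheta t = 0.
Proof.
move=> t1; have : is_derive t 1 theta 0.
  apply: (near_eq_is_derive _ (is_derive_cst (1 : R) t (1 : R))).
  near=> y; rewrite /= theta_in// ltW//; near: y.
  have ct : {for t, continuous (fun t : R => `|t|)} by exact: norm_continuous.
  by move: (ct [set x | x < 1]); apply; apply: open_nbhs_nbhs; split => //; exact: open_lt.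
by move=> [_ <-]; rewrite /dtheta derive1E.
Unshelve. all: by end_near. Qed.

Lemma dtheta_out (t : R) : 2 < `|t| -> dtheta t = 0.
Proof.
move=> t1; have : is_derive t 1 theta 0.
  apply: (near_eq_is_derive _ (is_derive_cst (0 : R) t (1 : R))).
  near=> y; rewrite /= theta_out// ltW//; near: y.
  have ct : {for t, continuous (fun t : R => `|t|)} by exact: norm_continuous.
  by move: (ct [set x | 2 < x]); apply; apply: open_nbhs_nbhs; split => //; exact: open_gt.
by move=> [_ <-]; rewrite /dtheta derive1E.
Unshelve. all: by end_near. Qed.

Lemma theta_bounded : exists2 B : R, 0 <= B & forall t, `|theta t| <= B /\ `|dtheta t| <= B.
Proof.
have [|B1 B10 hB1] := @smooth1_bounded R theta (-2) 2 0 (smooth1_theta 0).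
  by move=> x h; apply: theta_out; rewrite leNgt; apply/negP; rewrite ltr_norml => /andP[h1 h2]; apply: h; rewrite !ltW.
have [||B2 B20 hB2] := @smooth1_bounded R dtheta (-2) 2 0.
- by case: (smooth1_theta 1).
- by move=> x h; apply: dtheta_out; rewrite ltNge; apply/negP; rewrite ler_norml => /andP[h1 h2]; apply: h; rewrite h1.
exists (B1 + B2); first by rewrite addr_ge0.
move=> x; split; first by rewrite (le_trans (hB1 x))// lerDl.
by rewrite (le_trans (hB2 x))// lerDr.
Qed.

Lemma C1_theta (rho : R) : 0 < rho -> C1_on setT (fun x : R * R => theta (x.1 / rho) * theta (x.2 / rho))
  (fun x => dtheta (x.1 / rho) / rho * theta (x.2 / rho)) (fun x => theta (x.1 / rho) * (dtheta (x.2 / rho) / rho)).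
Proof.
move=> r0 x _.
have ct : continuous theta by exact: smooth1_continuous (smooth1_theta 0).
have cd : continuous dtheta.
  by apply: (@smooth1_continuous R 0); case: (smooth1_theta 1).
have cs (h : R -> R) : continuous h -> continuous (fun t : R => h (t / rho)).
  move=> ch t; apply: (@continuous_comp R R R (fun t : R => t / rho) h); last exact: ch.
  by apply: continuousM; [exact: cvg_id|exact: cvg_cst].
have c1 (h : R -> R) : continuous h -> {for x, continuous (fun x : R * R => h x.1)}.
  by move=> ch; apply: (@continuous_comp _ _ _ fst h); [exact: cvg_fst|exact: ch].
have c2 (h : R -> R) : continuous h -> {for x, continuous (fun x : R * R => h x.2)}.
  by move=> ch; apply: (@continuous_comp _ _ _ snd h); [exact: cvg_snd|exact: ch].
have ds (t : R) : is_derive t 1 (fun t => theta (t / rho)) (dtheta (t / rho) / rho).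
  have da : is_derive t 1 (fun t : R => t / rho) rho^-1.
    have := is_deriveM (is_derive_id t (1 : R)) (is_derive_cst rho^-1 t (1 : R)).
    by rewrite scaler0 add0r; congr is_derive; rewrite [LHS]mulr1.
  exact: (@is_derive1_comp _ theta (fun t => t / rho) _ _ _ (is_derive_theta _) da).
split.
- exact: (is_derive_tensor1 (fun t => theta (t / rho)) (ds x.1)).
- exact: (is_derive_tensor2 (fun t => theta (t / rho)) (ds x.2)).
- by apply: continuousM; [exact: c1 (cs _ ct)|exact: c2 (cs _ ct)].
- apply: continuousM; last exact: c2 (cs _ ct).
  by apply: continuousM; [exact: c1 (cs _ cd)|exact: cvg_cst].
- apply: continuousM; first exact: c1 (cs _ ct).
  by apply: continuousM; [exact: c2 (cs _ cd)|exact: cvg_cst].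
Qed.

End theta.

Section cutoff.
Context {R : realType}.
Variables (Omega : set (R * R)) (F1 F2 V : R * R -> R).
Hypothesis oO : open Omega.
Hypothesis cF : forall x, Omega x -> [/\ {for x, continuous F1}, {for x, continuous F2} & {for x, continuous V}].
Hypothesis V0 : forall x, 0 <= V x.
Hypothesis FV : forall x, V x = 0 -> F1 x = 0 /\ F2 x = 0.
Local Notation int2 D f := (\int[@lebesgue2 R]_(x in D) (f x)%:E)%E.
Local Notation dens := (fun x => (F1 x ^+ 2 + F2 x ^+ 2) / V x).
Hypothesis finite_energy : (int2 Omega dens < +oo)%E.
(** [V] stands for [|v|^2]. A cutoff at scale [4 ^+ k] has gradient of order [4 ^- k], so this bound
    makes the integral of [V |grad eta|^2] of order [k]. *)
Hypothesis growth : exists D (k0 : nat), forall k : nat, (k0 <= k)%N -> exists Vk : R,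
  [/\ 0 <= Vk, forall x, Omega x -> box (2 * 4 ^+ k) x -> V x <= Vk &
     (Vk%:E * lebesgue2 (Omega `&` box (2 * 4 ^+ k)) <= (D * k.+1%:R * (4 ^+ k) ^+ 2)%:E)%E].

Let nz := Omega `&` [set x | 0 < V x].

Let oV : open nz.
Proof.
rewrite openE => x [Ox Vx]; apply: filterI; first exact: open_nbhs_nbhs.
have [_ _ c] := cF Ox.
by move: (c [set x | 0 < x]); apply; apply: open_nbhs_nbhs; split => //; exact: open_gt.
Qed.

Let mV : measurable (nz : set (borel_plane R)).
Proof. exact: open_borel_plane. Qed.

Let dens0 x : 0 <= dens x.
Proof. by rewrite divr_ge0// addr_ge0 ?sqr_ge0. Qed.

Let mdens : measurable_fun (nz : set (borel_plane R)) dens.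
Proof.
apply: continuous_on_measurable => // x [Ox Vx]; have [c1 c2 c] := cF Ox.
apply: continuousM; first by apply: continuousD; exact: continuousM.
by apply: continuousV => //; rewrite gt_eqF.
Qed.

(* Where V vanishes so does F, so that integrands in F only see [nz]. *)
Let int_nz (f : R * R -> R) : (forall x, F1 x = 0 -> F2 x = 0 -> f x = 0) ->
  int2 Omega f = int2 nz f.
Proof.
move=> f0; rewrite /nz [RHS]integral_mkcondr; apply: eq_integral => x; rewrite inE => Ox.
rewrite patchE; case: ifPn => // /negP; rewrite inE /= => nx.
have Vx0 : V x = 0 by apply/eqP; rewrite eq_le V0 andbT leNgt; apply/negP.
by have [h1 h2] := FV Vx0; rewrite f0.
Qed.

(** The gradient of [theta] at scale [rho = 4 ^+ k.+1] lives in one dyadic annulus. There the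
    integral of [|F|^2 / V] is of order [1 / k] for the [k] selected by [slow_increment], against
    order [k] for that of [V |grad eta|^2]. *)
Theorem cutoff : exists2 C0, 0 <= C0 & forall M d : R, 0 < d -> exists eta e1 e2 L,
    [/\ C1_on setT eta e1 e2, forall x, box M x -> eta x = 1,
       forall x, `|eta x| <= C0, 0 <= L /\ forall x, ~ box L x -> eta x = 0 &
       (int2 Omega (fun x => Num.sqrt (F1 x ^+ 2 + F2 x ^+ 2) * (`|e1 x| + `|e2 x|)) <= d%:E)%E].
Proof.
have [B B0 hB] := @theta_bounded R.
exists (B * B); first by rewrite mulr_ge0.
move=> M d d0.
have [D' [k0 hD']] := growth.
pose D := Num.max D' 0.
have D0 : 0 <= D by rewrite le_max lexx orbT.
have DD' : D' <= D by rewrite le_max lexx.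
pose Bk k : set (R * R) := nz `&` box (2 * 4 ^+ k).
have mBk k : measurable (Bk k : set (borel_plane R)).
  by apply: measurableI => //; exact: measurable_box.
have p4 k : 0 < 4 ^+ k :> R by rewrite exprn_gt0.
have BkS k : Bk k `<=` Bk k.+1.
  move=> x [nx [x1 x2]]; split => //; have := p4 k.
  by rewrite /box /= exprS; split; lra.
have iT : (@lebesgue2 R).-integrable nz (EFin \o dens).
  apply/integrableP; split; first exact/measurable_EFinP.
  rewrite (_ : (\int[_]_(x in _) _)%E = int2 nz dens); last first.
    by apply: eq_integral => x _ /=; rewrite ger0_norm.
  rewrite -int_nz// => x -> ->.
  by rewrite expr0n addr0 mul0r.
have iB k : (@lebesgue2 R).-integrable (Bk k) (EFin \o dens).
  by apply: integrableS iT => // x [].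
pose Tk k := fine (int2 (Bk k) dens).
have TkE k : int2 (Bk k) dens = (Tk k)%:E.
  by rewrite fineK//; exact: integrable_fin_num (iB k).
have T0 k : 0 <= Tk k by rewrite fine_ge0// integral_ge0// => x _; rewrite lee_fin.
have TM k : Tk k <= fine (int2 nz dens).
  rewrite -lee_fin -TkE fineK; last exact: integrable_fin_num iT.
  apply: ge0_subset_integral => //; first exact/measurable_EFinP.
    by move=> x _; rewrite lee_fin.
  by move=> x [].
have mA k : measurable (Bk k.+1 `\` Bk k : set (borel_plane R)) by exact: measurableD.
have Tdiff k : int2 (Bk k.+1 `\` Bk k) dens = (Tk k.+1 - Tk k)%:E.
  have : int2 (Bk k.+1) dens = (int2 (Bk k) dens + int2 (Bk k.+1 `\` Bk k) dens)%E.
    have {1}-> : Bk k.+1 = Bk k `|` (Bk k.+1 `\` Bk k).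
      by rewrite setUDr setDv setD0 setUC; apply/esym/setUidPl; exact: BkS.
    rewrite ge0_integral_setU//.
    - apply/measurable_EFinP; apply: measurable_funS mdens => //.
      by move=> x [[]|[[]]].
    - by move=> x _; rewrite lee_fin.
    - by rewrite disj_set2E; apply/eqP/seteqP; split => // x [h1 [_ /(_ h1)]].
  have aux (x y : R) (z : \bar R) : (x%:E = y%:E + z)%E -> z = (x - y)%:E.
    by case: z => //= z [->]; rewrite addrAC subrr add0r.
  by rewrite !TkE => /aux.
(* Half of [d] goes to each term of the AM-GM bound. The energy term uses an increment with
   [k.+1%:R * (Tk k.+1 - Tk k) <= d * delta]; the gradient term is at most [4 * B ^+ 4 * D * delta],
   which is below [d / 2]. The summand 1 keeps the denominator positive. *)
pose delta := d / (8 * B ^+ 4 * D + 1).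
have dd0 : 0 < 8 * B ^+ 4 * D + 1 by rewrite ltr_wpDl// !mulr_ge0// exprn_ge0.
have delta0 : 0 < delta by rewrite divr_gt0.
have [N0 hN0] := exists_nat_gt `|M|.
have [k kK hk] := slow_increment (k0 + N0) (mulr_gt0 d0 delta0) TM T0.
pose rho : R := 4 ^+ k.+1.
have rho0 : 0 < rho by exact: p4.
have rhoE : rho = 4 * 4 ^+ k by rewrite /rho exprS.
have [|Vk [Vk0 hVk area]] := hD' k.+1.
  by rewrite (leq_trans _ (leqW kK))// leq_addr.
pose lam := k.+1%:R / delta.
have lam0 : 0 < lam by rewrite divr_gt0// ltr0Sn.
pose e1 (x : R * R) := dtheta (x.1 / rho) / rho * theta (x.2 / rho).
pose e2 (x : R * R) := theta (x.1 / rho) * (dtheta (x.2 / rho) / rho).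
pose E x := `|e1 x| + `|e2 x|.
have E0 x : 0 <= E x by rewrite addr_ge0.
have EB x : E x <= 2 * B ^+ 2 / rho.
  have [h1 h1'] := hB (x.1 / rho); have [h2 h2'] := hB (x.2 / rho).
  have -> : 2 * B ^+ 2 / rho = B / rho * B + B * (B / rho) by field; rewrite gt_eqF.
  have r' : 0 <= rho^-1 by rewrite invr_ge0 ltW.
  have key (p q : R) : `|p| <= B -> `|q| <= B -> `|p / rho * q| <= B / rho * B.
    move=> pB qB; rewrite !normrM normfV (gtr0_norm rho0); apply: ler_pM => //.
      by rewrite mulr_ge0.
    exact: ler_wpM2r.
  by rewrite /E /e1 /e2; apply: lerD; rewrite ?[_ * (_ / _)]mulrC; exact: key.
have Eout x : nz x -> ~ (Bk k.+1 `\` Bk k) x -> E x = 0.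
  move=> nx nA; have [b1|b1] := pselect (box (2 * 4 ^+ k) x).
    have [x1 x2] := b1; have := p4 k => p.
    rewrite /E /e1 /e2 !dtheta_in ?mul0r ?mulr0 ?normr0 ?addr0//.
      by rewrite normrM normfV (gtr0_norm rho0) ltr_pdivrMr// mul1r rhoE; lra.
    by rewrite normrM normfV (gtr0_norm rho0) ltr_pdivrMr// mul1r rhoE; lra.
  have [b2|b2] := pselect (box (2 * rho) x).
    by exfalso; apply: nA; split; [split|move=> [_]].
  have [h|h] : 2 < `|x.1 / rho| \/ 2 < `|x.2 / rho|.
    apply: contrapT => /not_orP[/negP + /negP]; rewrite -!leNgt !normrM normfV (gtr0_norm rho0).
    by rewrite !ler_pdivrMr// => h1 h2; apply: b2.
  - by rewrite /E /e1 /e2 (dtheta_out h) (theta_out (ltW h)) !mul0r normr0 addr0.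
  - by rewrite /E /e1 /e2 (dtheta_out h) (theta_out (ltW h)) mul0r !mulr0 normr0 addr0.
pose Fn x := Num.sqrt (F1 x ^+ 2 + F2 x ^+ 2).
have Fn0 x : 0 <= Fn x by rewrite sqrtr_ge0.
pose Q := Vk * (2 * B ^+ 2 / rho) ^+ 2 / (2 * lam).
have lam20 : 0 < 2 * lam by rewrite mulr_gt0.
have Q0 : 0 <= Q.
  by apply: divr_ge0; [apply: mulr_ge0 => //; exact: sqr_ge0|exact: ltW].
have B4 : 0 <= B ^+ 4 by rewrite exprn_ge0.
(* AM-GM with weight [lam]: the dyadic annulus is chosen so that both terms are small. *)
have amgm x : (Bk k.+1 `\` Bk k) x -> Fn x * E x <= lam / 2 * dens x + Q.
  move=> [[[Ox Vx] bx] _]; rewrite /= in Vx.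
  have VE : V x * E x ^+ 2 <= Vk * (2 * B ^+ 2 / rho) ^+ 2.
    apply: ler_pM => //; rewrite ?sqr_ge0//; first exact: hVk.
    apply: lerXn2r; rewrite ?nnegrE//; exact: le_trans (E0 x) (EB x).
  apply: (@le_trans _ _ (lam / 2 * dens x + V x * E x ^+ 2 / (2 * lam))); last first.
    by rewrite lerD2l ler_pM2r// invr_gt0.
  rewrite -subr_ge0.
  have -> : lam / 2 * dens x + V x * E x ^+ 2 / (2 * lam) - Fn x * E x =
     (lam * Fn x - V x * E x) ^+ 2 / (2 * lam * V x).
    have -> : dens x = Fn x ^+ 2 / V x by rewrite sqr_sqrtr// addr_ge0 ?sqr_ge0.
    by field; rewrite !gt_eqF.
  by apply: divr_ge0; [exact: sqr_ge0|apply: mulr_ge0 => //; exact: ltW].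
have mEn : measurable_fun (nz : set (borel_plane R)) (fun x => Fn x * E x).
  apply: continuous_on_measurable => // x [Ox _]; have [c1 c2 _] := cF Ox.
  have [_ _ _ ce1 ce2] := C1_theta rho0 (I : setT x).
  apply: continuousM.
    apply: (@continuous_comp _ _ _ (fun x => F1 x ^+ 2 + F2 x ^+ 2) Num.sqrt).
      by apply: continuousD; exact: continuousM.
    exact: sqrt_continuous.
  by apply: continuousD; (apply: continuous_comp; [|exact: norm_continuous]).
have An : Bk k.+1 `\` Bk k `<=` nz by move=> x [[]].
exists (fun x => theta (x.1 / rho) * theta (x.2 / rho)), e1, e2, (2 * rho); split.
- exact: C1_theta.
- have Mr : M <= rho.
    apply: le_trans (ler_norm _) _; apply: (le_trans (ltW hN0)).
    rewrite /rho -natrX ler_nat.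
    by rewrite (leq_trans _ (ltnW (ltn_expl k.+1 (isT : 1 < 4)%N)))// (leq_trans (leq_addl k0 _))// (leq_trans kK).
  move=> x [x1 x2]; rewrite !theta_in ?mulr1//.
    by rewrite normrM normfV (gtr0_norm rho0) ler_pdivrMr// mul1r (le_trans x2).
  by rewrite normrM normfV (gtr0_norm rho0) ler_pdivrMr// mul1r (le_trans x1).
- by move=> x; rewrite normrM; apply: ler_pM => //; have [] := hB (x.1 / rho); have [] := hB (x.2 / rho).
- split; first by rewrite mulr_ge0// ltW.
  move=> x bx; have [h|h] : 2 <= `|x.1 / rho| \/ 2 <= `|x.2 / rho|.
    apply: contrapT => /not_orP[/negP + /negP]; rewrite -!ltNge !normrM normfV (gtr0_norm rho0).
    by rewrite !ltr_pdivrMr// => h1 h2; apply: bx; split; exact: ltW.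
  + by rewrite theta_out// mul0r.
  + by rewrite [X in _ * X]theta_out// mulr0.
rewrite -/(int2 Omega (fun x => Fn x * E x)) int_nz; last first.
  by move=> x E1 E2; rewrite /Fn E1 E2 expr0n addr0 sqrtr0 mul0r.
have -> : int2 nz (fun x => Fn x * E x) = int2 (Bk k.+1 `\` Bk k) (fun x => Fn x * E x).
  rewrite [LHS]integral_mkcond [RHS]integral_mkcond; apply: eq_integral => x _; rewrite !patchE.
  case: ifPn => [/set_mem nx|nx]; last first.
    by rewrite ifN//; apply: contra nx => /set_mem h; apply: mem_set; exact: An.
  case: ifPn => // nA; rewrite Eout ?mulr0// => h.
  by move/negP: nA; apply; exact: mem_set.
apply: (@le_trans _ _ (\int[@lebesgue2 R]_(x in Bk k.+1 `\` Bk k) ((lam / 2)%:E * (dens x)%:E + Q%:E))%E).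
  apply: ge0_le_integral => //.
  - by move=> x _; rewrite lee_fin mulr_ge0.
  - by apply/measurable_EFinP; exact: measurable_funS mEn.
  - apply: emeasurable_funD => //; apply/measurable_EFinP; apply: measurable_funM => //.
    exact: measurable_funS mdens.
have l20 : 0 <= lam / 2 by rewrite divr_ge0// ltW.
rewrite ge0_integralD//; first last.
- by apply/measurable_EFinP; apply: measurable_funM => //; exact: measurable_funS mdens.
- by move=> x _; rewrite -EFinM lee_fin mulr_ge0.
rewrite ge0_integralZl//; first last.
- by move=> x _; rewrite lee_fin.
- by apply/measurable_EFinP; exact: measurable_funS mdens.
rewrite Tdiff -EFinM integral_cst//.
apply: (@le_trans _ _ ((d / 2)%:E + (d / 2)%:E)%E); last by rewrite -EFinD -splitr.
apply: leeD.
  rewrite lee_fin /lam.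
  have -> : k.+1%:R / delta / 2 * (Tk k.+1 - Tk k) = k.+1%:R * (Tk k.+1 - Tk k) / delta / 2.
    by field; rewrite gt_eqF.
  by rewrite ler_pM2r// ler_pdivrMr.
apply: (@le_trans _ _ ((2 * B ^+ 4 / (lam * rho ^+ 2))%:E * (D * k.+2%:R * rho ^+ 2)%:E)%E).
  have -> : Q = 2 * B ^+ 4 / (lam * rho ^+ 2) * Vk.
    by rewrite /Q; field; rewrite !gt_eqF.
  rewrite EFinM -muleA; apply: lee_wpmul2l.
    by rewrite lee_fin; apply: divr_ge0; apply: mulr_ge0 => //; [exact: ltW|exact: sqr_ge0].
  apply: (@le_trans _ _ (D' * k.+2%:R * (4 ^+ k.+1) ^+ 2)%:E); last first.
    by rewrite lee_fin; apply: ler_wpM2r; rewrite ?sqr_ge0//; apply: ler_wpM2r.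
  apply: le_trans area; apply: lee_wpmul2l; first by rewrite lee_fin.
  apply: le_measure; rewrite ?inE//.
    by apply: measurableI; [exact: open_borel_plane|exact: measurable_box].
  by move=> x [[[]]].
rewrite -EFinM lee_fin.
have -> : 2 * B ^+ 4 / (lam * rho ^+ 2) * (D * k.+2%:R * rho ^+ 2) =
   2 * B ^+ 4 * D * delta * (k.+2%:R / k.+1%:R).
  by rewrite /lam; field; rewrite !gt_eqF ?ltr0Sn.
apply: (@le_trans _ _ (2 * B ^+ 4 * D * delta * 2)).
  apply: ler_wpM2l.
    by apply: mulr_ge0; [apply: mulr_ge0 => //; exact: mulr_ge0|exact: ltW].
  by rewrite ler_pdivrMr ?ltr0Sn// -natrM ler_nat mul2n -addnn addnS addSn !ltnS leq_addl.
have dE : d = delta * (8 * B ^+ 4 * D + 1) by rewrite /delta divfK// gt_eqF.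
rewrite [leRHS](_ : _ = 2 * B ^+ 4 * D * delta * 2 + delta / 2); last by rewrite {1}dE; field.
by rewrite lerDl divr_ge0// ltW.
Qed.

End cutoff.

(** * The three domains *)

Lemma open_superlevel (R : realType) (f : R * R -> R) (c : R) :
  continuous f -> open [set x | c < f x].
Proof.
by move=> cf; apply: (@open_comp _ _ f [set x | c < x]) => [x _|]; [exact: cf|exact: open_gt].
Qed.

Section closure_facts.
Context {R : realType}.
Implicit Types (Omega : set (R * R)) (f : R * R -> R) (x : R * R).

Lemma compact_closure_box Omega (M : R) : compact (closure Omega `&` box M).
Proof.
rewrite setIC; apply: compact_closedI; first exact: compact_box.
exact: closed_closure.
Qed.

(** As [f] vanishes on the boundary, the set where [f >= e] cannot reach it. Since [f] is continuous
    only within the closure, compactness is obtained on the graph: the part of height at least [e]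
    is compact, and so is its projection. *)
Lemma compact_superlevel Omega f (M e : R) : {within closure Omega, continuous f} ->
  (forall x, (closure Omega `\` Omega) x -> f x = 0) -> 0 < e ->
  compact (Omega `&` box M `&` [set x | e <= f x]).
Proof.
move=> cf f0 e0; pose K := closure Omega `&` box M.
have cK : compact K := @compact_closure_box Omega M.
have cfK : {within K, continuous f} by apply: continuous_subspaceW cf => x [].
have cg : {within K, continuous (fun x => (x, f x))}.
  have ci : {within K, continuous (id : R * R -> R * R)} by apply: continuous_subspaceT => y; exact: cvg_id.
  by move=> x; exact: (cvg_pair (ci x) (cfK x)).
have cl : closed [set p : (R * R) * R | e <= p.2].
  have -> : [set p : (R * R) * R | e <= p.2] = snd @^-1` [set t | e <= t] by [].
  by apply: closed_comp; [move=> x _; exact: cvg_snd|exact: closed_ge].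
have cG := compact_closedI (continuous_compact cg cK) cl.
have -> : Omega `&` box M `&` [set x | e <= f x] =
    fst @` ((fun x => (x, f x)) @` K `&` [set p : (R * R) * R | e <= p.2]).
  apply/seteqP; split => [x [[Ox bx] fx]|_ [_ [[x [cx bx] <-] /= fx] <-]] /=.
    by exists (x, f x) => //; split => //; exists x => //; split => //; exact: subset_closure.
  split => //; split => //; apply: contrapT => nOx.
  by move: fx; rewrite f0// leNgt e0.
by apply: continuous_compact cG; apply: continuous_subspaceT => p; exact: cvg_fst.
Qed.

Lemma within_for Omega f g : open Omega -> {within closure Omega, continuous g} ->
  (forall x, Omega x -> f x = g x) -> forall x, Omega x -> {for x, continuous f}.
Proof.
move=> oO cg fg x Ox.
have : {within Omega, continuous g} by apply: continuous_subspaceW cg; exact: subset_closure.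
rewrite continuous_open_subspace// => /(_ x (mem_set Ox)) cgx.
have : g y @[y --> x] --> f x by rewrite fg.
apply: cvg_trans; apply: near_eq_cvg.
have nO : nbhs x Omega by exact: open_nbhs_nbhs.
by apply: filterS nO => y Oy; exact/esym/fg.
Qed.

Lemma C1_closure_on Omega f : open Omega -> C1_closure Omega f ->
  C1_on Omega f ('D_((1 : R), (0 : R)) f) ('D_((0 : R), (1 : R)) f).
Proof.
move=> oO [cf df] x Ox.
have [d1 [g1 cg1 E1]] := df _ (or_introl erefl).
have [d2 [g2 cg2 E2]] := df _ (or_intror erefl).
split.
- by apply: DeriveDef => //; exact: d1.
- by apply: DeriveDef => //; exact: d2.
- exact: (within_for oO cf).
- exact: (within_for oO cg1).
- exact: (within_for oO cg2).
Qed.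

Lemma C1_closure_bounded Omega f (M : R) : C1_closure Omega f ->
  exists2 C, 0 <= C & forall x, Omega x -> box M x ->
    [/\ `|f x| <= C, `|'D_((1 : R), (0 : R)) f x| <= C & `|'D_((0 : R), (1 : R)) f x| <= C].
Proof.
move=> [cf df].
have [_ [g1 cg1 E1]] := df _ (or_introl erefl).
have [_ [g2 cg2 E2]] := df _ (or_intror erefl).
have bd (g : R * R -> R) : {within closure Omega, continuous g} ->
    exists2 C, 0 < C & forall x, (closure Omega `&` box M) x -> `|g x| <= C.
  move=> cg; apply: (@compact_bound R (closure Omega `&` box M) g); first exact: compact_closure_box.
  by apply: continuous_subspaceW cg => x [].
have [C0 C00 h0] := bd f cf; have [C1 C10 h1] := bd g1 cg1; have [C2 C20 h2] := bd g2 cg2.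
exists (C0 + C1 + C2); first by rewrite !addr_ge0// ltW.
move=> x Ox bx; have cx : (closure Omega `&` box M) x by split => //; exact: subset_closure.
by rewrite E1// E2//; have := h0 x cx; have := h1 x cx; have := h2 x cx; split; lra.
Qed.

End closure_facts.

Section tame_symmetries.
Context {R : realType}.
Variables (Omega : set (R * R)) (a a1 a2 b b1 b2 : R * R -> R).
Hypothesis tOmega : tame Omega a a1 a2 b b1 b2.
Local Notation N f := (fun x => - f x).

(** The flux of [(a, - b)] is the opposite flux; only the compactness of superlevel sets depends on
    the sign of [b]. *)
Lemma tameN : (forall M e : R, 0 < e -> compact (Omega `&` box M `&` [set x | e <= - b x])) ->
  tame Omega a a1 a2 (N b) (N b1) (N b2).
Proof.
move=> cN; case: tOmega => oO aC bC bd _ dv en [C0 C00 cu].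
split; [exact: oO|exact: aC|exact: C1_onN| |exact: cN| | |].
- move=> M; have [C C0' hC] := bd M; exists C => // x Ox bx.
  by rewrite !normrN; exact: hC.
- move=> phi G1 G2 K cK KO phiC phi0.
  rewrite -(dv _ _ _ K cK KO (C1_onN phiC)) => [|x /phi0 ->]; last by rewrite oppr0.
  by apply: eq_integral => x _; congr EFin; ring.
- rewrite (_ : (\int[_]_(x in _) _)%E = (\int[@lebesgue2 R]_(x in Omega)
    (((a x * b1 x - b x * a1 x) ^+ 2 + (a x * b2 x - b x * a2 x) ^+ 2)
      / (a x ^+ 2 + b x ^+ 2))%:E)%E)//.
  by apply: eq_integral => x _; congr EFin; congr (_ / _); ring.
exists C0 => // M d d0; have [eta [e1 [e2 [L [h1 h2 h3 h4 h5]]]]] := cu M d d0.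
exists eta, e1, e2, L; split => //; apply: le_trans h5.
by rewrite le_eqVlt; apply/orP; left; apply/eqP; apply: eq_integral => x _; congr (Num.sqrt _ * _)%:E; ring.
Qed.

(** The exchange changes the sign of the flux. The premise on superlevel sets of [a] will come from
    the absence of a boundary in the plane. *)
Lemma tame_swap : (forall M e : R, 0 < e -> compact (Omega `&` box M `&` [set x | e <= a x])) ->
  tame Omega b b1 b2 a a1 a2.
Proof.
move=> cN; case: tOmega => oO aC bC bd _ dv en [C0 C00 cu].
split; [exact: oO|exact: bC|exact: aC| |exact: cN| | |].
- move=> M; have [C C0' hC] := bd M; exists C => // x Ox bx.
  by have [] := hC x Ox bx.
- move=> phi G1 G2 K cK KO phiC phi0.
  rewrite -(dv _ _ _ K cK KO (C1_onN phiC)) => [|x /phi0 ->]; last by rewrite oppr0.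
  by apply: eq_integral => x _; congr EFin; ring.
- rewrite (_ : (\int[_]_(x in _) _)%E = (\int[@lebesgue2 R]_(x in Omega)
    (((a x * b1 x - b x * a1 x) ^+ 2 + (a x * b2 x - b x * a2 x) ^+ 2)
      / (a x ^+ 2 + b x ^+ 2))%:E)%E)//.
  apply: eq_integral => x _; congr EFin; rewrite [b x ^+ 2 + _]addrC; congr (_ / _); ring.
exists C0 => // M d d0; have [eta [e1 [e2 [L [h1 h2 h3 h4 h5]]]]] := cu M d d0.
exists eta, e1, e2, L; split => //; apply: le_trans h5.
by rewrite le_eqVlt; apply/orP; left; apply/eqP; apply: eq_integral => x _; congr (Num.sqrt _ * _)%:E; ring.
Qed.

End tame_symmetries.

(** Two substantial conditions are derived here: [div_free_C1] passes from smooth to C^1 test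
    functions, and [cutoff] converts the growth bound into cutoffs. *)
Lemma tame_intro (R : realType) (Omega : set (R * R)) (a a1 a2 b b1 b2 : R * R -> R) :
  open Omega -> C1_on Omega a a1 a2 -> C1_on Omega b b1 b2 ->
  (forall M : R, exists2 C, 0 <= C & forall x, Omega x -> box M x ->
    [/\ `|a x| <= C, `|a1 x| <= C & `|a2 x| <= C]) ->
  (forall M : R, exists2 C, 0 <= C & forall x, Omega x -> box M x ->
    [/\ `|b x| <= C, `|b1 x| <= C & `|b2 x| <= C]) ->
  (forall M e : R, 0 < e -> compact (Omega `&` box M `&` [set x | e <= b x])) ->
  div_free Omega (fun x => (flux1 a a1 b b1 x, flux2 a a2 b b2 x)) ->
  (\int[@lebesgue2 R]_(x in Omega) ((flux1 a a1 b b1 x ^+ 2 + flux2 a a2 b b2 x ^+ 2)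
   / (a x ^+ 2 + b x ^+ 2))%:E < +oo)%E ->
  (exists D (k0 : nat), forall k : nat, (k0 <= k)%N -> exists Vk : R,
    [/\ 0 <= Vk, forall x, Omega x -> box (2 * 4 ^+ k) x -> a x ^+ 2 + b x ^+ 2 <= Vk &
     (Vk%:E * lebesgue2 (Omega `&` box (2 * 4 ^+ k)) <= (D * k.+1%:R * (4 ^+ k) ^+ 2)%:E)%E]) ->
  tame Omega a a1 a2 b b1 b2.
Proof.
move=> oO aC bC ba bb cb dv en gr.
have cF x : Omega x -> [/\ {for x, continuous (flux1 a a1 b b1)}, {for x, continuous (flux2 a a2 b b2)} &
    {for x, continuous (fun x => a x ^+ 2 + b x ^+ 2)}].
  move=> Ox; have [_ _ ca ca1 ca2] := aC x Ox; have [_ _ cb' cb1 cb2] := bC x Ox; split.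
  - by apply: continuousB; exact: continuousM.
  - by apply: continuousB; exact: continuousM.
  - by apply: continuousD; exact: continuousM.
split => //.
- move=> M; have [C1 C10 h1] := ba M; have [C2 C20 h2] := bb M.
  exists (C1 + C2); first by rewrite addr_ge0.
  move=> x Ox bx; have [? ? ?] := h1 x Ox bx; have [? ? ?] := h2 x Ox bx.
  by split; split; [rewrite ler_wpDr|rewrite ler_wpDr|rewrite ler_wpDr|rewrite ler_wpDl|rewrite ler_wpDl|rewrite ler_wpDl].
- move=> phi G1 G2 K cK KO phiC phi0.
  apply: (@div_free_C1 R Omega (flux1 a a1 b b1) (flux2 a a2 b b2) phi G1 G2 K) => //.
  by move=> x /cF[].
apply: (cutoff oO cF) => //.
- by move=> x; rewrite addr_ge0 ?sqr_ge0.
- move=> x /eqP; rewrite paddr_eq0 ?sqr_ge0// !sqrf_eq0 => /andP[/eqP E1 /eqP E2].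
  by rewrite /flux1 /flux2 E1 E2 !mul0r subrr.
Qed.

Section tame_field.
Context {R : realType}.
Variables (Omega : set (R * R)) (v : R * R -> R * R).
Hypothesis hOmega : [\/ Omega = setT, Omega = halfplane | Omega = strip].
Hypothesis hC1 : C1_closure Omega (fun x => (v x).1) /\ C1_closure Omega (fun x => (v x).2).
Hypothesis hdiv : div_free Omega (flux v).
Hypothesis hbdry : forall x : R * R, (closure Omega `\` Omega) x -> (v x).2 = 0.
Hypothesis hfin : (flux_energy v Omega < +oo)%E.
Hypothesis hgrowth : exists2 C : R, 0 < C & forall r : R, 100 < r ->
    [/\ Omega = setT ->
          (sup_norm v (disk r)
             <= (C * Num.sqrt (ln r))%:E)%E,
        Omega = halfplane ->
          (sup_norm v (halfplane `&` disk r)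
             <= (C * Num.sqrt (ln r))%:E)%E &
        Omega = strip ->
          (sup_norm v (`[- r, r] `*` `[-1, 1])%R
             <= (C * Num.sqrt r)%:E)%E].

Definition v1 x := (v x).1.
Definition v2 x := (v x).2.
Definition d1v1 : R * R -> R := 'D_((1 : R), (0 : R)) v1.
Definition d2v1 : R * R -> R := 'D_((0 : R), (1 : R)) v1.
Definition d1v2 : R * R -> R := 'D_((1 : R), (0 : R)) v2.
Definition d2v2 : R * R -> R := 'D_((0 : R), (1 : R)) v2.

Lemma domain_open : open Omega.
Proof.
case: hOmega => ->; first exact: openT.
  by apply: open_superlevel => x; exact: cvg_snd.
have -> : strip = [set x : R * R | -1 < x.2] `&` [set x | -1 < - x.2].
  by apply/seteqP; split => x /=; rewrite /strip /= ltrN2; [move=> /andP[]|move=> [-> ->]].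
apply: openI; apply: open_superlevel => x; first exact: cvg_snd.
by apply: cvgN; exact: cvg_snd.
Qed.

Lemma enorm_box (x : R * R) (c : R) : box c x -> enorm x <= 2 * c.
Proof.
move=> [x1 x2]; have c0 : 0 <= c by exact: le_trans (normr_ge0 _) x1.
rewrite -(@ler_pXn2r _ 2) ?nnegrE ?enorm_ge0 ?mulr_ge0// sqr_enorm.
rewrite -(real_normK (num_real x.1)) -(real_normK (num_real x.2)).
have k (p : R) : `|p| <= c -> `|p| ^+ 2 <= c ^+ 2 by move=> pc; apply: lerXn2r; rewrite ?nnegrE.
have := k _ x1; have := k _ x2; rewrite exprMn; have := sqr_ge0 c; lra.
Qed.

Lemma sup_norm_le A c x : (sup_norm v A <= c%:E)%E -> 0 <= c -> A x -> v1 x ^+ 2 + v2 x ^+ 2 <= c ^+ 2.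
Proof.
move=> h c0 Ax; rewrite /v1 /v2 -sqr_enorm; apply: lerXn2r; rewrite ?nnegrE ?enorm_ge0//.
rewrite -lee_fin; apply: le_trans h; apply: ereal_sup_ubound.
by exists x.
Qed.

(** The box of half side [2 * 4 ^+ k] lies in the disk of radius [4 ^+ k.+1], which exceeds 100 for
    [k >= 3]. In the plane and half plane [|v|^2] is O(k) and the area O(16^k); in the strip both
    [|v|^2] and the area are O(4^k). *)
Lemma domain_growth : exists D (k0 : nat), forall k : nat, (k0 <= k)%N -> exists Vk : R,
  [/\ 0 <= Vk, forall x, Omega x -> box (2 * 4 ^+ k) x -> v1 x ^+ 2 + v2 x ^+ 2 <= Vk &
     (Vk%:E * lebesgue2 (Omega `&` box (2 * 4 ^+ k)) <= (D * k.+1%:R * (4 ^+ k) ^+ 2)%:E)%E].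
Proof.
have [C C0 hC] := hgrowth.
have mO : measurable (Omega : set (borel_plane R)) by apply: open_borel_plane; exact: domain_open.
have mB c : measurable (Omega `&` box c : set (borel_plane R)).
  by apply: measurableI => //; exact: measurable_box.
have p4 k : 0 < 4 ^+ k :> R by rewrite exprn_gt0.
have r100 k : (3 <= k)%N -> 100 < 4 ^+ k.+1 :> R.
  move=> k3; apply: (@lt_le_trans _ _ (4 ^+ 4)); first by rewrite -natrX ltr_nat.
  by rewrite ler_eXn2l// ltr1n.
have ln4 : 0 <= ln 4 :> R by rewrite ln_ge0// ler1n.
have plane k : (3 <= k)%N ->
    (forall r : R, 100 < r -> forall x, Omega x -> disk r x -> v1 x ^+ 2 + v2 x ^+ 2 <= (C * Num.sqrt (ln r)) ^+ 2) ->
    exists Vk : R, [/\ 0 <= Vk, forall x, Omega x -> box (2 * 4 ^+ k) x -> v1 x ^+ 2 + v2 x ^+ 2 <= Vk &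
     (Vk%:E * lebesgue2 (Omega `&` box (2 * 4 ^+ k)) <= ((16 * C ^+ 2 * ln 4) * k.+1%:R * (4 ^+ k) ^+ 2)%:E)%E].
  move=> k3 hr; exists (C ^+ 2 * (ln 4 * k.+1%:R)); split.
  - by apply: mulr_ge0; [exact: sqr_ge0|exact: mulr_ge0].
  - move=> x Ox bx; have := hr _ (r100 k k3) x Ox.
    rewrite exprMn sqr_sqrtr ?ln_ge0 ?lnXn ?mulr_natr//; last by rewrite exprn_ege1// ler1n.
    by apply; rewrite /disk /= (le_trans (enorm_box bx))// exprS; have := p4 k; lra.
  - have p8 : 0 <= 2 * 4 ^+ k :> R by rewrite mulr_ge0// ltW.
    apply: (@le_trans _ _ ((C ^+ 2 * (ln 4 * k.+1%:R))%:E * ((2 * (2 * 4 ^+ k)) ^+ 2)%:E)%E).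
      apply: lee_wpmul2l.
        by rewrite lee_fin; apply: mulr_ge0; [exact: sqr_ge0|exact: mulr_ge0].
      rewrite -lebesgue2_box//; apply: le_measure; rewrite ?inE//; first exact: measurable_box.
    by rewrite -EFinM lee_fin le_eqVlt; apply/orP; left; apply/eqP; ring.
have disk_case A : Omega `<=` A -> (forall r : R, 100 < r -> (sup_norm v (A `&` disk r) <= (C * Num.sqrt (ln r))%:E)%E) ->
    forall r : R, 100 < r -> forall x, Omega x -> disk r x -> v1 x ^+ 2 + v2 x ^+ 2 <= (C * Num.sqrt (ln r)) ^+ 2.
  move=> OA h r r1 x Ox dx; apply: (sup_norm_le (h r r1)); last by split => //; exact: OA.
  by rewrite mulr_ge0 ?sqrtr_ge0// ltW.
have [OT|OH|OS] := hOmega.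
- exists (16 * C ^+ 2 * ln 4), 3%N => k k3; apply: plane => //.
  by apply: (disk_case setT) => // r /hC[h _ _]; rewrite setTI; exact: h.
- exists (16 * C ^+ 2 * ln 4), 3%N => k k3; apply: plane => //.
  by apply: (disk_case halfplane) => [|r /hC[_ h _]]; [rewrite OH|exact: h].
exists (32 * C ^+ 2), 3%N => k k3.
have r1 := r100 k k3; have [_ _ /(_ OS) hs] := hC _ r1; have pk := p4 k.
exists (C ^+ 2 * 4 ^+ k.+1); split.
- by apply: mulr_ge0; [exact: sqr_ge0|rewrite ltW].
- move=> x Ox [x1 x2].
  have -> : C ^+ 2 * 4 ^+ k.+1 = (C * Num.sqrt (4 ^+ k.+1)) ^+ 2 by rewrite exprMn sqr_sqrtr// ltW.
  apply: (sup_norm_le hs); first by rewrite mulr_ge0 ?sqrtr_ge0// ltW.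
  move: Ox; rewrite OS => /andP[s1 s2]; split => /=; rewrite in_itv /=.
    by rewrite -ler_norml exprS; lra.
  by rewrite !ltW.
pose I1 : set (measurableTypeR R) := `[- (2 * 4 ^+ k), 2 * 4 ^+ k]%classic.
pose I2 : set (measurableTypeR R) := `[-1, 1]%classic.
have mI1 : measurable I1 by exact: measurable_itv.
have mI2 : measurable I2 by exact: measurable_itv.
apply: (@le_trans _ _ ((C ^+ 2 * 4 ^+ k.+1)%:E * (4 * 4 ^+ k * 2)%:E)%E).
  apply: lee_wpmul2l.
    by rewrite lee_fin; apply: mulr_ge0; [exact: sqr_ge0|rewrite ltW].
  have <- : lebesgue2 (I1 `*` I2) = (4 * 4 ^+ k * 2)%:E.
    transitivity (lebesgue_measure I1 * lebesgue_measure I2)%E.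
      exact: product_measure1E.
    rewrite /I1 /I2 !lebesgue_measure_itv /= !lte_fin !ifT; [|lra|lra].
    by rewrite -!EFinB -EFinM; congr EFin; ring.
  apply: le_measure; rewrite ?inE//; first exact: measurableX.
  move=> x [+ [x1 x2]]; rewrite OS => /andP[s1 s2]; split; rewrite /I1 /I2 /= in_itv /=.
    by rewrite -ler_norml.
  by rewrite !ltW.
rewrite -EFinM lee_fin [4 ^+ k.+1]exprS.
have -> : C ^+ 2 * (4 * 4 ^+ k) * (4 * 4 ^+ k * 2) = 32 * C ^+ 2 * 1 * (4 ^+ k) ^+ 2 by ring.
apply: ler_wpM2r; first exact: sqr_ge0.
apply: ler_wpM2l; first by apply: mulr_ge0 => //; exact: sqr_ge0.
by rewrite ler1n.
Qed.

Lemma tame_field : tame Omega v1 d1v1 d2v1 v2 d1v2 d2v2.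
Proof.
apply: tame_intro.
- exact: domain_open.
- exact: C1_closure_on domain_open hC1.1.
- exact: C1_closure_on domain_open hC1.2.
- by move=> M; exact: C1_closure_bounded M hC1.1.
- by move=> M; exact: C1_closure_bounded M hC1.2.
- by move=> M e e0; apply: compact_superlevel => //; case: hC1.2.
- exact: hdiv.
- apply: le_lt_trans hfin; rewrite le_eqVlt; apply/orP; left; apply/eqP.
  by apply: eq_integral => x _; rewrite !sqr_enorm.
- exact: domain_growth.
Qed.

End tame_field.

(** * Null sets under expanding maps *)

Section null_sets.
Context {R : realType}.
Local Notation leb := (@lebesgue_measure R).

Lemma atan_contract (x y : R) : `|atan x - atan y| <= `|x - y|.
Proof.
have [z _ E] := @MVT_between R atan (fun z => (1 + z ^+ 2)^-1) y x (fun z _ => is_derive1_atan z).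
rewrite E normrM ler_piMl//.
have z0 : 1 <= 1 + z ^+ 2 by rewrite lerDl sqr_ge0.
by rewrite ger0_norm ?invr_ge0 ?(le_trans ler01)// invf_le1// (lt_le_trans ltr01).
Qed.

Lemma le_leb (A B : set R) : A `<=` B -> (leb A <= leb B)%E.
Proof. by move=> AB; exact: (le_mu_ext (wlength idfun) AB). Qed.

(** An interval of length [v - u] pulls back under an expanding map into one of length [2 (v - u)],
    centred at any point of the preimage. The argument takes place at the level of outer measure,
    since the preimages are arbitrary sets. *)
Lemma null_preimage (D N : set R) (c : R -> R) :
  (forall t t', D t -> D t' -> `|t - t'| <= `|c t - c t'|) -> leb N = 0%E ->
  leb (D `&` c @^-1` N) = 0%E.
Proof.
move=> hc N0; apply/eqP; rewrite eq_le; apply/andP; split; last first.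
  by apply: mu_ext_ge0 => X; exact: measure_ge0.
apply/lee_addgt0Pr => e e0; rewrite add0e.
(* Half of [e], as pulling back doubles the lengths of the covering intervals. *)
have e20 : 0 < e / 2 by rewrite divr_gt0.
have : (leb N < (e / 2)%:E)%E by rewrite N0 lte_fin.
move=> /ereal_inf_lt[_ [F [mF NF] <-] sF].
have wl0 k : (0 <= wlength idfun (F k))%E by exact: measure_ge0.
apply: (@le_trans _ _ (\sum_(0 <= k <oo) leb (D `&` c @^-1` F k))%E).
  have /(_ (fun k => D `&` c @^-1` F k)) := @mu_ext_sigma_subadditive _ _ R (wlength idfun) (fun X => measure_ge0 _ X).
  apply: le_trans; apply: le_leb => t [Dt /NF[k _ kt]].
  by exists k.
apply: (@le_trans _ _ (\sum_(0 <= k <oo) (2%:E * wlength idfun (F k)))%E); last first.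
  rewrite nneseriesZl// -(divfK (_ : 2 != 0 :> R) e)// mulrC EFinM.
  by apply: lee_wpmul2l => //; exact: ltW.
apply: lee_nneseries => [k _ _|k _].
  by apply: mu_ext_ge0 => X; exact: measure_ge0.
have /ocitvP[->|[[u v] /= uv ->]] := mF k.
  by rewrite preimage_set0 setI0 -[leb set0]/(lebesgue_measure set0) !measure0 mule0.
have [->|/set0P[t0 [Dt0 ct0]]] := eqVneq (D `&` c @^-1` `]u, v]) set0.
  by rewrite measure0 mule_ge0// measure_ge0.
apply: (@le_trans _ _ (leb `[t0 - (v - u), t0 + (v - u)]%classic)).
  apply: le_leb => t [Dt ct]; have := hc t t0 Dt Dt0.
  move: ct ct0; rewrite /= !in_itv /= => /andP[h1 h2] /andP[h3 h4] h.
  have : `|t - t0| <= v - u.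
    by apply: le_trans h _; rewrite ler_norml; apply/andP; split; lra.
  by rewrite ler_norml => /andP[h5 h6]; apply/andP; split; lra.
rewrite lebesgue_measure_itv wlength_itv /= !lte_fin uv ifT; last by lra.
by rewrite -!EFinB -EFinM lee_fin; lra.
Qed.

Lemma tan_expanding (phi t t' : R) : - (pi / 2) < t - phi < pi / 2 -> - (pi / 2) < t' - phi < pi / 2 ->
  `|t - t'| <= `|tan (t - phi) - tan (t' - phi)|.
Proof.
move=> ht ht'; apply: le_trans (atan_contract _ _).
by rewrite !tanK ?in_itv//= opprB addrA subrK.
Qed.

End null_sets.

Section degenerate.
Context {R : realType}.
Variables (Omega : set (R * R)) (b b1 b2 : R * R -> R).
Hypothesis oO : open Omega.
Hypothesis bC : C1_on Omega b b1 b2.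

(** The coarea formula for [b] with the integrand [1 / |grad b|] on this set gives its area as an
    integral over levels, to which only the single level 0 contributes. *)
Lemma critical_null : @lebesgue2 R (Omega `&` [set x | (b1 x, b2 x) != 0] `&` [set x | b x = 0]) = 0%E.
Proof.
pose O := Omega `&` [set x | 0 < b1 x ^+ 2 + b2 x ^+ 2].
have OE : Omega `&` [set x | (b1 x, b2 x) != 0] = O.
  apply/seteqP; split => x [Ox /= h]; split => //=.
    rewrite lt_neqAle addr_ge0 ?sqr_ge0// andbT eq_sym; apply: contra h.
    by rewrite paddr_eq0 ?sqr_ge0// !sqrf_eq0 => /andP[/eqP -> /eqP ->].
  by apply/negP => /eqP[E1 E2]; rewrite E1 E2 expr0n addr0 ltxx in h.
rewrite OE.
have oO' : open O.
  rewrite openE => x [Ox bx]; have [_ _ _ c1 c2] := bC Ox; apply: filterI.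
    exact: open_nbhs_nbhs.
  have cs : {for x, continuous (fun x => b1 x ^+ 2 + b2 x ^+ 2)}.
    by apply: continuousD; exact: continuousM.
  by move: (cs [set x | 0 < x]); apply; apply: open_nbhs_nbhs; split => //; exact: open_gt.
have mO : measurable (O : set (borel_plane R)) by exact: open_borel_plane.
have bC' : C1_on O b b1 b2 by apply: C1_onS bC => x [].
have mb : measurable_fun (O : set (borel_plane R)) b.
  by apply: continuous_on_measurable => // x /bC'[].
pose Z : set (borel_plane R) := O `&` [set x | b x = 0].
have mZ : measurable Z by exact: (mb mO _ (measurable_set1 (0 : measurableTypeR R))).
have mn : measurable_fun (O : set (borel_plane R)) (fun x => (enorm (b1 x, b2 x))^-1).
  apply: continuous_on_measurable => // x Ox; have [_ _ _ c1 c2] := bC' x Ox.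
  apply: continuousV.
    by rewrite gt_eqF// /enorm sqrtr_gt0; case: Ox.
  apply: (@continuous_comp _ _ _ (fun x => dot (b1 x, b2 x) (b1 x, b2 x)) Num.sqrt).
    by apply: continuousD; exact: continuousM.
  exact: sqrt_continuous.
pose f : borel_plane R -> \bar R := (fun x => (enorm (b1 x, b2 x))^-1%:E) \_ Z.
have mf : measurable_fun setT f.
  apply/(measurable_restrictT _ mZ); apply/measurable_EFinP; apply: measurable_funS mn => //.
  by move=> x [].
have f0 x : (0 <= f x)%E.
  by rewrite /f patchE; case: ifPn => // _; rewrite lee_fin invr_ge0 enorm_ge0.
have bn0 x : O x -> (b1 x, b2 x) != 0.
  by rewrite -OE => -[].
have [mI EI] := coarea oO' bC' bn0 mf f0.
transitivity (\int[@lebesgue2 R]_(x in O) ((enorm (b1 x, b2 x))%:E * f x))%E.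
  rewrite -[LHS]mul1e -integral_cst// [LHS]integral_mkcond [RHS]integral_mkcond.
  apply: eq_integral => x _; rewrite !patchE /f patchE.
  case: ifPn => [/set_mem[Ox bx]|nZ].
    rewrite mem_set// -EFinM mulfV// gt_eqF// /enorm sqrtr_gt0.
    by case: Ox.
  by case: ifPn; rewrite ?mule0.
rewrite EI.
transitivity (\int[@lebesgue_measure R]_(y in [set 0%R])
    (\int[@hausdorff1 R]_(x in O `&` b @^-1` [set y]) f x))%E; last exact: integral_set1.
rewrite [RHS]integral_mkcond; apply: eq_integral => y _; rewrite patchE.
case: ifPn => // /negP; rewrite inE => y0.
apply: integral0_eq => x [Ox bx]; rewrite /f patchE memNset// => -[_ /= b0].
by apply: y0; rewrite /= -bx.
Qed.

End degenerate.

(** * Directions of the field *)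

Section geometry.
Context {R : realType}.
Variables (Omega : set (R * R)) (v : R * R -> R * R).
Hypothesis oO : open Omega.
Local Notation a := (v1 v).
Local Notation b := (v2 v).
Variables (a1 a2 b1 b2 : R * R -> R).
Hypothesis aC : C1_on Omega a a1 a2.
Hypothesis bC : C1_on Omega b b1 b2.
Local Notation F1 := (flux1 a a1 b b1).
Local Notation F2 := (flux2 a a2 b b2).
Local Notation int2 D f := (\int[@lebesgue2 R]_(x in D) (f x)%:E)%E.

(** A partial derivative of [v / |v|] is orthogonal to [v] and has length equal to the corresponding
    component of [|F|] divided by [|v|^2]. The proof is a direct computation, with [n = |v|] treated
    as an atom subject to [n ^+ 2 = a ^+ 2 + b ^+ 2]. *)
Lemma jacobian_direction x : Omega x -> 0 < enorm (v x) ->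
  enorm (v x) ^+ 2 * jacobian_norm (direction v) x = fluxn a a1 a2 b b1 b2 x.
Proof.
move=> Ox vx; pose O := Omega `&` [set x | 0 < a x * a x + b x * b x].
have VC : C1_on Omega (fun x => a x * a x + b x * b x)
    (fun x => (a x * a1 x + a x * a1 x) + (b x * b1 x + b x * b1 x))
    (fun x => (a x * a2 x + a x * a2 x) + (b x * b2 x + b x * b2 x)).
  move=> z Oz; have [d1 d2 c c1 c2] := C1_on_mul aC aC Oz; have [d1' d2' c' c1' c2'] := C1_on_mul bC bC Oz.
  by split; [exact: is_deriveD|exact: is_deriveD|exact: continuousD|exact: continuousD|exact: continuousD].
have OO : O `<=` Omega by move=> z [].
have Ox' : O x by split => //=; move: vx; rewrite /enorm sqrtr_gt0.
have nC : C1_on O (fun x => (Num.sqrt (a x * a x + b x * b x))^-1)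
    (fun x => - (Num.sqrt (a x * a x + b x * b x)) ^- 2 * (2 * Num.sqrt (a x * a x + b x * b x))^-1
      * ((a x * a1 x + a x * a1 x) + (b x * b1 x + b x * b1 x)))
    (fun x => - (Num.sqrt (a x * a x + b x * b x)) ^- 2 * (2 * Num.sqrt (a x * a x + b x * b x))^-1
      * ((a x * a2 x + a x * a2 x) + (b x * b2 x + b x * b2 x))).
  apply: (@C1_on_comp R O _ _ _ (fun t => (Num.sqrt t)^-1) (fun t => - (Num.sqrt t) ^- 2 * (2 * Num.sqrt t)^-1)).
    exact: C1_onS VC.
  move=> z [_ /= Vz]; have sz : Num.sqrt (a z * a z + b z * b z) != 0 by rewrite gt_eqF// sqrtr_gt0.
  split; first exact: is_deriveV sz (is_derive1_sqrt Vz).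
  apply: continuousM.
    apply: continuousN; apply: continuousV; first by rewrite expf_neq0.
    by apply: (@continuous_comp _ _ _ Num.sqrt (fun t => t ^+ 2)); [exact: sqrt_continuous|exact: exprn_continuous].
  apply: continuousV; first by rewrite mulf_neq0.
  by apply: continuousM; [exact: cvg_cst|exact: sqrt_continuous].
have [d11 d12 _ _ _] := C1_on_mul nC (C1_onS OO aC) Ox'.
have [d21 d22 _ _ _] := C1_on_mul nC (C1_onS OO bC) Ox'.
rewrite /jacobian_norm /grad /=.
have E1 : (fun z => (direction v z).1) = (fun x => (Num.sqrt (a x * a x + b x * b x))^-1 * a x) by [].
have E2 : (fun z => (direction v z).2) = (fun x => (Num.sqrt (a x * a x + b x * b x))^-1 * b x) by [].
rewrite E1 E2; move: d11 d12 d21 d22 => [_ ->] [_ ->] [_ ->] [_ ->].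
have n2 : Num.sqrt (a x * a x + b x * b x) ^+ 2 = a x * a x + b x * b x.
  by rewrite sqr_sqrtr// ltW//; case: Ox'.
rewrite -[enorm (v x)]/(Num.sqrt (a x * a x + b x * b x)) in vx *.
set n := Num.sqrt (a x * a x + b x * b x) in n2 vx *.
have n0 : n != 0 by rewrite gt_eqF.
rewrite /dot /=.
have n2' : n ^+ 2 = Num.sqrt ((n ^+ 2) ^+ 2) by rewrite sqrtr_sqr ger0_norm// sqr_ge0.
rewrite {1}n2' -sqrtrM ?sqr_ge0// /fluxn; congr Num.sqrt.
have kA (p q r : R) : n^-1 * r + p * (- n ^- 2 * (2 * n)^-1 * q) = (r * n ^+ 2 - p * q / 2) / n ^+ 3.
  by field.
rewrite !kA n2 /flux1 /flux2.
have n6 : (n ^+ 3) ^+ 2 = (a x * a x + b x * b x) ^+ 3 by rewrite -n2 -!exprM.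
have n30 : n ^+ 3 != 0 by rewrite expf_neq0.
have V0 : a x * a x + b x * b x != 0 by rewrite -n2 expf_neq0.
have mm (p : R) : p / n ^+ 3 * (p / n ^+ 3) = p ^+ 2 / (a x * a x + b x * b x) ^+ 3.
  by rewrite -n6; field.
rewrite !mm; field.
exact: V0.
Qed.

Lemma direction0 x : ~ (0 < enorm (v x)) -> enorm (v x) = 0.
Proof. by move=> h; apply/eqP; rewrite eq_le enorm_ge0 andbT leNgt; apply/negP. Qed.

Lemma energy_edens D : D `<=` Omega -> energy v D = int2 D (edens a a1 a2 b b1 b2).
Proof.
move=> DO; apply: eq_integral => x; rewrite inE => /DO Ox; congr EFin.
have E : edens a a1 a2 b b1 b2 x = fluxn a a1 a2 b b1 b2 x ^+ 2 / enorm (v x) ^+ 2.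
  by rewrite /edens sqr_enorm sqr_sqrtr// addr_ge0 ?sqr_ge0.
have [v0|/direction0 v0] := pselect (0 < enorm (v x)).
  by rewrite E -(jacobian_direction Ox v0); field; rewrite gt_eqF.
by rewrite E v0 expr0n mul0r invr0 mulr0.
Qed.

Lemma measurable_edens : measurable_fun (Omega : set (borel_plane R)) (edens a a1 a2 b b1 b2).
Proof.
have cV x : Omega x -> {for x, continuous (fun x => a x ^+ 2 + b x ^+ 2)}.
  move=> Ox; have [_ _ ca _ _] := aC Ox; have [_ _ cb _ _] := bC Ox.
  by apply: continuousD; exact: continuousM.
pose nz : set (borel_plane R) := Omega `&` [set x | 0 < a x ^+ 2 + b x ^+ 2].
have onz : open (nz : set (R * R)).
  rewrite openE => x [Ox Vx]; apply: filterI; first exact: open_nbhs_nbhs.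
  by move: (cV x Ox [set x | 0 < x]); apply; apply: open_nbhs_nbhs; split => //; exact: open_gt.
have mnz : measurable nz by exact: open_borel_plane.
have mf : measurable_fun nz (edens a a1 a2 b b1 b2).
  apply: continuous_on_measurable => // x [Ox Vx].
  have [_ _ ca ca1 ca2] := aC Ox; have [_ _ cb cb1 cb2] := bC Ox.
  apply: continuousM.
    have c1 : {for x, continuous F1} by apply: continuousB; exact: continuousM.
    have c2 : {for x, continuous F2} by apply: continuousB; exact: continuousM.
    by apply: continuousD; exact: continuousM.
  by apply: continuousV; [rewrite gt_eqF|exact: cV].
have mr : measurable_fun setT (edens a a1 a2 b b1 b2 \_ nz) by apply/(measurable_restrictT _ mnz).
apply: (@eq_measurable_fun _ _ _ _ _ (edens a a1 a2 b b1 b2 \_ nz)); last exact: measurable_funTS.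
move=> x; rewrite inE => Ox; rewrite patchE; case: ifPn => // /negP; rewrite inE => nx.
have V0 : a x ^+ 2 + b x ^+ 2 = 0.
  apply/eqP; rewrite eq_le addr_ge0 ?sqr_ge0// andbT leNgt.
  by apply/negP => h; apply: nx.
by rewrite /edens V0 invr0 mulr0.
Qed.

(* On [b = 0] the flux is [a grad b]: it vanishes at the critical points of [b], and by the
   coarea formula the other points form a null set. *)
Lemma energy_zero : energy v (Omega `&` [set x | b x = 0]) = 0%E.
Proof.
have mb : measurable_fun (Omega : set (borel_plane R)) b.
  by apply: continuous_on_measurable oO _ => x Ox; have [_ _ cb _ _] := bC Ox.
have mO : measurable (Omega : set (borel_plane R)) by exact: open_borel_plane.
pose Z : set (borel_plane R) := Omega `&` [set x | b x = 0].
have mZ : measurable Z by exact: (mb mO _ (measurable_set1 (0 : measurableTypeR R))).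
rewrite energy_edens; last by move=> x [].
have mE : measurable_fun Z (edens a a1 a2 b b1 b2).
  by apply: measurable_funS measurable_edens => // x [].
pose Z' : set (borel_plane R) := Omega `&` [set x | (b1 x, b2 x) != 0] `&` [set x | b x = 0].
have Z'Z : Z' `<=` Z by move=> x [[]].
have mZ' : measurable Z'.
  pose O := Omega `&` [set x | 0 < b1 x ^+ 2 + b2 x ^+ 2].
  have -> : Z' = (O : set (borel_plane R)) `&` Z.
    apply/seteqP; split => [x [[Ox /= h] bx]|x [[Ox /= h] [_ bx]]]; split => //; split => //=.
      rewrite lt_neqAle addr_ge0 ?sqr_ge0// andbT eq_sym; apply: contra h.
      by rewrite paddr_eq0 ?sqr_ge0// !sqrf_eq0 => /andP[/eqP -> /eqP ->].
    by apply/negP => /eqP[e1 e2]; rewrite e1 e2 expr0n addr0 ltxx in h.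
  apply: measurableI => //; apply: open_borel_plane.
  rewrite openE => x [Ox bx]; have [_ _ _ c1 c2] := bC Ox; apply: filterI.
    exact: open_nbhs_nbhs.
  have cs : {for x, continuous (fun x => b1 x ^+ 2 + b2 x ^+ 2)}.
    by apply: continuousD; exact: continuousM.
  by move: (cs [set x | 0 < x]); apply; apply: open_nbhs_nbhs; split => //; exact: open_gt.
transitivity (int2 Z' (edens a a1 a2 b b1 b2)).
  rewrite [LHS]integral_mkcond [RHS]integral_mkcond; apply: eq_integral => x _; rewrite !patchE.
  case: ifPn => [/set_mem Zx|nZ]; last first.
    by rewrite ifN//; apply: contra nZ => /set_mem h; apply: mem_set; exact: Z'Z.
  case: ifPn => // /negP; rewrite inE => nZ'.
  have [e1 e2] : b1 x = 0 /\ b2 x = 0.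
    have : (b1 x, b2 x) = 0 by apply: contrapT => /eqP h; apply: nZ'; case: Zx.
    by case.
  by case: Zx => _ /= bx; rewrite /edens /flux1 /flux2 e1 e2 bx !mulr0 !mul0r subrr expr0n addr0 mul0r.
apply: null_set_integral => //; last exact: (critical_null oO bC).
by apply/measurable_EFinP; apply: measurable_funS mE.
Qed.

(** On an open half circle a direction is determined by its slope; this identifies [Sigma] with a
    level set of [slope]. *)
Lemma direction_slope (p q y1 y2 : R) : y1 ^+ 2 + y2 ^+ 2 = 1 -> 0 < y2 ->
  [/\ 0 < Num.sqrt (p ^+ 2 + q ^+ 2), (Num.sqrt (p ^+ 2 + q ^+ 2))^-1 * p = y1 &
     (Num.sqrt (p ^+ 2 + q ^+ 2))^-1 * q = y2] <-> 0 < q /\ p / q = y1 / y2.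
Proof.
move=> y12 y20; split.
  set n := Num.sqrt _ => -[n0 e1 e2].
  have q0 : 0 < q by rewrite -(pmulr_rgt0 q (x := n^-1)) ?invr_gt0// e2.
  by split => //; rewrite -e1 -e2; field; rewrite !gt_eqF.
move=> [q0 e].
have pE : p = q / y2 * y1.
  have qn0 : q != 0 by rewrite gt_eqF.
  by rewrite -[LHS](divfK qn0) e mulrC mulrA mulrAC.
have nE : Num.sqrt (p ^+ 2 + q ^+ 2) = q / y2.
  have -> : p ^+ 2 + q ^+ 2 = (q / y2) ^+ 2 * (y1 ^+ 2 + y2 ^+ 2).
    by rewrite pE; field; rewrite gt_eqF.
  by rewrite y12 mulr1 sqrtr_sqr gtr0_norm// divr_gt0.
rewrite nE divr_gt0//; split => //.
  by rewrite pE; field; rewrite !gt_eqF.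
by field; rewrite !gt_eqF.
Qed.

(* The half plane [0 < q] in the target, seen in the rotated or reflected
   coordinates (p, q) = Y v. *)
Theorem frakk_half_plane (p p1 p2 q q1 q2 : R * R -> R) (Y : R * R -> R * R) :
  tame Omega p p1 p2 q q1 q2 ->
  (forall x, (p x, q x) = Y (v x)) -> injective Y ->
  (forall c u, Y (c *: u) = c *: Y u) -> (forall u, (Y u).1 ^+ 2 + (Y u).2 ^+ 2 = u.1 ^+ 2 + u.2 ^+ 2) ->
  (forall x, flux1 p p1 q q1 x ^+ 2 + flux2 p p2 q q2 x ^+ 2 = F1 x ^+ 2 + F2 x ^+ 2) ->
  exists2 c : R, energy v (pos Omega q) = (c * pi)%:E &
    exists N : set (measurableTypeR R), [/\ measurable N, lebesgue_measure N = 0%E &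
      forall y, circle y -> 0 < (Y y).2 -> ~ N ((Y y).1 / (Y y).2) -> frakk Omega v y = c%:E].
Proof.
move=> t pqY Yinj YZ Yn FE.
have [c _ [[N [mN N0 hN]] eN]] := level_const t.
have pE x : p x = (Y (v x)).1 by rewrite -pqY.
have qE x : q x = (Y (v x)).2 by rewrite -pqY.
have en x : enorm (v x) = Num.sqrt (p x ^+ 2 + q x ^+ 2).
  by rewrite pE qE Yn -sqr_enorm sqrtr_sqr ger0_norm// enorm_ge0.
have fl x : fluxn p p1 p2 q q1 q2 x = fluxn a a1 a2 b b1 b2 x by rewrite /fluxn FE.
exists c.
  rewrite -eN energy_edens; last by move=> x [].
  apply: eq_integral => x _; congr EFin; rewrite /edens FE; congr (_ / _).
  by rewrite pE qE Yn.
exists N; split => // y cy y2 yN; rewrite -(hN _ yN) /frakk /level.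
have y12 : (Y y).1 ^+ 2 + (Y y).2 ^+ 2 = 1.
  by rewrite Yn -sqr_enorm (cy : enorm y = 1) expr1n.
have -> : Sigma Omega v y = pos Omega q `&` slope p q @^-1` [set (Y y).1 / (Y y).2].
  apply/seteqP; split => x.
    move=> [Ox vx dx].
    have := (direction_slope (p x) (q x) y12 y2).1; rewrite -en => h.
    have [|q0 sl] := h; last by split; first split.
    by rewrite -dx YZ /= -pqY.
  move=> [[Ox q0] sl].
  have := (direction_slope (p x) (q x) y12 y2).2 (conj q0 sl); rewrite -en => -[v0 e1 e2].
  split => //; apply: Yinj; rewrite YZ -pqY; apply: injective_projections => /=.
    exact: e1.
  exact: e2.
apply: eq_integral => x; rewrite inE => -[[Ox q0] _]; congr EFin.
rewrite fl; apply: jacobian_direction => //.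
by rewrite en sqrtr_gt0 ltr_wpDl ?sqr_ge0// exprn_gt0.
Qed.

End geometry.

(** * The circle *)

Section circle.
Context {R : realType}.
Local Notation leb := (@lebesgue_measure R).

Lemma null_negligible (N : set R) : leb N = 0%E <-> leb.-negligible N.
Proof. by split => [h|h]; apply/negligible_outer_measure. Qed.

Lemma null_sub (A B : set R) : A `<=` B -> leb B = 0%E -> leb A = 0%E.
Proof.
move=> AB B0; apply/eqP; rewrite eq_le -{1}B0 le_leb//=.
Qed.

Lemma null_setU (A B : set R) : leb A = 0%E -> leb B = 0%E -> leb (A `|` B) = 0%E.
Proof. by move=> A0 B0; apply/null_negligible; apply: negligibleU; exact/null_negligible. Qed.

(** Within a quarter turn of [phi] the shifted tangent is expanding, and a sign does not affect
    this. *)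
Lemma null_tan (phi u w : R) (c : R -> R) (N : set R) : phi - pi / 2 <= u -> w <= phi + pi / 2 ->
  (forall t, u < t < w -> c t = tan (t - phi)) \/ (forall t, u < t < w -> c t = - tan (t - phi)) ->
  leb N = 0%E -> leb (`]u, w[%classic `&` c @^-1` N) = 0%E.
Proof.
move=> hu hw hc N0; apply: null_preimage => // t t'; rewrite /= !in_itv /= => ht ht'.
apply: le_trans (tan_expanding (phi := phi) _ _) _.
- by move: ht => /andP[? ?]; apply/andP; split; lra.
- by move: ht' => /andP[? ?]; apply/andP; split; lra.
by case: hc => E; rewrite (E t ht) (E t' ht') // -opprD normrN.
Qed.

Lemma sinBpi (t : R) : sin (t - pi) = - sin t.
Proof. by rewrite sinB cospi sinpi; ring. Qed.

Lemma cosBpi (t : R) : cos (t - pi) = - cos t.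
Proof. by rewrite cosB cospi sinpi; ring. Qed.

Lemma cot_tanBpihalf (t : R) : cos t / sin t = - tan (t - pi / 2).
Proof. by rewrite /tan sinBpihalf cosBpihalf mulNr opprK. Qed.

Lemma cot_tanDpihalf (t : R) : cos t / - sin t = tan (t - - (pi / 2)).
Proof. by rewrite opprK /tan sinDpihalf cosDpihalf. Qed.

Lemma cot_tanBpiDpihalf (t : R) : cos t / - sin t = tan (t - (pi + pi / 2)).
Proof. by rewrite opprD addrA /tan sinBpihalf cosBpihalf sinBpi cosBpi opprK. Qed.

Lemma sin_lt0 (t : R) : pi < t < 2 * pi -> sin t < 0.
Proof.
move=> /andP[t1 t2]; rewrite -oppr_gt0 -sinBpi; apply: sin_gt0_pi.
by apply/andP; split; lra.
Qed.

Lemma circle_cos_sin (t : R) : circle (cos t, sin t).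
Proof.
have h : enorm (cos t, sin t) ^+ 2 = 1 ^+ 2 by rewrite sqr_enorm /= cos2Dsin2 expr1n.
by apply/eqP; rewrite -(@eqrXn2 _ 2) ?enorm_ge0// h.
Qed.

(** The exceptional directions are those whose slope lies in [N] or [N'], and the points with
    [y.2 = 0]. In terms of the angle, the slope is up to sign a shifted tangent, so the exceptional
    slopes form a null set of angles. *)
Lemma ae_arc_length (N N' : set (measurableTypeR R)) (P : R * R -> Prop) :
  measurable N -> leb N = 0%E -> measurable N' -> leb N' = 0%E ->
  (forall y, circle y -> 0 < y.2 -> ~ N (y.1 / y.2) -> P y) ->
  (forall y, circle y -> y.2 < 0 -> ~ N' (y.1 / - y.2) -> P y) ->
  (forall y, ~ circle y -> P y) ->
  {ae arc_length, forall y, P y}.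
Proof.
move=> mN N0 mN' N'0 hup hlow hout.
pose up := [set y : R * R | 0 < y.2]; pose low := [set y : R * R | 0 < - y.2].
have oup : open up by apply: open_superlevel => y; exact: cvg_snd.
have olow : open low by apply: open_superlevel => y; apply: cvgN; exact: cvg_snd.
have mup : measurable_fun (up : set (borel_plane R)) (fun y => y.1 / y.2).
  apply: continuous_on_measurable => // y uy; apply: continuousM; first exact: cvg_fst.
  by apply: continuousV; [rewrite gt_eqF|exact: cvg_snd].
have mlow : measurable_fun (low : set (borel_plane R)) (fun y => y.1 / - y.2).
  apply: continuous_on_measurable => // y uy; apply: continuousM; first exact: cvg_fst.
  by apply: continuousV; [rewrite gt_eqF|apply: continuousN; exact: cvg_snd].
have m1 := mup (open_borel_plane oup) _ mN; have m2 := mlow (open_borel_plane olow) _ mN'.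
have m3 : measurable ([set y : R * R | y.2 = 0] : set (borel_plane R)).
  have -> : [set y : R * R | y.2 = 0] = ~` (up `|` low).
    apply/seteqP; split => y /=; rewrite /up /low /=.
      by move=> ->; rewrite oppr0 ltxx; case.
    by move=> /not_orP[/negP + /negP]; rewrite oppr_gt0 -!leNgt => h1 h2; apply/eqP; rewrite eq_le h1.
  by apply: measurableC; apply: open_borel_plane; exact: openU.
exists ((up `&` (fun y => y.1 / y.2) @^-1` N) `|` (low `&` (fun y => y.1 / - y.2) @^-1` N') `|` [set y | y.2 = 0]).
split; first by apply: measurableU => //; exact: measurableU.
  (* The angles 0 and pi are split off; on the open intervals between them [sin] has a constant
     sign. *)
  apply: (@null_sub _ ((`]0, pi[%classic `&` (fun t => cos t / sin t) @^-1` N) `|`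
    (`]pi, 2 * pi[%classic `&` (fun t => cos t / - sin t) @^-1` N') `|` [set 0] `|` [set pi])).
    move=> t [/= /andP[t0 t2p]]; rewrite /up /low /= !in_itv /=.
    have [t0'|t0'] := eqVneq t 0; first by move=> _; left; right.
    have [tp|tp] := eqVneq t pi; first by move=> _; right.
    have {}t0' : 0 < t by rewrite lt_neqAle eq_sym t0' t0.
    have [tp'|tp'] := ltP t pi.
      have s0 : 0 < sin t by apply: sin_gt0_pi; rewrite t0' tp'.
      move=> [[[_ h]|[h _]]|h]; last by rewrite h ltxx in s0.
        by left; left; left; rewrite t0'.
      by rewrite oppr_gt0 ltNge (ltW s0) in h.
    have {}tp : pi < t by rewrite lt_neqAle eq_sym tp tp'.
    have s0 : sin t < 0 by apply: sin_lt0; rewrite tp t2p.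
    move=> [[[h _]|[_ h]]|h]; last by rewrite h ltxx in s0.
      by have := lt_trans s0 h; rewrite ltxx.
    by left; left; right; rewrite tp t2p.
  have p0 := pi_gt0 R.
  apply: null_setU; last exact: lebesgue_measure_set1.
  apply: null_setU; last exact: lebesgue_measure_set1.
  apply: null_setU.
    by apply: (@null_tan (pi / 2)) => //; [lra|lra|right => t _; exact: cot_tanBpihalf].
  by apply: (@null_tan (pi + pi / 2)) => //; [lra|lra|left => t _; exact: cot_tanBpiDpihalf].
move=> y /= nP; have [cy|/hout//] := pselect (circle y).
have [y0|y0|y0] := ltgtP y.2 0; last by right.
  left; right; split; first by rewrite /low /= oppr_gt0.
  by apply: contrapT => h; apply: nP; exact: hlow.
left; left; split => //.
by apply: contrapT => h; apply: nP; exact: hup.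
Qed.

Lemma null_avoid (u w : R) (E E' : set R) : u < w -> leb E = 0%E -> leb E' = 0%E ->
  exists t, [/\ u < t < w, ~ E t & ~ E' t].
Proof.
move=> uw E0 E'0; apply: contrapT => h.
have : leb `]u, w[%classic = 0%E.
  apply: (@null_sub _ (E `|` E')); last exact: null_setU.
  move=> t /=; rewrite in_itv /= => tuw; apply: contrapT => /not_orP[nE nE'].
  by apply: h; exists t.
rewrite lebesgue_measure_itv /= lte_fin uw -EFinB => -[] /eqP.
by rewrite subr_eq0 gt_eqF.
Qed.

End circle.

Theorem proposition5p1 (R : realType) (Omega : set (R * R))
  (v : R * R -> R * R)
  (hOmega : [\/ Omega = setT, Omega = halfplane | Omega = strip])
  (hC1 : C1_closure Omega (fun x => (v x).1) /\
         C1_closure Omega (fun x => (v x).2))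
  (hdiv : div_free Omega (flux v))
  (hbdry : forall x : R * R, (closure Omega `\` Omega) x -> (v x).2 = 0)
  (hfin : (flux_energy v Omega < +oo)%E)
  (hgrowth : exists2 C : R, 0 < C & forall r : R, 100 < r ->
    [/\ Omega = setT ->
          (sup_norm v (disk r)
             <= (C * Num.sqrt (ln r))%:E)%E,
        Omega = halfplane ->
          (sup_norm v (halfplane `&` disk r)
             <= (C * Num.sqrt (ln r))%:E)%E &
        Omega = strip ->
          (sup_norm v (`[- r, r] `*` `[-1, 1])%R
             <= (C * Num.sqrt r)%:E)%E]) :
  (Omega = setT ->
     {ae arc_length, forall y : R * R, circle y ->
        frakk Omega v y = ((2 * pi)^-1%:E * energy v Omega)%E}) /\
  (Omega = strip \/ Omega = halfplane ->
     {ae arc_length, forall y : R * R, upper_semicircle y ->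
        frakk Omega v y =
          (pi^-1%:E * energy v (Omega `&` [set x | (0 <= (v x).2)%R]))%E} /\
     {ae arc_length, forall y : R * R, lower_semicircle y ->
        frakk Omega v y =
          (pi^-1%:E * energy v (Omega `&` [set x | ((v x).2 <= 0)%R]))%E}).
Proof.
have oO := domain_open hOmega.
have t := tame_field hOmega hC1 hdiv hbdry hfin hgrowth.
have aC := tame_C1a t; have bC := tame_C1b t.
pose a := v1 v; pose b := v2 v; pose a1 := d1v1 v; pose a2 := d2v1 v; pose b1 := d1v2 v; pose b2 := d2v2 v.
have tN : tame Omega a a1 a2 (fun x => - b x) (fun x => - b1 x) (fun x => - b2 x).
  apply: (tameN t) => M e e0; apply: compact_superlevel e0.
    by move=> x; apply: cvgN; case: hC1.2 => c _; exact: c.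
  by move=> x /hbdry bx; rewrite /b /v2 bx oppr0.
have [c Ec [N [mN N0 hN]]] : exists2 c : R, energy v (pos Omega b) = (c * pi)%:E &
    exists N : set (measurableTypeR R), [/\ measurable N, lebesgue_measure N = 0%E &
      forall y, circle y -> 0 < y.2 -> ~ N (y.1 / y.2) -> frakk Omega v y = c%:E].
  have pair x : (a x, b x) = id (v x) by rewrite /a /b /v1 /v2; case: (v x).
  by apply: (@frakk_half_plane R Omega v _ _ _ _ aC bC _ _ _ _ _ _ id t pair).
pose flip (u : R * R) : R * R := (u.1, - u.2).
have [c' Ec' [N' [mN' N'0 hN']]] : exists2 c : R, energy v (pos Omega (fun x => - b x)) = (c * pi)%:E &
    exists N : set (measurableTypeR R), [/\ measurable N, lebesgue_measure N = 0%E &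
      forall y, circle y -> 0 < - y.2 -> ~ N (y.1 / - y.2) -> frakk Omega v y = c%:E].
  have pair x : (a x, - b x) = flip (v x) by [].
  apply: (@frakk_half_plane R Omega v _ _ _ _ aC bC _ _ _ _ _ _ flip tN pair).
  - by move=> [u1 u2] [w1 w2] [-> /oppr_inj ->].
  - by move=> k u; rewrite /flip; apply: injective_projections; rewrite //= scalerN.
  - by move=> u; rewrite /flip /= sqrrN.
  - by move=> x; rewrite /flux1 /flux2 -/a -/a1 -/a2 -/b -/b1 -/b2; ring.
have mb : measurable_fun (Omega : set (borel_plane R)) b.
  by apply: continuous_on_measurable oO _ => x Ox; have [_ _ cb _ _] := bC x Ox.
have mO : measurable (Omega : set (borel_plane R)) by exact: open_borel_plane.
pose Z : set (borel_plane R) := Omega `&` [set x | b x = 0].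
have mZ : measurable Z by exact: (mb mO _ (measurable_set1 (0 : measurableTypeR R))).
have mp : measurable (pos Omega b : set (borel_plane R)) := measurable_pos t.
have mn : measurable (pos Omega (fun x => - b x) : set (borel_plane R)) := measurable_pos tN.
(* The zero set of [v2] belongs to both closed sets in the statement, whereas [pos] is defined by a
   strict inequality; since it carries no energy, the two agree. *)
have EZ : energy v Z = 0%E by exact: (energy_zero oO aC bC).
have mE := measurable_edens oO aC bC.
have energyU (A B : set (borel_plane R)) : measurable A -> measurable B -> A `<=` Omega -> B `<=` Omega ->
    (forall x, A x -> ~ B x) -> energy v (A `|` B) = (energy v A + energy v B)%E.
  move=> mA mB AO BO AB; rewrite !(energy_edens aC bC)//; last by move=> x [/AO|/BO].
  rewrite ge0_integral_setU//.
  - by apply/measurable_EFinP; apply: measurable_funS mE => // x [/AO|/BO].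
  - by move=> x _; rewrite lee_fin edens_ge0.
  - by rewrite disj_set2E; apply/eqP/seteqP; split => // x [/AB h /h].
have Eup : energy v (Omega `&` [set x | 0 <= (v x).2]) = (c * pi)%:E.
  have -> : Omega `&` [set x | 0 <= (v x).2] = pos Omega b `|` Z.
    apply/seteqP; split => [x [Ox /=]|x [[Ox /= bx]|[Ox /= bx]]]; last 2 first.
    - by split => //=; exact: ltW.
    - by split => //=; rewrite -/(v2 v x) -/b bx.
    by rewrite le_eqVlt => /predU1P[bx|bx]; [right|left]; split.
  rewrite energyU//; first by rewrite Ec EZ adde0.
  - by move=> x [].
  - by move=> x [].
  - by move=> x [_ /= bx] [_ /= bx0]; rewrite bx0 ltxx in bx.
have Elow : energy v (Omega `&` [set x | (v x).2 <= 0]) = (c' * pi)%:E.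
  have -> : Omega `&` [set x | (v x).2 <= 0] = pos Omega (fun x => - b x) `|` Z.
    apply/seteqP; split => [x [Ox /=]|x [[Ox /= bx]|[Ox /= bx]]]; last 2 first.
    - by split => //=; rewrite -oppr_ge0 ltW.
    - by split => //=; rewrite -/(v2 v x) -/b bx.
    rewrite le_eqVlt => /predU1P[bx|bx]; [right|left]; split => //=.
    by rewrite oppr_gt0.
  rewrite energyU//; first by rewrite Ec' EZ adde0.
  - by move=> x [].
  - by move=> x [].
  - by move=> x [_ /= bx] [_ /= bx0]; rewrite bx0 oppr0 ltxx in bx.
have pin0 : pi != 0 :> R by rewrite gt_eqF// pi_gt0.
split; last first.
  move=> _; split.
    rewrite Eup -EFinM mulrC mulfK//.
    apply: (ae_arc_length mN N0 mN' N'0) => [y cy y2 yN _|y cy y2 _ [_ /= y2']|y cy [/cy]//].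
      exact: hN.
    by rewrite leNgt y2 in y2'.
  rewrite Elow -EFinM mulrC mulfK//.
  apply: (ae_arc_length mN N0 mN' N'0) => [y cy y2 _ [_ /= y2']|y cy y2 yN _|y cy [/cy]//].
    by rewrite leNgt y2 in y2'.
  by apply: hN' => //; rewrite oppr_gt0.
move=> OT.
(* In the plane the closure adds no points, so [v1] satisfies the boundary condition vacuously and
   can take the place of [v2]. *)
have tS : tame Omega b b1 b2 a a1 a2.
  apply: (tame_swap t) => M e e0; apply: compact_superlevel e0; first by case: hC1.1.
  by move=> x [_]; rewrite OT; case.
have [d _ [Nd [mNd Nd0 hNd]]] : exists2 c : R, energy v (pos Omega a) = (c * pi)%:E &
    exists N : set (measurableTypeR R), [/\ measurable N, lebesgue_measure N = 0%E &
      forall y, circle y -> 0 < y.1 -> ~ N (y.2 / y.1) -> frakk Omega v y = c%:E].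
  have pair x : (b x, a x) = swap (v x) by [].
  apply: (@frakk_half_plane R Omega v _ _ _ _ aC bC _ _ _ _ _ _ (@swap R) tS pair) => //.
  - exact: can_inj swapK.
  - by move=> u; rewrite /swap /= addrC.
  - by move=> x; rewrite /flux1 /flux2 -/a -/a1 -/a2 -/b -/b1 -/b2; ring.
have p0 := pi_gt0 R.
(* The half circles [v1 > 0] and [v2 > 0], and also [v1 > 0] and [v2 < 0], share a quarter circle. *)
have cd : c = d.
  have h1 : lebesgue_measure (`]0, pi / 2[%classic `&` (fun t => cos t / sin t) @^-1` N) = 0%E.
    by apply: (@null_tan R (pi / 2)) N0; [lra|lra|right => s _; exact: cot_tanBpihalf].
  have h2 : lebesgue_measure (`]0, pi / 2[%classic `&` (fun t => sin t / cos t) @^-1` Nd) = 0%E.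
    by apply: (@null_tan R 0) Nd0; [lra|lra|left => s _; rewrite subr0].
  have [|s [/andP[s0 s1] n1 n2]] := @null_avoid R 0 (pi / 2) _ _ _ h1 h2; first by rewrite divr_gt0.
  have si : 0 < sin s by apply: sin_gt0_pi; apply/andP; split; lra.
  have co : 0 < cos s by apply: cos_gt0_pihalf; apply/andP; split; lra.
  have e1 : frakk Omega v (cos s, sin s) = c%:E.
    by apply: hN (circle_cos_sin s) si _ => h; apply: n1; split => //=; rewrite in_itv /= s0.
  have e2 : frakk Omega v (cos s, sin s) = d%:E.
    by apply: hNd (circle_cos_sin s) co _ => h; apply: n2; split => //=; rewrite in_itv /= s0.
  by move: e2; rewrite e1 => -[].
have c'd : c' = d.
  have h1 : lebesgue_measure (`]-(pi / 2), 0[%classic `&` (fun t => cos t / - sin t) @^-1` N') = 0%E.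
    by apply: (@null_tan R (- (pi / 2))) N'0; [lra|lra|left => s _; exact: cot_tanDpihalf].
  have h2 : lebesgue_measure (`]-(pi / 2), 0[%classic `&` (fun t => sin t / cos t) @^-1` Nd) = 0%E.
    by apply: (@null_tan R 0) Nd0; [lra|lra|left => s _; rewrite subr0].
  have [|s [/andP[s0 s1] n1 n2]] := @null_avoid R (- (pi / 2)) 0 _ _ _ h1 h2; first by lra.
  have si : 0 < - sin s by rewrite -sinN; apply: sin_gt0_pi; apply/andP; split; lra.
  have co : 0 < cos s by apply: cos_gt0_pihalf; apply/andP; split; lra.
  have e1 : frakk Omega v (cos s, sin s) = c'%:E.
    by apply: hN' (circle_cos_sin s) si _ => h; apply: n1; split => //=; rewrite in_itv /= s0.
  have e2 : frakk Omega v (cos s, sin s) = d%:E.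
    by apply: hNd (circle_cos_sin s) co _ => h; apply: n2; split => //=; rewrite in_itv /= s0.
  by move: e2; rewrite e1 => -[].
(* The two half planes of the target contribute [c * pi] and [c' * pi], with [c = c']; hence the
   factor [2 * pi]. *)
have E : energy v Omega = (2 * pi * c)%:E.
  have OE : Omega = (Omega `&` [set x | 0 <= (v x).2]) `|` pos Omega (fun x => - b x).
    apply/seteqP; split => [x Ox|x [[]//|[]//]].
    by have [bx|bx] := leP 0 (v x).2; [left|right; split; rewrite //= oppr_gt0].
  rewrite OE energyU//.
  - by rewrite Eup Ec' -EFinD cd c'd; congr EFin; ring.
  - have -> : Omega `&` [set x | 0 <= (v x).2] = Omega `&` (b @^-1` `[0, +oo[).
      by apply/seteqP; split => x [Ox /=] h; split => //; move: h; rewrite /= in_itv /= andbT.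
    exact: (mb mO _ (measurable_itv _)).
  - by move=> x [].
  - by move=> x [_ /= bx] [_ /=]; rewrite oppr_gt0 ltNge bx.
rewrite E -EFinM mulrA mulVf ?mul1r; last by rewrite mulf_neq0.
apply: (ae_arc_length mN N0 mN' N'0) => [y cy y2 yN _|y cy y2 yN _|y cy /cy//].
  exact: hN.
by rewrite cd -c'd; apply: hN' => //; rewrite oppr_gt0.
Qed.
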